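(* Let $c_2>0$ be a numerical constant. For all sufficiently small $\varepsilon>\delta>0$ and every integer $K\ge1$ there is a constant $C_{\varepsilon,\delta,K}$ such that the following holds. Assume: (2) $r>C_{\varepsilon,\delta,K}$ is an odd number and $\bar V>\exp(r^2)$ is real; (3) $\lambda_0\in[0,8]\setminus J_r^{\bar V}$; (4) $R_0\ge R_1\ge\cdots\ge R_6\ge\exp(c_2r)$ are scales with $R_k^{1-2\delta}\ge R_{k+1}\ge R_k^{1-\frac12\varepsilon}$ for $0\le k\le5$, and $R_0,R_3$ are $r$-dyadic scales; (5) $Q\subset\mathbb Z^2$ is an $r$-dyadic box of length $R_0$; (6) $Q_1',\dots,Q_K'\subset Q$ are $r$-dyadic boxes, each of length $R_3$; (7) $G\subset\bigcup_kQ_k'$ with $0<|G|\le R_0^\delta$; (8) $\Theta\subset Q$ and $Q\setminus\Theta=\bigcup_{b\in D}\Omega_r(b)$ for some $D\subset\dot r\mathbb Z^2\cap Q$; (9) $\Theta$ is $\varepsilon_0^{1/5}$-regular in every box $Q'\subset Q\setminus\bigcup_kQ_k'$ of length $R_6$; (10) $V':\Theta\to\{0,\bar V\}$ satisfies: for any $V:Q\to\{0,\bar V\}$ with $V|_\Theta=V'$, any $\lambda\in[\lambda_0-\bar V^{-R_5},\lambda_0+\bar V^{-R_5}]$, any $t\in[0,1]$ and any set $\mathcal R$ of $r$-bits inside $Q$ that do not affect $\Theta\cup\bigcup_kQ_k'$, each $Q_r(b)\in\mathcal R$ is admissible, and $H_Q^{\mathcal R,t}u=\lambda u$ implies $$\bar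 V^{R_4}\|u\|_{\ell^2(Q\setminus\bigcup_kQ_k')}\le\|u\|_{\ell^2(Q)}\le(1+R_0^{-\delta})\|u\|_{\ell^2(G)}.$$ Then, with $\{V(a)\}$ i.i.d. and $\mathbb P[V(a)=0]=\mathbb P[V(a)=\bar V]=\frac12$, $$\mathbb P\left[\|(H_Q-\lambda_0)^{-1}\|\le\bar V^{R_1}\ \big|\ V|_\Theta=V'\right]\ge1-R_0^{10\varepsilon-\frac12}.$$
   Context: Lattice and operators. For $a\in\mathbb Z^2$, $|a|=\|a\|_\infty$. $\mathbb Z^2$ is the nearest-neighbour graph: $a\sim b$ iff $\|a-b\|_1=1$; paths and connectedness refer to it. $\Delta u(a)=-4u(a)+\sum_{b\sim a}u(b)$, $H=-\Delta+V$. For finite $S\subset\mathbb Z^2$, $H_S=P_SHP_S^\dagger$ is the Dirichlet restriction to $\ell^2(S)$ (matrix entries $H_S(b,b)=4+V(b)$, $H_S(b,c)=-1$ if $b\sim c$, $0$ otherwise; similarly $(-\Delta)_S$). $\|\cdot\|$ is the operator norm. For real $l\ge1$, $Q_l(a)=\{a'\in\mathbb Z^2:|a-a'|\le\frac{l-1}2\}$ and $Q_l=Q_l(0)$; ''a box of length $L$'' means a box $Q_L(a)$. Boundaries. $\partial^+S=\{a\notin S:a\sim b\text{ for some }b\in S\}$, $\partial^-S=\{a\in S:a\sim b\text{ for some }b\notin S\}$, and $\partial S$ is the set of edges $\{a,b\}$ with $a\in\partial^+S$, $b\in\partial^-S$, $a\sim b$. Tilted squares and regularity. A tilted rectangle is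 $R_{I,J}=\{(x,y)\in\mathbb Z^2:x+y\in I,\ x-y\in J\}$ with $I,J\subset\mathbb Z$ intervals; it is a tilted square if $|I|=|J|$. $\mathcal D_k^\pm=\{(x,y)\in\mathbb Z^2:x\pm y=k\}$. A set $\Theta\subset\mathbb Z^2$ is $\eta$-sparse in a tilted rectangle $R$ if $|\mathcal D_k^\varsigma\cap\Theta\cap R|\le\eta|\mathcal D_k^\varsigma\cap R|$ for all $k\in\mathbb Z$ and both signs $\varsigma\in\{+,-\}$. $\Theta$ is $\eta$-regular in a set $E\subset\mathbb Z^2$ if $\sum_k|\tilde Q_k|\le\eta|E|$ whenever $\tilde Q_1,\dots,\tilde Q_n\subset E$ are disjoint tilted squares in each of which $\Theta$ is not $\eta$-sparse. The constant $\varepsilon_0$. $\varepsilon_0>0$ is a fixed small constant with $\varepsilon_0<\varepsilon_1^{10}$, where $\varepsilon_1\in(0,\frac1{100})$ is a numerical constant with the following property: for every $\varepsilon\le\varepsilon_1$ there is $\alpha>1$ such that, whenever $Q\subset\mathbb Z^2$ is a box with $\ell(Q)\ge\alpha$ (where $\ell(Q_l(a))=2\lfloor\frac{l-1}2\rfloor$), $\Theta\subset Q$ is $\varepsilon$-regular in $Q$, $\bar V\ge2$, $\lambda_0\in[0,8]$ and $V':\Theta\to\{0,\bar V\}$, then conditionally on $V|_\Theta=V'$, with probability at least $1-\exp(-\varepsilon\ell(Q)^{2/3})$ one has: any $\lambda,u$ with $|\lambda-\lambda_0|\le(\ell(Q)\bar V)^{-\alpha\ell(Q)}$, $Hu=\lambda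 u$ in $Q$ and $|u|\le1$ in a $1-\varepsilon^3$ fraction of $Q\setminus\Theta$ satisfy $|u|\le(\ell(Q)\bar V)^{\alpha\ell(Q)}$ in $\frac1{100}Q$ (where $kQ_l(a)=Q_{kl}(a)$). $r$-bits. For odd $r$, $\dot r=\lceil(1-\frac{\varepsilon_0}2)(r-1)\rceil$ and $\dot r\mathbb Z^2=\{(\dot rx,\dot ry):x,y\in\mathbb Z\}$. For $a\in\dot r\mathbb Z^2$: $\Omega_r(a)=Q_{(1-2\varepsilon_0)r}(a)$, $\tilde\Omega_r(a)=Q_{(1-\frac32\varepsilon_0)r}(a)$, $F_r(a)=Q_r(a)\setminus\Omega_r(a)$. The boxes $Q_r(a)$, $a\in\dot r\mathbb Z^2$, are called $r$-bits. Given $V$ on $F_r(a)$, $Q_r(a)$ is admissible if (i) for all $x\in\partial^-Q_r(a)$ and $y\in F_r(a)$ with $|x-y|\ge\frac{\varepsilon_0}{30}r$ there is no path in $F_r(a)$ joining $x$ to $y$ on all of whose vertices $V=0$; and (ii) there is no path in $F_r(a)$ joining a vertex of $\partial^+\Omega_r(a)$ to a vertex of $\partial^-\tilde\Omega_r(a)$ on all of whose vertices $V=0$. An $r$-bit is inside $S$ if $Q_r(a)\subset S$; it does not affect $S$ if $\Omega_r(a)\cap S=\emptyset$. $S_r(a)$ is the maximal connected subset of $\Omega_r(a)\cup\{b\in F_r(a):V(b)=0\}$ containing $\Omega_r(a)$. $r$-dyadic boxes and cutting. $Q_L(a)$ is $r$-dyadic (and $L$ an $r$-dyadic scale) if for some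 positive integer $k$, $a\in2^k\dot r\mathbb Z^2$ and $L=2^{k+1}\dot r+r$. For an $r$-dyadic box $Q$, $V:Q\to\{0,\bar V\}$, a set $\mathcal R$ of admissible $r$-bits inside $Q$ and $t\in[0,1]$, $H_Q^{\mathcal R,t}$ on $\ell^2(Q)$ has entries $H_Q^{\mathcal R,t}(b,c)=t-1$ if $\{b,c\}\in\bigcup_{Q_r(a')\in\mathcal R}\partial S_r(a')$ and $H_Q^{\mathcal R,t}(b,c)=H_Q(b,c)$ otherwise. Exceptional energies. $Eig_r=\bigcup\{\sigma((-\Delta)_S):S\subset Q_r\text{ connected}\}$ and $J_r^{U}=\bigcup_{x\in Eig_r}[x-U^{-1/4},x+U^{-1/4}]$ for $U>1$. *)

(* Defs.v *)
From HB Require Import structures.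
From mathcomp Require Import all_boot all_order all_algebra finmap.
From mathcomp Require Import all_classical all_reals all_analysis.

Set Implicit Arguments.
Unset Strict Implicit.
Unset Printing Implicit Defensive.

Import Order.TTheory GRing.Theory Num.Theory.
Import numFieldNormedType.Exports.

Local Open Scope classical_set_scope.
Local Open Scope ring_scope.

Notation site := (int * int)%type.

Definition adj : rel site :=
  fun a b => `|a.1 - b.1| + `|a.2 - b.2| == 1.

Definition distoo (a b : site) : int := Num.max `|a.1 - b.1| `|a.2 - b.2|.

(* Cardinality of a finite set of sites; the junk value 0 on infinite sets is
   never reached below. *)
Definition num_sites (A : set site) : nat := #|` fset_set A |%fset.

(* p is the list of vertices of the path after its starting point x *)
Definition joined (A : set site) (x y : site) : Prop :=
  exists p : seq site,
    [/\ path adj x p, last x p = y & forall c, c \in x :: p -> A c].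

Definition connected_graph (A : set site) : Prop :=
  forall x y, A x -> A y -> joined A x y.

Definition outer_bd (S : set site) : set site :=
  [set a | ~ S a /\ exists2 b, S b & adj a b].

Definition inner_bd (S : set site) : set site :=
  [set a | S a /\ exists2 b, ~ S b & adj a b].

(* Edges are encoded as unordered pairs [set a; b]. *)
Definition edge_bd (S : set site) : set (set site) :=
  [set e | exists a b, [/\ e = [set a; b], outer_bd S a, inner_bd S b & adj a b]].

Definition lattice (m : int) : set site :=
  [set a | exists x y : int, a = (m * x, m * y)].

Definition tilted_rect (I J : interval int) : set site :=
  [set a | a.1 + a.2 \in I /\ a.1 - a.2 \in J].

Definition tilted_square (A : set site) : Prop :=
  exists I J : interval int, ([set` I] #= [set` J])%card /\ A = tilted_rect I J.

(* The diagonals D_k^+ (s = true) and D_k^- (s = false). *)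
Definition diagonal (s : bool) (k : int) : set site :=
  [set a | (if s then a.1 + a.2 else a.1 - a.2) = k].

Section Reals.
Context {R : realType}.
Implicit Types (a b c : site) (S A E Theta : set site) (V u : site -> R).

Definition box (l : R) a : set site :=
  [set b | (distoo a b)%:~R <= (l - 1) / 2].

Definition sparse (eta : R) Theta A : Prop :=
  forall (k : int) (s : bool),
    (num_sites (diagonal s k `&` Theta `&` A))%:R
      <= eta * (num_sites (diagonal s k `&` A))%:R.

Definition regular (eta : R) Theta E : Prop :=
  forall (n : nat) (T : 'I_n -> set site),
    (forall i, [/\ tilted_square (T i), T i `<=` E & ~ sparse eta Theta (T i)]) ->
    trivIset setT T ->
    \sum_(i < n) (num_sites (T i))%:R <= eta * (num_sites E)%:R.

Definition laplacian u a : R := - 4 * u a + \sum_(b \in [set b | adj a b]) u b.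

Definition schrodinger V u a : R := - laplacian u a + V a * u a.

Definition kernelH V b c : R :=
  if b == c then 4 + V b else if adj b c then -1 else 0.

(* l^2(S) is the space of column vectors indexed by 'I_(num_sites S); index i
   stands for the site (site_of S i), in the enumeration of fset_set S. *)
Definition site_of S (i : 'I_(num_sites S)) : site := nth (0, 0) (fset_set S) i.
Arguments site_of : clear implicits.

Definition restrict_mx S (k : site -> site -> R) : 'M[R]_(num_sites S) :=
  \matrix_(i, j) k (site_of S i) (site_of S j).

Definition dirichletH S V : 'M[R]_(num_sites S) := restrict_mx S (kernelH V).

(* eigenvalue refers to row vectors; the matrices used here are symmetric. *)
Definition spectrum n (M : 'M[R]_n) : set R := [set x | eigenvalue M x].

Definition l2norm n (u : 'cV[R]_n) : R := Num.sqrt (\sum_i u i 0 ^+ 2).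

(* Norm in l^2(E) of the restriction to E of a vector of l^2(S). *)
Definition l2norm_on S E (u : 'cV[R]_(num_sites S)) : R :=
  Num.sqrt (\sum_(i | site_of S i \in E) u i 0 ^+ 2).

Definition opnorm n (M : 'M[R]_n) : R :=
  sup [set y | exists2 u : 'cV[R]_n, l2norm u <= 1 & y = l2norm (M *m u)].

(* || (M - lambda)^{-1} || <= B, with || (M - lambda)^{-1} || = +oo when
   lambda is in the spectrum of M. *)
Definition resolvent_le n (M : 'M[R]_n) (lambda B : R) : Prop :=
  (M - lambda%:M \in unitmx) /\ opnorm (invmx (M - lambda%:M)) <= B.

(* An r-bit Q_r(a), and hence a set of r-bits, is given by its centre(s). *)

Definition rdot (eps0 : R) (r : nat) : int :=
  Num.ceil ((1 - eps0 / 2) * (r%:R - 1)).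

Definition Omega (eps0 : R) (r : nat) a : set site := box ((1 - 2 * eps0) * r%:R) a.

Definition tOmega (eps0 : R) (r : nat) a : set site :=
  box ((1 - 3 / 2 * eps0) * r%:R) a.

Definition frame (eps0 : R) (r : nat) a : set site :=
  box r%:R a `\` Omega eps0 r a.

Definition zeros V : set site := [set b | V b = 0].

Definition admissible (eps0 : R) (r : nat) V a : Prop :=
  (forall x y, inner_bd (box r%:R a) x -> frame eps0 r a y ->
     eps0 / 30 * r%:R <= (distoo x y)%:~R ->
     ~ joined (frame eps0 r a `&` zeros V) x y) /\
  (forall x y, outer_bd (Omega eps0 r a) x -> inner_bd (tOmega eps0 r a) y ->
     ~ joined (frame eps0 r a `&` zeros V) x y).

(* The maximal connected subset is obtained as the union of all of them. *)
Definition cluster (eps0 : R) (r : nat) V a : set site :=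
  [set x | exists T : set site,
     [/\ Omega eps0 r a `<=` T,
         T `<=` Omega eps0 r a `|` (frame eps0 r a `&` zeros V),
         connected_graph T & T x]].

Definition dyadic_scale (eps0 : R) (r : nat) (L : R) : Prop :=
  exists k : nat, (0 < k)%N /\ L = (2 ^+ k.+1 * rdot eps0 r)%:~R + r%:R.

(* The box of length L centred at a is r-dyadic. *)
Definition dyadic_box (eps0 : R) (r : nat) (L : R) a : Prop :=
  exists k : nat, [/\ (0 < k)%N, lattice (2 ^+ k * rdot eps0 r) a
    & L = (2 ^+ k.+1 * rdot eps0 r)%:~R + r%:R].

Definition cut_kernel (eps0 : R) (r : nat) V (Rb : set site) (t : R) b c : R :=
  if `[< exists2 a, Rb a & edge_bd (cluster eps0 r V a) [set b; c] >]
  then t - 1 else kernelH V b c.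

Definition cutH (eps0 : R) (r : nat) Q V (Rb : set site) (t : R) :
  'M[R]_(num_sites Q) := restrict_mx Q (cut_kernel eps0 r V Rb t).

Definition Eig (r : nat) : set R :=
  [set x | exists S : set site, [/\ S `<=` box r%:R (0, 0), connected_graph S
     & spectrum (dirichletH S (fun=> 0)) x]].

Definition Jset (r : nat) (U : R) : set R :=
  [set y | exists2 x, Eig r x &
     x - U `^ (- (1 / 4)) <= y <= x + U `^ (- (1 / 4))].

Definition two_valued (Vbar : R) A V : Prop := forall a, A a -> V a = 0 \/ V a = Vbar.

(* (V a) is a family of i.i.d. {0, Vbar}-valued variables, each value having
   probability 1/2; mutual independence is the product rule over finite
   families. *)
Definition iid_potential d (T : measurableType d) (P : probability T R)
    (Vbar : R) (V : site -> {RV P >-> R}) : Prop :=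
  [/\ forall a w, V a w = 0 \/ V a w = Vbar,
      forall a, P (V a @^-1` [set 0]) = (2^-1)%:E,
      forall a, P (V a @^-1` [set Vbar]) = (2^-1)%:E
    & forall (F : {fset site}) (B : site -> set R),
        (forall a, measurable (B a)) ->
        fine (P (\bigcap_(a in [set` F]) (V a @^-1` B a)))
          = \prod_(a <- F) fine (P (V a @^-1` B a))].

Definition cond_prob d (T : measurableType d) (P : probability T R)
  (A B : set T) : R := fine (P (A `&` B)) / fine (P B).

Definition ell (l : R) : R := 2 * (Num.floor ((l - 1) / 2))%:~R.

Definition continuation_event (eps alpha l : R) a Theta (Vbar lambda0 : R) V : Prop :=
  forall (lambda : R) u,
    `|lambda - lambda0| <= (ell l * Vbar) `^ (- (alpha * ell l)) ->
    (forall x, box l a x -> schrodinger V u x = lambda * u x) ->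
    (1 - eps ^+ 3) * (num_sites (box l a `\` Theta))%:R
      <= (num_sites [set x | (box l a `\` Theta) x /\ `|u x| <= 1])%:R ->
    forall x, box (1 / 100 * l) a x -> `|u x| <= (ell l * Vbar) `^ (alpha * ell l).

(* The property required of the constant epsilon_1. *)
Definition unique_continuation (eps1 : R) : Prop :=
  forall eps : R, 0 < eps -> eps <= eps1 ->
  exists2 alpha : R, 1 < alpha &
  forall (a : site) (l : R) (Theta : set site) (Vbar lambda0 : R) (V' : site -> R),
    1 <= l -> alpha <= ell l ->
    Theta `<=` box l a -> regular eps Theta (box l a) ->
    2 <= Vbar -> 0 <= lambda0 <= 8 -> two_valued Vbar Theta V' ->
  forall d (T : measurableType d) (P : probability T R) (V : site -> {RV P >-> R}),
    iid_potential Vbar V ->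
    1 - expR (- (eps * ell l `^ (2 / 3))) <=
    cond_prob P
      [set w | continuation_event eps alpha l a Theta Vbar lambda0 (fun x => V x w)]
      [set w | forall x, Theta x -> V x w = V' x].

End Reals.

(* Main.v *)
Require Import Defs.
From mathcomp Require Import all_boot all_order all_algebra finmap complex.
From mathcomp Require Import ring lra zify.
From mathcomp Require Import all_classical all_reals all_analysis.

Set Implicit Arguments.
Unset Strict Implicit.
Unset Printing Implicit Defensive.

Import Order.TTheory GRing.Theory Num.Theory.
Import numFieldNormedType.Exports.

(** Write A(X) for the Dirichlet operator on Q whose potential is Vbar exactly on
    the configuration X, and let m = 4|G|.  Conditioning on V = V' on Theta leaves
    a uniform configuration X among those compatible with V', so the claim is a
    count of the configurations for which A(X) has an eigenvalue within
    Vbar^(-R_1) of lambda_0.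

    Eigenvectors have many large entries.  A normalised eigenvector u has an entry
    of size at least 1/R_0.  The eigenvalue equation transports it, with the loss
    of a factor of order Vbar per step, to the centre of a box of length R_6 that
    avoids the boxes Q'_k (reach_clear_box).  If u were small on most of this box
    outside Theta, the continuation event would make u too small at the centre.
    So either this event fails, which is improbable, or |u| > Vbar^(-R_2) on a
    positive fraction of the box outside Theta (peak_sites).  Those sites lie in
    cells Omega_r(b) of bits b that do not meet the Q'_k, and by pigeonhole there
    is one offset o such that u is large at 2g of the sites b + o, where g is of
    order R_6^2/r^2 (resonance_dichotomy).

    Resonances are rare on a fibre.  Freeze V except on the set J of the sites
    b + o, so that X is encoded by Y in the cube of subsets of J.  The number of Y
    for which A(Y) has an eigenvector as above is at most a polynomial in m times
    |J| C(|J|, |J|/2) / g (fiber_bound), that is, of order R_0 2^|J| / g up to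
    small powers of R_0.  This gives the power -1/2 with room to spare.

    The proof of fiber_bound compares A(Y) with the operator A(Y) + B in which the
    boundary edges of the clusters of the free bits are cut.  For all intermediate
    operators A(Y) + tB the eigenvectors with eigenvalue in the window
    |lambda - lambda_0| <= Vbar^(-R_5) live on G and are tiny on the cut edges.
    Hence the window contains at most m eigenvalues (card_window_loc), and the
    numbers of eigenvalues of A(Y) and of A(Y) + B above levels in the window
    differ by at most m (count_ge_two_ends).  For A(Y) + B the sites of J lie in
    different blocks; at a generic level each site x of J moves one eigenvalue
    across the level or none, whatever the rest of Y is, so the count is
    N + |K :&: Y| for a fixed K in J (decoupled_count).  Therefore the count of
    A(Y) minus |K :&: Y| takes at most 2m + 1 values.  On the other hand, by
    interlacing, this difference is nondecreasing in the symmetric difference of Y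
    and K, and it increases strictly when one adds a coordinate at which the
    eigenvector of an isolated resonance is large (rel_count_strict).  The
    resonant Y with a given value of the difference thus form a Sperner family
    with at least g forbidden directions at each member, and such families are
    small (sperner_bound).  Isolation comes from a pigeonhole over m + 1 disjoint
    annuli around lambda_0 whose radii grow fast (gap_exists); if most large
    entries sit at coordinates that already belong to the symmetric difference,
    the argument is applied to - A(Y), as a function of the complement of Y. *)

Module SpectralCombinatorics.
Import mathcomp.boot.fintype mathcomp.boot.finset.
Local Open Scope ring_scope.

(** * Quadratic forms and diagonalisation *)

Section Forms.
Context {R : rcfType}.

Definition dotr n (f g : 'rV[R]_n) : R := (f *m g^T) 0 0.
Definition qform n (A : 'M[R]_n) (f : 'rV[R]_n) : R := dotr (f *m A) f.

Lemma dotrE n (f g : 'rV[R]_n) : dotr f g = \sum_i f 0 i * g 0 i.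
Proof. by rewrite /dotr mxE; apply: eq_bigr => i _; rewrite mxE. Qed.

Lemma dotrC n (f g : 'rV[R]_n) : dotr f g = dotr g f.
Proof. by rewrite !dotrE; apply: eq_bigr => i _; rewrite mulrC. Qed.

Lemma dotrDl n (f g h : 'rV[R]_n) : dotr (f + g) h = dotr f h + dotr g h.
Proof. by rewrite /dotr mulmxDl mxE. Qed.

Lemma dotrZl n a (f h : 'rV[R]_n) : dotr (a *: f) h = a * dotr f h.
Proof. by rewrite /dotr -scalemxAl mxE. Qed.

Lemma dotrDr n (f g h : 'rV[R]_n) : dotr h (f + g) = dotr h f + dotr h g.
Proof. by rewrite dotrC dotrDl !(dotrC h). Qed.

Lemma dotrZr n a (f h : 'rV[R]_n) : dotr h (a *: f) = a * dotr h f.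
Proof. by rewrite dotrC dotrZl dotrC. Qed.

Lemma dotr_ge0 n (f : 'rV[R]_n) : 0 <= dotr f f.
Proof. by rewrite dotrE; apply: sumr_ge0 => i _; rewrite -expr2 sqr_ge0. Qed.

Lemma dotr_eq0 n (f : 'rV[R]_n) : (dotr f f == 0) = (f == 0).
Proof.
apply/idP/eqP => [|->]; last by rewrite /dotr mul0mx mxE.
rewrite dotrE psumr_eq0 => [/allP h|i _]; last by rewrite -expr2 sqr_ge0.
apply/rowP => i; rewrite mxE; apply/eqP.
by have := h i (mem_index_enum i); rewrite -expr2 sqrf_eq0.
Qed.

Lemma dotr_mulmx n p (f : 'rV[R]_n) (A : 'M[R]_(n, p)) (g : 'rV[R]_p) :
  dotr (f *m A) g = dotr f (g *m A^T).
Proof. by rewrite /dotr trmx_mul trmxK mulmxA. Qed.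

Lemma dotr_sym n (A : 'M[R]_n) f g : A^T = A ->
  dotr (f *m A) g = dotr (g *m A) f.
Proof. by move=> sA; rewrite dotr_mulmx sA dotrC. Qed.

Lemma entry_sqr_le n (f : 'rV[R]_n) i : f 0 i ^+ 2 <= dotr f f.
Proof.
rewrite dotrE (bigD1 i) //= expr2 lerDl.
by apply: sumr_ge0 => j _; rewrite -expr2 sqr_ge0.
Qed.

Lemma qformDl n (A B : 'M[R]_n) f : qform (A + B) f = qform A f + qform B f.
Proof. by rewrite /qform mulmxDr dotrDl. Qed.

Lemma qformZl n a (A : 'M[R]_n) f : qform (a *: A) f = a * qform A f.
Proof. by rewrite /qform -scalemxAr dotrZl. Qed.

Lemma qformN n (A : 'M[R]_n) f : qform (- A) f = - qform A f.
Proof. by rewrite -scaleN1r qformZl mulN1r. Qed.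

Lemma qformZr n (A : 'M[R]_n) a f : qform A (a *: f) = a ^+ 2 * qform A f.
Proof. by rewrite /qform -scalemxAl dotrZl dotrZr mulrA expr2. Qed.

Lemma qformD n (A : 'M[R]_n) f g : A^T = A ->
  qform A (f + g) = qform A f + 2 * dotr (f *m A) g + qform A g.
Proof.
move=> sA; rewrite /qform mulmxDl !dotrDl !dotrDr (dotr_sym g f sA); ring.
Qed.

Definition pdiag n (i : 'I_n) : 'M[R]_n := delta_mx i i.

Lemma pdiag_sym n (i : 'I_n) : (pdiag i)^T = pdiag i.
Proof. by rewrite /pdiag trmx_delta. Qed.

Lemma mul_pdiag n (i : 'I_n) (f : 'rV[R]_n) :
  f *m pdiag i = f 0 i *: delta_mx 0 i.
Proof.
apply/rowP => j; rewrite !mxE (bigD1 i) //= !mxE eqxx /=.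
rewrite big1 ?addr0 //.
by move=> k ki; rewrite mxE (negbTE ki) /= mulr0.
Qed.

Lemma dotr_delta n (i : 'I_n) (f : 'rV[R]_n) : dotr f (delta_mx 0 i) = f 0 i.
Proof.
rewrite dotrE (bigD1 i) //= mxE !eqxx mulr1 big1 ?addr0 // => k ki.
by rewrite mxE (negbTE ki) andbF mulr0.
Qed.

Lemma qform_pdiag n (i : 'I_n) (f : 'rV[R]_n) : qform (pdiag i) f = f 0 i ^+ 2.
Proof. by rewrite /qform mul_pdiag dotrZl dotrC dotr_delta expr2. Qed.

End Forms.

Section Spectral.
Context {R : rcfType}.

(** An eigenvector x + i y of the complexified matrix exists, and symmetry
    forces b (|x|^2 + |y|^2) = 0 for the imaginary part b of its eigenvalue;
    hence the nonzero one of x and y is a real eigenvector. *)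
Lemma sym_real_eigenvector n (A : 'M[R]_n.+1) : A^T = A ->
  exists a, exists2 u : 'rV[R]_n.+1, u != 0 & u *m A = a *: u.
Proof.
move=> sA; pose C : numClosedFieldType := complex.complex R.
pose j : {rmorphism R -> C} := complex.real_complex R.
have [l /eigenvalueP[z zA z0]] := @eigenvalue_closed C n.+1 (map_mx j A) isT.
pose x := map_mx (@complex.Re R) z; pose y := map_mx (@complex.Im R) z.
have key k : complex.Re ((z *m map_mx j A) 0 k) = (x *m A) 0 k /\
   complex.Im ((z *m map_mx j A) 0 k) = (y *m A) 0 k.
  rewrite !mxE; split.
    rewrite (big_morph (@complex.Re R) (id1 := 0) (op1 := +%R)); [|by case=> ? ? [? ?]|by []]; apply: eq_bigr => i _; rewrite !mxE /=.
    by case: (z 0 i) => a b /=; rewrite mulr0 subr0.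
  rewrite (big_morph (@complex.Im R) (id1 := 0) (op1 := +%R)); [|by case=> ? ? [? ?]|by []]; apply: eq_bigr => i _; rewrite !mxE /=.
  by case: (z 0 i) => a b /=; rewrite mulr0 add0r.
case: l zA => a b zA.
have xA : x *m A = a *: x - b *: y.
  apply/rowP => k; rewrite -(key k).1 zA !mxE.
  by case: (z 0 k).
have yA : y *m A = b *: x + a *: y.
  apply/rowP => k; rewrite -(key k).2 zA !mxE.
  by case: (z 0 k) => c d /=; rewrite addrC.
have b0 : b * (dotr x x + dotr y y) = 0.
  have := dotr_sym x y sA; rewrite xA yA -!scaleNr !dotrDl !dotrZl (dotrC y x).
  by move=> h; lra.
have [x0|x0] := eqVneq x 0; last first.
  exists a; exists x => //; rewrite xA.
  have bz : b = 0.
    move/eqP: b0; rewrite mulf_eq0 => /orP[/eqP//|].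
    rewrite paddr_eq0 ?dotr_ge0 // dotr_eq0 => /andP[/eqP x00 _].
    by rewrite x00 eqxx in x0.
  by rewrite bz scale0r subr0.
exists a; exists y; last by rewrite yA x0 scaler0 add0r.
apply: contraNneq z0 => y0; apply/eqP/rowP => k.
have := congr1 (fun M : 'rV_n.+1 => M 0 k) x0.
have := congr1 (fun M : 'rV_n.+1 => M 0 k) y0.
by rewrite !mxE; case: (z 0 k) => c d /= -> ->.
Qed.

(** The reflection that exchanges u and the first basis vector. *)
Lemma orthogonal_completion n (u : 'rV[R]_n.+1) : dotr u u = 1 ->
  exists2 H : 'M[R]_n.+1, H *m H^T = 1%:M & delta_mx 0 0 *m H = u.
Proof.
move=> u1; pose e : 'rV[R]_n.+1 := delta_mx 0 0.
have [w wE] : exists w, w = u - e by exists (u - e).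
have [w0|w0] := eqVneq w 0.
  exists 1%:M; first by rewrite trmx1 mulmx1.
  by rewrite mulmx1; apply/esym/eqP; rewrite -subr_eq0 -wE w0.
have ww0 : dotr w w != 0 by rewrite dotr_eq0.
pose c := 2 / dotr w w.
have wwE' : w *m w^T = (dotr w w)%:M by apply/matrixP=> i j; rewrite !ord1 [RHS]mxE.
have ee1 : dotr e e = 1 by rewrite dotr_delta mxE eqxx.
have ww : dotr w w = - 2 * dotr e w.
  rewrite wE -scaleN1r !dotrDl !dotrDr !dotrZl !dotrZr (dotrC u e) u1 ee1.
  by ring.
have Hsym : (1%:M - c *: (w^T *m w))^T = 1%:M - c *: (w^T *m w).
  by rewrite linearB /= trmx1 linearZ /= trmx_mul trmxK.
exists (1%:M - c *: (w^T *m w)).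
  rewrite Hsym mulmxBl mul1mx mulmxBr mulmx1 -!scalemxAl -!scalemxAr.
  rewrite mulmxA -(mulmxA w^T) wwE' mul_mx_scalar -scalemxAl !scalerA.
  have -> : c * (c * dotr w w) = c + c by rewrite /c divfK // mulrDr mulr1.
  by rewrite scalerDl opprB addrK subrK.
have ewE : e *m w^T = (dotr e w)%:M by apply/matrixP=> i j; rewrite !ord1 [RHS]mxE.
rewrite mulmxBr mulmx1 -scalemxAr mulmxA ewE mul_scalar_mx scalerA.
have -> : c * dotr e w = -1.
  by move: ww0; rewrite /c ww mulf_eq0 negb_or => /andP[_ ?]; field.
by rewrite scaleN1r opprK wE addrC subrK.
Qed.

(** Rotating a unit eigenvector to the first basis vector leaves a symmetric
    block of one dimension less. The conclusion is boolean so that a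
    diagonalisation can be picked by choice. *)
Theorem spectral_symmetric n (A : 'M[R]_n) : A^T = A ->
  exists Pd : 'M[R]_n * 'rV[R]_n,
    (Pd.1 *m Pd.1^T == 1%:M) && (A == Pd.1^T *m diag_mx Pd.2 *m Pd.1).
Proof.
elim: n A => [|n IHn] A sA.
  by exists (1%:M, 0); apply/andP; split; apply/eqP/matrixP=> -[].
have [a [u0 u00 u0A]] := sym_real_eigenvector sA.
pose u := (Num.sqrt (dotr u0 u0))^-1 *: u0.
have d0 : 0 < dotr u0 u0 by rewrite lt_def dotr_ge0 dotr_eq0 u00.
have u1 : dotr u u = 1.
  rewrite /u dotrZl dotrZr mulrA -invfM -expr2 sqr_sqrtr ?ltW // mulVf //.
  by rewrite gt_eqF.
have uA : u *m A = a *: u by rewrite /u -scalemxAl u0A !scalerA mulrC.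
have [H HH eH] := orthogonal_completion u1.
have HH' : H^T *m H = 1%:M by apply: mulmx1C.
have [B BE] : exists B : 'M[R]_(1 + n), B = H *m A *m H^T by exists (H *m A *m H^T).
have sB : B^T = B by rewrite BE !trmx_mul trmxK sA mulmxA.
have eB : (delta_mx 0 0 : 'rV[R]_n.+1) *m B = a *: delta_mx 0 0.
  by rewrite BE !mulmxA eH uA -scalemxAl -eH -mulmxA HH mulmx1.
have B0 j : B 0 j = a *+ (j == 0).
  move/rowP/(_ j): eB; rewrite -rowE !mxE => ->.
  by rewrite eqxx mulr_natr; case: (j == 0).
have Bbl : B = block_mx a%:M 0 0 (drsubmx B).
  rewrite -[LHS]submxK; congr block_mx.
  - apply/matrixP => i j; rewrite !ord1 !mxE.
    have -> : lshift n (0 : 'I_1) = 0 by apply: val_inj.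
    by rewrite B0.
  - apply/matrixP => i j; rewrite !ord1 !mxE.
    have -> : lshift n (0 : 'I_1) = 0 by apply: val_inj.
    by rewrite B0.
  - apply/matrixP => i j; rewrite !ord1 -sB !mxE.
    have -> : lshift n (0 : 'I_1) = 0 by apply: val_inj.
    by rewrite B0.
have [|[P d] /= /andP[/eqP PP /eqP dE]] := IHn (drsubmx B).
  by rewrite -{2}sB -trmx_drsub.
pose Q : 'M[R]_(1 + n) := block_mx 1%:M 0 0 P.
have QQ : Q *m Q^T = 1%:M.
  rewrite /Q tr_block_mx mulmx_block !trmx0 !trmx1 PP.
  by rewrite !mulmx0 !mul0mx !mulmx1 !addr0 add0r -scalar_mx_block.
have QdQ : block_mx a%:M 0 0 (P^T *m diag_mx d *m P) =
    Q^T *m diag_mx (row_mx a%:M d) *m Q.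
  rewrite /Q tr_block_mx diag_mx_row !mulmx_block !trmx0 !trmx1.
  rewrite !mulmx0 !mul0mx !addr0 !mul0mx !mulmx1 !mul1mx !add0r.
  by congr block_mx; apply/matrixP => i j; rewrite !ord1 !mxE eqxx.
exists (Q *m H, row_mx a%:M d); apply/andP; split => /=; apply/eqP.
  by rewrite trmx_mul mulmxA -(mulmxA Q) HH mulmx1 QQ.
have -> : A = H^T *m B *m H by rewrite BE !mulmxA HH' mul1mx -mulmxA HH' mulmx1.
rewrite Bbl dE trmx_mul -!mulmxA; congr (_ *m _); rewrite !mulmxA; congr (_ *m H).
exact: QdQ.
Qed.
End Spectral.

(** * Counting the eigenvalues above a level *)

Section EigenvalueCount.
Context {R : rcfType}.

(** Guarding by symmetry makes the existence unconditional, so that eigbasis and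
    eigvals are total functions of the matrix. *)
Lemma eigdec_exists n (A : 'M[R]_n) :
  exists Pd : 'M[R]_n * 'rV[R]_n, (A^T == A) ==>
    ((Pd.1 *m Pd.1^T == 1%:M) && (A == Pd.1^T *m diag_mx Pd.2 *m Pd.1)).
Proof.
have [/eqP/spectral_symmetric[Pd ?]|] := boolP (A^T == A); last by exists (0, 0).
by exists Pd.
Qed.

Definition eigbasis n (A : 'M[R]_n) : 'M[R]_n := (xchoose (eigdec_exists A)).1.
Definition eigvals n (A : 'M[R]_n) : 'rV[R]_n := (xchoose (eigdec_exists A)).2.

Lemma eigbasis_orth n (A : 'M[R]_n) : A^T = A -> eigbasis A *m (eigbasis A)^T = 1%:M.
Proof.
by move=> /eqP sA; have /implyP/(_ sA)/andP[/eqP] := xchooseP (eigdec_exists A).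
Qed.

Lemma eigbasisE n (A : 'M[R]_n) : A^T = A ->
  A = (eigbasis A)^T *m diag_mx (eigvals A) *m eigbasis A.
Proof.
by move=> /eqP sA; have /implyP/(_ sA)/andP[_ /eqP] := xchooseP (eigdec_exists A).
Qed.

Lemma eigbasis_mul n (A : 'M[R]_n) : A^T = A ->
  eigbasis A *m A = diag_mx (eigvals A) *m eigbasis A.
Proof.
move=> sA; have := congr1 (mulmx (eigbasis A)) (eigbasisE sA).
by rewrite !mulmxA eigbasis_orth // mul1mx.
Qed.

Lemma eigbasis_unit n (A : 'M[R]_n) : A^T = A -> eigbasis A \in unitmx.
Proof. by move=> sA; have [] := mulmx1_unit (eigbasis_orth sA). Qed.

Definition eigvec n (A : 'M[R]_n) i : 'rV[R]_n := row i (eigbasis A).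

Lemma eigvec_mul n (A : 'M[R]_n) i : A^T = A ->
  eigvec A i *m A = eigvals A 0 i *: eigvec A i.
Proof.
by move=> sA; rewrite /eigvec -row_mul eigbasis_mul // row_mul row_diag_mx -scalemxAl -rowE.
Qed.

Lemma eigvec_orth n (A : 'M[R]_n) i j : A^T = A ->
  dotr (eigvec A i) (eigvec A j) = (i == j)%:R.
Proof.
move=> sA; have /matrixP/(_ i j) := eigbasis_orth sA; rewrite !mxE => <-.
by rewrite dotrE; apply: eq_bigr => k _; rewrite !mxE.
Qed.

Lemma dotr_eigbasis n (A : 'M[R]_n) (c e : 'rV[R]_n) : A^T = A ->
  dotr (c *m eigbasis A) (e *m eigbasis A) = dotr c e.
Proof.
by move=> sA; rewrite dotr_mulmx -mulmxA eigbasis_orth // mulmx1.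
Qed.

Lemma qform_eigbasis n (A : 'M[R]_n) (c : 'rV[R]_n) : A^T = A ->
  qform A (c *m eigbasis A) = \sum_i eigvals A 0 i * c 0 i ^+ 2.
Proof.
move=> sA; rewrite /qform -mulmxA eigbasis_mul // mulmxA dotr_eigbasis // dotrE.
by apply: eq_bigr => i _; rewrite mul_mx_diag mxE; ring.
Qed.

Lemma mul_eigbasis n (A : 'M[R]_n) (c : 'rV[R]_n) :
  c *m eigbasis A = \sum_i c 0 i *: eigvec A i.
Proof. by rewrite mulmx_sum_row. Qed.

Definition indic n (I : {set 'I_n}) : 'rV[R]_n := \row_i (i \in I)%:R.

Lemma rank_indic_le n (I : {set 'I_n}) : (\rank (diag_mx (indic I)) <= #|I|)%N.
Proof.
rewrite diag_mx_sum_delta (bigID (mem I)) /= [X in _ + X]big1 ?addr0; last first.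
  by move=> i /negbTE iI; rewrite mxE iI scale0r.
rewrite -sum1_card; elim/big_ind2: _ => [|M m N k hM hN|i iI]; first by rewrite mxrank0.
  by apply: leq_trans (mxrank_add _ _) _; apply: leq_add.
by rewrite mxE iI scale1r mxrank_delta.
Qed.

Lemma rank_indic n (I : {set 'I_n}) : \rank (diag_mx (indic I)) = #|I|.
Proof.
apply/eqP; rewrite eqn_leq rank_indic_le /=.
have h : diag_mx (indic I) + diag_mx (indic (~: I)) = 1%:M.
  apply/matrixP => i j; rewrite !mxE inE; case: (i == j) => //=; last by rewrite addr0.
  by case: (i \in I); rewrite /= ?addr0 ?add0r.
have := mxrank_add (diag_mx (indic I)) (diag_mx (indic (~: I))).
rewrite h mxrank1 => h1.
rewrite -(leq_add2r #|~: I|) cardsC card_ord; apply: leq_trans h1 _.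
by rewrite leq_add2l rank_indic_le.
Qed.

(** The row space is spanned by the eigenvectors with index in I. *)
Definition specspace n (A : 'M[R]_n) (I : {set 'I_n}) : 'M[R]_n :=
  diag_mx (indic I) *m eigbasis A.

Lemma rank_specspace n (A : 'M[R]_n) I : A^T = A -> \rank (specspace A I) = #|I|.
Proof.
by move=> sA; rewrite mxrankMfree ?rank_indic // row_free_unit eigbasis_unit.
Qed.

Lemma specspaceP n (A : 'M[R]_n) I (f : 'rV[R]_n) : (f <= specspace A I)%MS ->
  exists2 c : 'rV[R]_n, f = c *m eigbasis A & forall i, i \notin I -> c 0 i = 0.
Proof.
move=> /submxP[c ->]; exists (c *m diag_mx (indic I)); first by rewrite mulmxA.
by move=> i /negbTE iI; rewrite mul_mx_diag !mxE iI mulr0.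
Qed.

Definition count_ge n (A : 'M[R]_n) (mu : R) : nat :=
  #|[set i | mu <= eigvals A 0 i]|.

Lemma specspace_ge n (A : 'M[R]_n) (I : {set 'I_n}) mu f : A^T = A ->
  (forall i, i \in I -> mu <= eigvals A 0 i) ->
  (f <= specspace A I)%MS -> mu * dotr f f <= qform A f.
Proof.
move=> sA hI /specspaceP[c -> c0].
rewrite qform_eigbasis // dotr_eigbasis // dotrE mulr_sumr.
apply: ler_sum => i _; have [/hI h|/c0->] := boolP (i \in I).
  by rewrite -expr2 ler_wpM2r // sqr_ge0.
by rewrite !mulr0 expr0n /= mulr0.
Qed.

Lemma specspace_lt n (A : 'M[R]_n) (I : {set 'I_n}) mu f : A^T = A ->
  (forall i, i \in I -> eigvals A 0 i < mu) ->
  (f <= specspace A I)%MS -> f != 0 -> qform A f < mu * dotr f f.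
Proof.
move=> sA hI /specspaceP[c -> c0] f0.
rewrite qform_eigbasis // dotr_eigbasis // dotrE mulr_sumr.
have [i ci] : exists i, c 0 i != 0.
  by apply/rV0Pn; apply: contraNneq f0 => ->; rewrite mul0mx.
have iI : i \in I by apply: contraNT ci => /c0->.
rewrite (bigD1 i) //= [ltRHS](bigD1 i) //=; apply: ltr_leD.
  by rewrite -expr2 ltr_pM2r ?hI // exprn_even_gt0.
apply: ler_sum => j _; have [/hI h|/c0->] := boolP (j \in I).
  by rewrite -expr2 ler_wpM2r ?sqr_ge0 // ltW.
by rewrite !mulr0 expr0n /= mulr0.
Qed.

Lemma capmx_rank_nz n m1 m2 (U : 'M[R]_(m1, n)) (W : 'M[R]_(m2, n)) : (n < \rank U + \rank W)%N ->
  exists f : 'rV[R]_n, [/\ (f <= U)%MS, (f <= W)%MS & f != 0].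
Proof.
move=> h; have : (U :&: W)%MS != 0.
  rewrite -mxrank_eq0 -lt0n; have := mxrank_sum_cap U W.
  by have := rank_leq_col (U + W)%MS; lia.
move=> /rowV0Pn[f fUW f0]; exists f; split=> //; apply: submx_trans fUW _.
  exact: capmxSl.
exact: capmxSr.
Qed.

(** Courant-Fischer: a space on which the form is at least mu meets the span of
    the eigenvectors below mu in 0 only, so its dimension is at most the number
    of the others. *)
Lemma count_ge_lower n m (A : 'M[R]_n) mu (U : 'M[R]_(m, n)) : A^T = A ->
  (forall f, (f <= U)%MS -> mu * dotr f f <= qform A f) ->
  (\rank U <= count_ge A mu)%N.
Proof.
move=> sA hU; rewrite leqNgt; apply/negP => lt.
pose I := [set i | mu <= eigvals A 0 i].
have [f [fU fW f0]] : exists f : 'rV[R]_n,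
    [/\ (f <= U)%MS, (f <= specspace A (~: I))%MS & f != 0].
  apply: capmx_rank_nz; rewrite rank_specspace //.
  by rewrite -[ltnLHS](card_ord n) -(cardsC I) ltn_add2r.
suff : qform A f < mu * dotr f f by rewrite ltNge hU.
by apply: specspace_lt fW f0 => // i; rewrite !inE -ltNge.
Qed.

Lemma count_ge_upper n m (A : 'M[R]_n) mu (U : 'M[R]_(m, n)) : A^T = A ->
  (forall f, (f <= U)%MS -> f != 0 -> qform A f < mu * dotr f f) ->
  (count_ge A mu + \rank U <= n)%N.
Proof.
move=> sA hU; rewrite leqNgt; apply/negP => lt.
pose I := [set i | mu <= eigvals A 0 i].
have [f [fU fW f0]] : exists f : 'rV[R]_n,
    [/\ (f <= U)%MS, (f <= specspace A I)%MS & f != 0].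
  by apply: capmx_rank_nz; rewrite rank_specspace // addnC.
suff : mu * dotr f f <= qform A f by rewrite leNgt hU.
by apply: specspace_ge fW => // i; rewrite inE.
Qed.

Lemma count_ge_space n (A : 'M[R]_n) mu : A^T = A ->
  exists2 U : 'M[R]_n, \rank U = count_ge A mu &
   forall f, (f <= U)%MS -> mu * dotr f f <= qform A f.
Proof.
move=> sA; exists (specspace A [set i | mu <= eigvals A 0 i]).
  by rewrite rank_specspace.
by move=> f; apply: specspace_ge => // i; rewrite inE.
Qed.

Lemma count_lt_space n (A : 'M[R]_n) mu : A^T = A ->
  exists2 U : 'M[R]_n, (count_ge A mu + \rank U)%N = n &
   forall f, (f <= U)%MS -> f != 0 -> qform A f < mu * dotr f f.
Proof.
move=> sA; pose I := [set i | mu <= eigvals A 0 i]; exists (specspace A (~: I)).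
  by rewrite rank_specspace // -[RHS](card_ord n) -(cardsC I).
by move=> f; apply: specspace_lt => // i; rewrite !inE -ltNge.
Qed.

Lemma count_ge_mono_mx n (A B : 'M[R]_n) mu nu : A^T = A -> B^T = B ->
  (forall f, qform A f - mu * dotr f f <= qform B f - nu * dotr f f) ->
  (count_ge A mu <= count_ge B nu)%N.
Proof.
move=> sA sB AB; have [U <- hU] := count_ge_space mu sA.
by apply: count_ge_lower => // f /hU h; have := AB f; lra.
Qed.

Lemma count_ge_anti n (A : 'M[R]_n) mu nu : mu <= nu ->
  (count_ge A nu <= count_ge A mu)%N.
Proof.
move=> h; apply/subset_leq_card/subsetP => i; rewrite !inE; exact: le_trans.
Qed.

(** Restricting to the hyperplane f 0 i = 0 costs one dimension, and there a
    change of the i-th diagonal entry is invisible. *)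
Lemma rank_cap_coord n m (U : 'M[R]_(m, n)) (i : 'I_n) :
  exists2 W : 'M[R]_n, (\rank U <= (\rank W).+1)%N &
  forall f : 'rV[R]_n, (f <= W)%MS -> (f <= U)%MS /\ f 0 i = 0.
Proof.
pose H : 'M[R]_n := diag_mx (indic [set~ i]).
exists (U :&: H)%MS.
  have := mxrank_sum_cap U H; have := rank_leq_col (U + H)%MS.
  by rewrite rank_indic cardsC1 card_ord; have := ltn_ord i; lia.
move=> f; rewrite sub_capmx => /andP[-> /submxP[c ->]]; split=> //.
by rewrite mul_mx_diag !mxE !inE eqxx mulr0.
Qed.

Definition bump_mx n (v : R) (i : 'I_n) (A : 'M[R]_n) := A + v *: pdiag i.

Lemma bump_sym n v i (A : 'M[R]_n) : A^T = A -> (bump_mx v i A)^T = bump_mx v i A.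
Proof. by move=> sA; rewrite linearD linearZ /= pdiag_sym sA. Qed.

Lemma qform_bump n v i (A : 'M[R]_n) f :
  qform (bump_mx v i A) f = qform A f + v * f 0 i ^+ 2.
Proof. by rewrite qformDl qformZl qform_pdiag. Qed.

(** Interlacing for a nonnegative rank one perturbation. *)
Lemma count_ge_bump n v i (A : 'M[R]_n) mu : A^T = A -> 0 <= v ->
  (count_ge A mu <= count_ge (bump_mx v i A) mu <= (count_ge A mu).+1)%N.
Proof.
move=> sA v0; have sB := bump_sym v i sA; apply/andP; split.
  apply: count_ge_mono_mx => // f; rewrite qform_bump.
  by have := mulr_ge0 v0 (sqr_ge0 (f 0 i)); lra.
have [U <- hU] := count_ge_space mu sB; have [W hW WP] := rank_cap_coord U i.
apply: leq_trans hW _; rewrite ltnS; apply: count_ge_lower => // f /WP[/hU].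
by rewrite qform_bump => h f0; move: h; rewrite f0 expr0n /= mulr0 addr0.
Qed.

(** With its converse below, this exchanges the two edges of a window:
    eigenvalues of A below a level are eigenvalues of - A above the opposite
    level. *)
Lemma count_geN_ge n (A : 'M[R]_n) mu : A^T = A ->
  (n <= count_ge (- A) (- mu) + count_ge A mu)%N.
Proof.
move=> sA; have sN : (- A)^T = - A by rewrite linearN /= sA.
have [U hU UP] := count_lt_space mu sA.
have : (\rank U <= count_ge (- A) (- mu))%N.
  apply: count_ge_lower => // f fU; rewrite qformN.
  have [->|f0] := eqVneq f 0; last by have := UP f fU f0; lra.
  by rewrite /qform mul0mx /dotr mul0mx mxE mulr0 oppr0.
by lia.
Qed.

Lemma count_geN_le n (A : 'M[R]_n) mu nu : A^T = A -> mu < nu ->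
  (count_ge (- A) (- mu) + count_ge A nu <= n)%N.
Proof.
move=> sA lt; have sN : (- A)^T = - A by rewrite linearN /= sA.
have [U hU UP] := count_ge_space (- mu) sN.
rewrite addnC -hU; apply: count_ge_upper => // f /UP; rewrite qformN => h f0.
have : 0 < dotr f f by rewrite lt_def dotr_ge0 dotr_eq0 f0.
by move=> d0; have : mu * dotr f f < nu * dotr f f; [rewrite ltr_pM2r | lra].
Qed.

End EigenvalueCount.

(** * Changing one diagonal entry *)

Section Perturbation.
Context {R : rcfType}.

Definition spectral_gap n (A : 'M[R]_n) (l0 s s' : R) : Prop :=
  forall mu, eigenvalue A mu -> ~ (s <= `|mu - l0| < s').

Lemma eigvals_eigenvalue n (A : 'M[R]_n) i : A^T = A -> eigenvalue A (eigvals A 0 i).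
Proof.
move=> sA; apply/eigenvalueP; exists (eigvec A i); first exact: eigvec_mul.
by rewrite -dotr_eq0 eigvec_orth // eqxx oner_eq0.
Qed.

Lemma eigenvalueN n (A : 'M[R]_n) mu : eigenvalue (- A) mu = eigenvalue A (- mu).
Proof.
apply/eigenvalueP/eigenvalueP => -[u uA u0]; exists u => //.
  by rewrite scaleNr -uA mulmxN opprK.
by rewrite mulmxN uA scaleNr opprK.
Qed.

Lemma spectral_gapN n (A : 'M[R]_n) l0 s s' :
  spectral_gap A l0 s s' -> spectral_gap (- A) (- l0) s s'.
Proof.
by move=> gap mu; rewrite eigenvalueN opprK => /gap; rewrite -opprD normrN.
Qed.

(** On the span of u and of the eigenvectors above the gap, one dimension larger
    than the count at l0 + s, the form of A - (l0 + s) is coercive up to a loss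
    of 2 s a^2 along u: the orthogonality of the two pieces removes the cross
    term. *)
Lemma gap_space n (A : 'M[R]_n) l0 s s' l (u : 'rV[R]_n) : A^T = A ->
  dotr u u = 1 -> u *m A = l *: u -> `|l - l0| < s -> spectral_gap A l0 s s' ->
  exists2 U : 'M[R]_n, \rank U = (count_ge A (l0 + s)).+1 &
  forall f, (f <= U)%MS -> exists g a, f = g + a *: u /\
    (s' - s) * dotr g g - 2 * s * a ^+ 2 <= qform A f - (l0 + s) * dotr f f.
Proof.
move=> sA u1 uA ls gap.
pose I := [set i | l0 + s <= eigvals A 0 i]; pose E := specspace A I.
have [l_lo l_hi] : - s < l - l0 /\ l - l0 < s by apply/andP; rewrite -ltr_norml.
have IE i : i \in I -> l0 + s' <= eigvals A 0 i.
  rewrite inE leNgt => hi; apply/negP => lt.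
  apply: (gap _ (eigvals_eigenvalue i sA)); rewrite ger0_norm; last by lra.
  by apply/andP; split; lra.
have orth f : (f <= E)%MS -> dotr f u = 0.
  move=> /specspaceP[c -> c0]; rewrite mul_eigbasis.
  rewrite /dotr mulmx_suml summxE big1 // => i _.
  rewrite -scalemxAl mxE -/(dotr _ _).
  have [iI|/c0->] := boolP (i \in I); last by rewrite mul0r.
  have : eigvals A 0 i * dotr (eigvec A i) u = l * dotr (eigvec A i) u.
    by rewrite -dotrZl -eigvec_mul // dotr_sym // uA dotrZl dotrC.
  move/eqP; rewrite -subr_eq0 -mulrBl mulf_eq0 => /orP[|/eqP->].
    by move: iI; rewrite inE => h /eqP; lra.
  by rewrite mulr0.
exists (E + u)%MS.
  have : \rank (E :&: u)%MS = 0%N.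
    apply/eqP; rewrite mxrank_eq0; apply/rowV0P => f.
    rewrite sub_capmx => /andP[/orth fu /sub_rVP[a fE]].
    by move: fu; rewrite fE dotrZl u1 mulr1 => ->; rewrite scale0r.
  have := mxrank_sum_cap E u; rewrite rank_specspace // rank_rV.
  have -> : u != 0 by rewrite -dotr_eq0 u1 oner_eq0.
  by rewrite /count_ge /= => + h0; rewrite h0 addn0 addn1.
move=> f /sub_addsmxP[[c1 c2] /= fE].
have [a aE] : exists a, c2 *m u = a *: u.
  by exists (c2 0 0); rewrite [c2]mx11_scalar mul_scalar_mx mxE eqxx mulr1n.
have gE : (c1 *m E <= E)%MS by exact: submxMl.
exists (c1 *m E), a; rewrite {1}fE aE; split=> //.
rewrite fE aE; set g := c1 *m E in gE *.
have gu := orth _ gE.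
have hg : (l0 + s') * dotr g g <= qform A g by exact: specspace_ge gE.
rewrite qformD // /qform -/(qform A g) -scalemxAl uA !dotrDl !dotrDr !dotrZl !dotrZr.
rewrite (dotr_sym g) // uA !dotrZl (dotrC u g) gu u1.
have a2 : 0 <= a ^+ 2 by exact: sqr_ge0.
have : 0 <= (l - l0 + s) * a ^+ 2 by apply: mulr_ge0 => //; lra.
rewrite /qform in hg *; nra.
Qed.

(** A large entry u 0 x makes the component along u visible in the coordinate f
    0 x, up to the part g. *)
Lemma entry_bound n (A : 'M[R]_n) (f g u : 'rV[R]_n) a x c :
  f = g + a *: u -> 0 <= c -> c <= u 0 x ^+ 2 ->
  a ^+ 2 * c <= 2 * f 0 x ^+ 2 + 2 * dotr g g.
Proof.
move=> -> c0 cu; rewrite !mxE.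
have hg := entry_sqr_le g x.
have : a ^+ 2 * c <= (a * u 0 x) ^+ 2 by rewrite exprMn ler_wpM2l // sqr_ge0.
by have := sqr_ge0 (2 * g 0 x + a * u 0 x); nra.
Qed.

(** If u is large at x, raising the x-th diagonal entry pays for the loss along
    u in gap_space: the resonant eigenvalue is pushed above l0 + s. *)
Lemma count_ge_bump_up n (A : 'M[R]_n) l0 s s' l (u : 'rV[R]_n) x v c : A^T = A ->
  dotr u u = 1 -> u *m A = l *: u -> `|l - l0| < s -> spectral_gap A l0 s s' ->
  0 < c -> c <= u 0 x ^+ 2 -> 8 * s <= v * c -> 8 * s <= (s' - s) * c ->
  ((count_ge A (l0 + s)).+1 <= count_ge (bump_mx v x A) (l0 + s))%N.
Proof.
move=> sA u1 uA ls gap c0 cu vc sc.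
have [U <- hU] := gap_space sA u1 uA ls gap.
have s0 : 0 < s by apply: le_lt_trans ls.
apply: count_ge_lower; first exact: bump_sym.
move=> f /hU[g [a [fE hf]]]; rewrite qform_bump.
have := entry_bound A fE (ltW c0) cu => hx.
suff : 0 <= c * ((s' - s) * dotr g g - 2 * s * a ^+ 2 + v * f 0 x ^+ 2).
  by rewrite pmulr_rge0 //; lra.
have g0 := dotr_ge0 g; have f0 := sqr_ge0 (f 0 x).
have h1 := ler_wpM2r g0 sc; have h2 := ler_wpM2r f0 vc.
have h3 := ler_wpM2l (ltW s0) hx.
have h4 := mulr_ge0 (ltW s0) g0; have h5 := mulr_ge0 (ltW s0) f0.
by lra.
Qed.

(** On the hyperplane f 0 x = 0 the component along u is controlled by the gap
    part, so the space of gap_space loses only the dimension that it had gained,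
    whatever the sign of v. *)
Lemma count_ge_bump_down n (A : 'M[R]_n) l0 s s' l (u : 'rV[R]_n) x v c : A^T = A ->
  dotr u u = 1 -> u *m A = l *: u -> `|l - l0| < s -> spectral_gap A l0 s s' ->
  0 < c -> c <= u 0 x ^+ 2 -> 8 * s <= (s' - s) * c ->
  (count_ge A (l0 + s) <= count_ge (bump_mx v x A) (l0 + s))%N.
Proof.
move=> sA u1 uA ls gap c0 cu sc.
have [U rU hU] := gap_space sA u1 uA ls gap.
have s0 : 0 < s by apply: le_lt_trans ls.
have [W hW WP] := rank_cap_coord U x.
rewrite -ltnS -rU; apply: leq_trans hW _; rewrite ltnS.
apply: count_ge_lower; first exact: bump_sym.
move=> f /WP[/hU[g [a [fE hf]]] fx]; rewrite qform_bump fx expr0n /= mulr0 addr0.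
have := entry_bound A fE (ltW c0) cu; rewrite fx expr0n /= mulr0 add0r => hx.
suff : 0 <= c * ((s' - s) * dotr g g - 2 * s * a ^+ 2).
  by rewrite pmulr_rge0 //; lra.
have g0 := dotr_ge0 g.
have h1 := ler_wpM2r g0 sc; have h3 := ler_wpM2l (ltW s0) hx.
by have h4 := mulr_ge0 (ltW s0) g0; lra.
Qed.

(** Here w 0 x is the x-th diagonal entry of the resolvent at mu. The sign of
    the secular function 1 + v (w 0 x) decides whether raising the diagonal
    entry by v moves an eigenvalue across mu: if it is negative, w can be
    adjoined to the space above mu. *)
Lemma secular_up n (A : 'M[R]_n) mu v x (w : 'rV[R]_n) : A^T = A ->
  w *m (A - mu%:M) = delta_mx 0 x -> 0 < v -> 1 + v * w 0 x < 0 ->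
  ((count_ge A mu).+1 <= count_ge (bump_mx v x A) mu)%N.
Proof.
move=> sA wA v0 neg; set g := w 0 x in neg.
have [E rE hE] := count_ge_space mu sA.
have wf (f : 'rV[R]_n) : dotr (w *m A) f = f 0 x + mu * dotr w f.
  rewrite -[A](subrK mu%:M) mulmxDr wA mul_mx_scalar dotrDl dotrZl.
  by rewrite (dotrC (delta_mx _ _)) dotr_delta.
have qw : qform A w = g + mu * dotr w w by rewrite /qform wf.
have g0 : g < 0 by nra.
have wE : ~~ (w <= E)%MS by apply/negP => /hE; rewrite qw; lra.
have -> : (count_ge A mu).+1 = \rank (E + w)%MS.
  have : \rank (E :&: w)%MS = 0%N.
    apply/eqP; rewrite mxrank_eq0; apply/rowV0P => f.
    rewrite sub_capmx => /andP[fE /sub_rVP[a fa]].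
    have [a0|a0] := eqVneq a 0; first by rewrite fa a0 scale0r.
    by rewrite fa (eqmx_scale _ a0) (negbTE wE) in fE.
  have := mxrank_sum_cap E w; rewrite rE rank_rV.
  have -> : w != 0 by apply: contraNneq wE => ->; exact: sub0mx.
  by rewrite /= => + h0; rewrite h0 addn0 addn1.
apply: count_ge_lower; first exact: bump_sym.
move=> f /sub_addsmxP[[c1 c2] /= fE].
have [a aE] : exists a, c2 *m w = a *: w.
  by exists (c2 0 0); rewrite [c2]mx11_scalar mul_scalar_mx mxE eqxx mulr1n.
have hE' := hE _ (submxMl c1 E).
rewrite fE aE; set h := c1 *m E in hE' *.
rewrite qform_bump qformD // qformZr dotrZr (dotr_sym h) // qw wf.
rewrite !dotrDl !dotrDr !dotrZl !dotrZr.
have -> : (h + a *: w) 0 x = h 0 x + a * g by rewrite mxE [(a *: w) 0 x]mxE.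
rewrite (dotrC h w); set p := h 0 x.
have key : 0 <= v * p ^+ 2 + 2 * a * p * (1 + v * g) + a ^+ 2 * (g * (1 + v * g)).
  (* the discriminant of this form in (p, a) is 1 + v g < 0 *)
  suff : 0 <= v * (v * p ^+ 2 + 2 * a * p * (1 + v * g) + a ^+ 2 * (g * (1 + v * g))).
    by rewrite pmulr_rge0.
  have -> : v * (v * p ^+ 2 + 2 * a * p * (1 + v * g) + a ^+ 2 * (g * (1 + v * g))) =
    (v * p + a * (1 + v * g)) ^+ 2 + a ^+ 2 * (- (1 + v * g)) by ring.
  by rewrite addr_ge0 ?sqr_ge0 // mulr_ge0 ?sqr_ge0 //; lra.
by lra.
Qed.

(** The complementary case: a rank one correction along w maps the space of
    vectors below mu for A injectively into one for the perturbed matrix. *)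
Lemma secular_stay n (A : 'M[R]_n) mu v x (w : 'rV[R]_n) : A^T = A ->
  w *m (A - mu%:M) = delta_mx 0 x -> 0 < v -> 0 < 1 + v * w 0 x ->
  (count_ge (bump_mx v x A) mu <= count_ge A mu)%N.
Proof.
move=> sA wA v0 pos; set g := w 0 x in pos.
have [E rE hE] := count_lt_space mu sA.
pose th := v / (1 + v * g).
have wf (f : 'rV[R]_n) : dotr (w *m A) f = f 0 x + mu * dotr w f.
  rewrite -[A](subrK mu%:M) mulmxDr wA mul_mx_scalar dotrDl dotrZl.
  by rewrite (dotrC (delta_mx _ _)) dotr_delta.
have qw : qform A w = g + mu * dotr w w by rewrite /qform wf.
pose T : 'M[R]_n := 1%:M - th *: (delta_mx x 0 *m w).
have fT f : f *m T = f + (- (th * f 0 x)) *: w.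
  rewrite mulmxBr mulmx1 -scalemxAr mulmxA scaleNr; congr (_ - _).
  by rewrite -colE [col x f]mx11_scalar mul_scalar_mx scalerA mxE.
have step f : (f <= E)%MS -> f != 0 ->
    qform (bump_mx v x A) (f *m T) < mu * dotr (f *m T) (f *m T).
  move=> fE f0; have h := hE f fE f0.
  rewrite fT qform_bump qformD // qformZr dotrZr (dotr_sym f) // qw wf.
  rewrite !dotrDl !dotrDr !dotrZl !dotrZr.
  have -> : (f + (- (th * f 0 x)) *: w) 0 x = f 0 x + - (th * f 0 x) * g.
    by rewrite mxE [(_ *: w) 0 x]mxE.
  rewrite (dotrC f w); set p := f 0 x.
  suff : v * (p + - (th * p) * g) ^+ 2 - 2 * th * p ^+ 2 + (th * p) ^+ 2 * g <= 0 by lra.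
  have thE : th * (1 + v * g) = v by rewrite /th divfK // gt_eqF.
  have th0 : 0 < th by rewrite divr_gt0.
  have -> : v * (p + - (th * p) * g) ^+ 2 - 2 * th * p ^+ 2 + (th * p) ^+ 2 * g =
     p ^+ 2 * ( - th).
    have h1 : v * (1 - th * g) = th by move: thE => h2; lra.
    have -> : v * (p + - (th * p) * g) ^+ 2 = p ^+ 2 * (1 - th * g) * (v * (1 - th * g)).
      by ring.
    by rewrite h1; ring.
  by rewrite mulr_ge0_le0 ?sqr_ge0 //; lra.
have rT : \rank (E *m T) = \rank E.
  apply/mxrank_injP/rowV0P => f.
  rewrite sub_capmx => /andP[fE]; rewrite sub_kermx => /eqP fT0.
  apply/eqP; apply/negPn/negP => f0; have := step f fE f0.
  by rewrite fT0 /qform mul0mx /dotr mul0mx mxE mulr0 ltxx.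
have : (count_ge (bump_mx v x A) mu + \rank (E *m T)%MS <= n)%N.
  apply: count_ge_upper; first exact: bump_sym.
  move=> f /submxP[c ->]; rewrite mulmxA => h0.
  apply: step; first exact: submxMl.
  by apply: contraNneq h0 => ->; rewrite mul0mx.
by rewrite rT; lia.
Qed.

(** Whether an eigenvalue crosses mu depends only on the x-th diagonal entry of
    the resolvent at mu, hence only on the block S of x. Outside S the matrices
    A1 and A2 may differ. *)
Lemma count_ge_bump_block n (A1 A2 : 'M[R]_n) (S : {set 'I_n}) mu v x :
  A1^T = A1 -> A2^T = A2 -> 0 < v -> x \in S ->
  diag_mx (indic S) *m A1 = diag_mx (indic S) *m A2 ->
  diag_mx (indic S) *m A2 = A2 *m diag_mx (indic S) ->
  A2 - mu%:M \in unitmx -> bump_mx v x A1 - mu%:M \in unitmx ->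
  (count_ge (bump_mx v x A1) mu - count_ge A1 mu =
   count_ge (bump_mx v x A2) mu - count_ge A2 mu)%N.
Proof.
move=> s1 s2 v0 xS eq12 com u2 u1'.
pose w : 'rV[R]_n := delta_mx 0 x *m invmx (A2 - mu%:M).
have w2 : w *m (A2 - mu%:M) = delta_mx 0 x by rewrite mulmxKV.
have dS : (delta_mx 0 x : 'rV[R]_n) *m diag_mx (indic S) = delta_mx 0 x.
  apply/rowP => j; rewrite mul_mx_diag !mxE.
  by case: (j =P x) => [->|_]; rewrite /= ?mul0r // xS mulr1.
have comm : diag_mx (indic S) *m (A2 - mu%:M) = (A2 - mu%:M) *m diag_mx (indic S).
  by rewrite mulmxBl mulmxBr com mul_scalar_mx mul_mx_scalar.
have wS : w *m diag_mx (indic S) = w.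
  apply: (can_inj (mulmxK u2)).
  by rewrite -mulmxA comm mulmxA w2 dS.
have w1 : w *m (A1 - mu%:M) = delta_mx 0 x.
  rewrite -wS -mulmxA mulmxBr eq12 -mulmxBr mulmxA wS; exact: w2.
have ne : 1 + v * w 0 x != 0.
  apply: contraL u1' => /eqP e0; apply/negP => un.
  have : w *m (bump_mx v x A1 - mu%:M) = 0.
    rewrite /bump_mx addrAC mulmxDr w1 -scalemxAr mul_pdiag scalerA.
    by rewrite -[X in X + _]scale1r -scalerDl e0 scale0r.
  move/(congr1 (mulmx^~ (invmx (bump_mx v x A1 - mu%:M)))).
  rewrite mulmxK // mul0mx => w0; move/eqP: e0.
  by rewrite w0 mxE mulr0 addr0 oner_eq0.
have /andP[l1 h1] := count_ge_bump x mu s1 (ltW v0).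
have /andP[l2 h2] := count_ge_bump x mu s2 (ltW v0).
have [neg|pos|/eqP] := ltgtP (1 + v * w 0 x) 0; last by rewrite (negbTE ne).
  have := secular_up s1 w1 v0 neg; have := secular_up s2 w2 v0 neg; lia.
have := secular_stay s1 w1 v0 pos; have := secular_stay s2 w2 v0 pos; lia.
Qed.

End Perturbation.

(** * Counts along a segment of operators *)

Section Path.
Context {R : archiRcfType}.

Lemma sum_cauchy_schwarz (I : finType) (P : pred I) (c z : I -> R) :
  (\sum_(i | P i) c i * z i) ^+ 2 <=
    (\sum_(i | P i) c i ^+ 2) * (\sum_(i | P i) z i ^+ 2).
Proof.
set b := \sum_(i | P i) c i * z i; set a := \sum_(i | P i) _; set d := \sum_(i | P i) _.
have d0 : 0 <= d by apply: sumr_ge0 => i _; exact: sqr_ge0.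
have a0 : 0 <= a by apply: sumr_ge0 => i _; exact: sqr_ge0.
have key t : 0 <= a - 2 * t * b + t ^+ 2 * d.
  have -> : a - 2 * t * b + t ^+ 2 * d = \sum_(i | P i) (c i - t * z i) ^+ 2.
    rewrite /a /b /d !mulr_sumr -sumrB -big_split /=.
    by apply: eq_bigr => i _; ring.
  by apply: sumr_ge0 => i _; exact: sqr_ge0.
have [d1|d1] := eqVneq d 0.
  have := key ((a + 1) / 2 * b); rewrite d1 mulr0 addr0 mulr0.
  have -> : a - 2 * ((a + 1) / 2 * b) * b = a - (a + 1) * b ^+ 2 by field.
  have [b0|b0] := eqVneq b 0; first by rewrite b0 expr0n.
  have := key ((a + 1) / (2 * b)); rewrite d1 mulr0 addr0.
  have -> : a - 2 * ((a + 1) / (2 * b)) * b = - 1 by field.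
  by lra.
have d2 : 0 < d by rewrite lt_def d1.
have := key (b / d).
have -> : a - 2 * (b / d) * b + (b / d) ^+ 2 * d = (a * d - b ^+ 2) / d by field.
by rewrite pmulr_lge0 ?invr_gt0 // subr_ge0.
Qed.

Definition window n (A : 'M[R]_n) (l0 w : R) : {set 'I_n} :=
  [set i | `|eigvals A 0 i - l0| <= w].

Definition window_leak n (A B : 'M[R]_n) (l0 w : R) : R :=
  \sum_(i in window A l0 w) dotr (eigvec A i *m B) (eigvec A i *m B).

(** Cauchy-Schwarz over the eigenvectors of the window. *)
Lemma window_leak_bound n (A B : 'M[R]_n) l0 w (c : 'rV[R]_n) : A^T = A ->
  (forall i, i \notin window A l0 w -> c 0 i = 0) ->
  dotr (c *m eigbasis A *m B) (c *m eigbasis A *m B) <=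
    window_leak A B l0 w * dotr c c.
Proof.
move=> sA c0; rewrite dotrE.
have E j : (c *m eigbasis A *m B) 0 j =
    \sum_(i in window A l0 w) c 0 i * (eigvec A i *m B) 0 j.
  rewrite mul_eigbasis mulmx_suml summxE (bigID (mem (window A l0 w))) /=.
  rewrite [X in _ + X]big1 ?addr0; last by move=> i /c0->; rewrite scale0r mul0mx mxE.
  by apply: eq_bigr => i _; rewrite -scalemxAl mxE.
have cc : \sum_(i in window A l0 w) c 0 i ^+ 2 <= dotr c c.
  rewrite dotrE [leRHS](bigID (mem (window A l0 w))) /=.
  under eq_bigr do rewrite expr2.
  by rewrite lerDl sumr_ge0 // => i _; rewrite -expr2 sqr_ge0.
have leak : window_leak A B l0 w =
    \sum_j \sum_(i in window A l0 w) (eigvec A i *m B) 0 j ^+ 2.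
  rewrite exchange_big /=; apply: eq_bigr => i _; rewrite dotrE.
  by apply: eq_bigr => j _; rewrite expr2.
rewrite leak mulr_suml; apply: ler_sum => j _; rewrite -expr2 E.
apply: le_trans (sum_cauchy_schwarz _ _ _) _; rewrite mulrC ler_wpM2l //.
by apply: sumr_ge0 => i _; exact: sqr_ge0.
Qed.

(** On the spectral space of A above mu the form of A + hB is at least mu - 2hb:
    on the part in the window B is at least -b up to the leak, and the part
    outside the window lies 5h higher, which absorbs the crude bound -4 on B and
    the cross term. *)
Lemma count_ge_step n (A B : 'M[R]_n) l0 w h b mu : A^T = A -> B^T = B ->
  0 <= h -> 0 < b <= 1 -> window_leak A B l0 w <= b ^+ 2 ->
  (forall f, - 4 * dotr f f <= qform B f) ->
  l0 - w <= mu -> mu + 5 * h <= l0 + w ->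
  (count_ge A mu <= count_ge (A + h *: B) (mu - 2 * h * b))%N.
Proof.
move=> sA sB h0 /andP[b0 b1] leak B4 mu1 mu2.
have sC : (A + h *: B)^T = A + h *: B by rewrite linearD linearZ /= sA sB.
rewrite -[X in (X <= _)%N](rank_specspace [set i | mu <= eigvals A 0 i] sA).
apply: count_ge_lower => // _ /specspaceP[c -> c0].
pose c1 : 'rV[R]_n := \row_i (if i \in window A l0 w then c 0 i else 0).
pose c2 : 'rV[R]_n := \row_i (if i \in window A l0 w then 0 else c 0 i).
have cE : c = c1 + c2.
  by apply/rowP => i; rewrite !mxE; case: ifP; rewrite ?addr0 ?add0r.
have c12 : dotr c c = dotr c1 c1 + dotr c2 c2.
  rewrite !dotrE -big_split /=; apply: eq_bigr => i _; rewrite !mxE.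
  by case: ifP => _; rewrite ?mulr0 ?addr0 ?add0r.
have qA : mu * dotr c1 c1 + (l0 + w) * dotr c2 c2 <= qform A (c *m eigbasis A).
  rewrite qform_eigbasis // !dotrE !mulr_sumr -big_split /=.
  apply: ler_sum => i _; rewrite !mxE.
  have [iI|/c0->] := boolP (i \in [set i | mu <= eigvals A 0 i]); last first.
    by case: ifP => _; rewrite !(mulr0, addr0) expr0n mulr0.
  move: iI; rewrite !inE => iI; rewrite -!expr2.
  case: ifP => [_|/negbT]; first by rewrite expr0n mulr0 addr0 ler_wpM2r ?sqr_ge0.
  rewrite -ltNge expr0n mulr0 add0r => lt; rewrite ler_wpM2r ?sqr_ge0 //.
  move: lt; rewrite real_ltr_normr ?num_real // => /orP[]; last by lra.
  by move=> ?; apply/ltW; lra.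
rewrite dotr_eigbasis // c12 qformDl qformZl.
set P := eigbasis A in qA *; rewrite {2}cE mulmxDl qformD //.
set f1 := c1 *m P; set f2 := c2 *m P.
have n1 : dotr f1 f1 = dotr c1 c1 by rewrite dotr_eigbasis.
have n2 : dotr f2 f2 = dotr c2 c2 by rewrite dotr_eigbasis.
have hB : dotr (f1 *m B) (f1 *m B) <= b ^+ 2 * dotr c1 c1.
  apply: le_trans (window_leak_bound B (l0 := l0) (w := w) sA _) _.
    by move=> i /negbTE iw; rewrite mxE iw.
  by rewrite ler_wpM2r // dotr_ge0.
(* Both bounds complete a square: that of f1 B + f2 for the cross term, that of f1 B +
   b f1 for the form on the window part. *)
have a1 : - (dotr (f1 *m B) (f1 *m B) + dotr f2 f2) <= 2 * dotr (f1 *m B) f2.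
  have := dotr_ge0 (f1 *m B + f2); rewrite !dotrDl !dotrDr (dotrC f2); lra.
have a2 : - 2 * b * dotr c1 c1 <= 2 * qform B f1.
  have := dotr_ge0 (f1 *m B + b *: f1); rewrite !dotrDl !dotrDr !dotrZl !dotrZr.
  rewrite (dotrC f1 (f1 *m B)) -/(qform B f1) n1 => h1.
  rewrite -subr_ge0 -(pmulr_rge0 _ b0); move: h1 hB; lra.
have a3 := B4 f2; rewrite n2 in a1 a3.
have g1 := dotr_ge0 c1; have g2 := dotr_ge0 c2.
have b2 : b ^+ 2 * dotr c1 c1 <= b * dotr c1 c1.
  by rewrite ler_wpM2r // expr2 ler_piMl // ltW.
have tot : - (2 * b * dotr c1 c1 + 5 * dotr c2 c2) <=
    qform B f1 + 2 * dotr (f1 *m B) f2 + qform B f2 by lra.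
have := ler_wpM2l h0 tot.
have : (mu + 5 * h) * dotr c2 c2 <= (l0 + w) * dotr c2 c2 by rewrite ler_wpM2r.
have : 0 <= h * b * dotr c2 c2 by rewrite !mulr_ge0 // ltW.
by lra.
Qed.

(** Steps of size 1/M lower the level by 2b/M each, hence by 2b in all; M is
    large compared with 1/w so that the margin 5h of count_ge_step fits in the
    window. *)
Lemma count_ge_path n (A B : 'M[R]_n) l0 w b mu : A^T = A -> B^T = B ->
  0 < w -> 0 < b <= 1 ->
  (forall t, 0 <= t <= 1 -> window_leak (A + t *: B) B l0 w <= b ^+ 2) ->
  (forall f, - 4 * dotr f f <= qform B f) ->
  l0 - w + 2 * b <= mu <= l0 + w / 2 ->
  (count_ge A mu <= count_ge (A + B) (mu - 2 * b))%N.
Proof.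
move=> sA sB w0 /andP[b0 b1] leak B4 /andP[mu1 mu2].
pose M := (Num.Def.archi_bound (10 / w)).+1.
have M0 : 0 < M%:R :> R by rewrite ltr0n.
have hM : 10 / w < M%:R.
  apply: lt_le_trans (_ : (Num.Def.archi_bound (10 / w))%:R <= _); last by rewrite ler_nat.
  by apply: archi_boundP; rewrite divr_ge0 // ltW.
have h5 : 5 * M%:R^-1 <= w / 2.
  rewrite ler_pdivrMr //; move: hM; rewrite ltr_pdivrMr // => hM.
  by lra.
have ind j : (j <= M)%N ->
    (count_ge A mu <= count_ge (A + (j%:R / M%:R) *: B) (mu - 2 * b * (j%:R / M%:R)))%N.
  elim: j => [|j IH] jM; first by rewrite mul0r scale0r addr0 mulr0 subr0.
  apply: leq_trans (IH (ltnW jM)) _.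
  have tj : 0 <= (j%:R / M%:R : R) <= 1.
    apply/andP; split; first by rewrite divr_ge0.
    by rewrite ler_pdivrMr // mul1r ler_nat ltnW.
  have bt0 : 0 <= b * (j%:R / M%:R) by case/andP: tj => t0 _; rewrite mulr_ge0 // ltW.
  have bt1 : b * (j%:R / M%:R) <= b by case/andP: tj => _ t1; rewrite ler_piMr // ltW.
  have := @count_ge_step n (A + (j%:R / M%:R) *: B) B l0 w M%:R^-1 b
     (mu - 2 * b * (j%:R / M%:R)).
  have -> : A + (j%:R / M%:R) *: B + M%:R^-1 *: B = A + (j.+1%:R / M%:R) *: B.
    by rewrite -addrA -scalerDl -natr1 mulrDl mul1r.
  have -> : mu - 2 * b * (j%:R / M%:R) - 2 * M%:R^-1 * b = mu - 2 * b * (j.+1%:R / M%:R).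
    by rewrite -natr1 mulrDl; ring.
  apply => //.
  - by rewrite linearD linearZ /= sA sB.
  - by rewrite b0.
  - exact: leak.
  - by lra.
  - by lra.
by have := ind M (leqnn _); rewrite divff ?gt_eqF // scale1r mulr1.
Qed.

Lemma count_ge_window n (A : 'M[R]_n) l0 w mu nu : 
  l0 - w <= mu -> mu <= nu -> nu <= l0 + w ->
  (count_ge A mu <= count_ge A nu + #|window A l0 w|)%N.
Proof.
move=> h1 h2 h3; rewrite /count_ge.
apply: leq_trans (leq_card_setU _ _).
apply/subset_leq_card/subsetP => i; rewrite !inE => hi.
have [//|lt] := leP nu (eigvals A 0 i).
by rewrite /= ler_norml; apply/andP; split; lra.
Qed.

(** Following the segment in both directions compares the counts at levels 2b
    apart; levels within the window differ by at most the m eigenvalues in it.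
    *)
Lemma count_ge_two_ends n (A B : 'M[R]_n) l0 w b m mu nu : A^T = A -> B^T = B ->
  0 < w -> 0 < b <= 1 -> 8 * b <= w ->
  (forall t, 0 <= t <= 1 -> window_leak (A + t *: B) B l0 w <= b ^+ 2) ->
  (forall f, `|qform B f| <= 4 * dotr f f) ->
  (#|window (A + B) l0 w| <= m)%N ->
  `|mu - l0| <= w / 4 -> `|nu - l0| <= w / 4 ->
  (count_ge A mu <= count_ge (A + B) nu + m)%N /\
  (count_ge (A + B) nu <= count_ge A mu + m)%N.
Proof.
move=> sA sB w0 b01 bw leak B4 wm.
rewrite !ler_norml => /andP[mu1 mu2] /andP[nu1 nu2].
have /andP[b0 b1] := b01.
split.
  have h : (count_ge A mu <= count_ge (A + B) (mu - 2 * b))%N.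
    apply: (count_ge_path sA sB w0 b01 leak) => [f|]; last by lra.
    by have := B4 f; rewrite ler_norml => /andP[]; lra.
  apply: leq_trans h _.
  have [le|lt] := leP nu (mu - 2 * b).
    by apply: leq_trans (leq_addr _ _); apply: count_ge_anti.
  apply: leq_trans (leq_add (leqnn _) wm).
  by apply: count_ge_window; lra.
have sAB : (A + B)^T = A + B by rewrite linearD /= sA sB.
have h : (count_ge (A + B) (mu + 2 * b) <= count_ge (A + B + - B) (mu + 2 * b - 2 * b))%N.
  apply: (count_ge_path (l0 := l0) (w := w) sAB) => //.
  - by rewrite linearN /= sB.
  - move=> t /andP[t0 t1].
    have := leak (1 - t); rewrite subr_ge0 t1 gerBl t0 => /(_ isT).
    have -> : A + B + t *: - B = A + (1 - t) *: B.
      by rewrite scalerN scalerBl scale1r addrA.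
    apply: le_trans; rewrite /window_leak; apply: ler_sum => i _.
    by rewrite mulmxN /dotr linearN /= mulNmx mulmxN opprK.
  - by move=> f; rewrite qformN; have := B4 f; rewrite ler_norml => /andP[]; lra.
  - by lra.
rewrite addrK addrK in h.
apply: leq_trans (_ : (count_ge (A + B) (mu + 2 * b) + m <= _)%N); last by rewrite leq_add2r.
have [le|lt] := leP (mu + 2 * b) nu.
  by apply: leq_trans (leq_addr _ _); apply: count_ge_anti.
apply: leq_trans (leq_add (leqnn _) wm).
by apply: count_ge_window; lra.
Qed.

End Path.

(** * A quantitative Sperner theorem *)

Section CentralBinomial.

Lemma bin_le_half n k : ('C(n, k) <= 'C(n, n./2))%N.
Proof.
have low d : forall k, (k + d = n./2)%N -> ('C(n, k) <= 'C(n, n./2))%N.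
  elim: d => [|d IH] j; first by rewrite addn0 => ->.
  move=> jd; apply: leq_trans (IH j.+1 _); last by lia.
  rewrite -(leq_pmul2l (ltn0Sn j)) mul_bin_left leq_mul2r; apply/orP; right.
  by have := odd_double_half n; lia.
have [le|lt] := leqP k n./2; first by apply: (low (n./2 - k)%N); rewrite subnKC.
have [kn|nk] := leqP k n; last by rewrite bin_small.
have := odd_double_half n => nE; rewrite -bin_sub //.
by apply: (low (n./2 - (n - k))%N); rewrite subnKC //; lia.
Qed.

(** This form of the bound on the central binomial coefficient is exactly
    inductive. *)
Lemma central_bin_even k : ('C(k.*2, k) ^ 2 * k.*2.+1 <= 16 ^ k)%N.
Proof.
elim: k => [|k IH]; first by rewrite bin0.
have step : (k.+1 * 'C(k.+1.*2, k.+1) = 2 * k.*2.+1 * 'C(k.*2, k))%N.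
  have h1 : ('C(k.+1.*2, k.+1) * (k.+1`! * k.+1`!) = k.+1.*2`!)%N.
    by rewrite -[in RHS](@bin_fact k.+1.*2 k.+1) -?addnn ?leq_addr // addnK.
  have h2 : ('C(k.*2, k) * (k`! * k`!) = k.*2`!)%N.
    by rewrite -[in RHS](@bin_fact k.*2 k) -?addnn ?leq_addr // addnK.
  move: h1; rewrite doubleS !factS -h2.
  set a := 'C(_, _); set d := 'C(_, _); set f := k`! => h1.
  have f0 : (0 < k.+1 * (f * f))%N by rewrite !muln_gt0 fact_gt0.
  apply/eqP; rewrite -(eqn_pmul2l f0); apply/eqP.
  transitivity (a * (k.+1 * f * (k.+1 * f)))%N; first by ring.
  by rewrite h1 -addnn; ring.
have : (k.+1 ^ 2 * ('C(k.+1.*2, k.+1) ^ 2 * k.+1.*2.+1) <= k.+1 ^ 2 * 16 ^ k.+1)%N.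
  rewrite mulnA -expnMn step expnMn.
  set d := 'C(_, _) in IH *; set e := (16 ^ k)%N in IH *.
  have : ((2 * k.*2.+1) ^ 2 * k.+1.*2.+1 <= 16 * k.+1 ^ 2 * k.*2.+1)%N by nia.
  move=> h; apply: (@leq_trans (d ^ 2 * (16 * k.+1 ^ 2 * k.*2.+1))).
    by rewrite mulnAC mulnC leq_mul2l h orbT.
  have -> : (k.+1 ^ 2 * 16 ^ k.+1 = 16 * k.+1 ^ 2 * e)%N by rewrite (expnS 16) -/e; ring.
  have -> : (d ^ 2 * (16 * k.+1 ^ 2 * k.*2.+1) = 16 * k.+1 ^ 2 * (d ^ 2 * k.*2.+1))%N by ring.
  by rewrite leq_mul2l IH orbT.
by rewrite leq_pmul2l.
Qed.

Lemma central_bin_le n : (n * 'C(n, n./2) ^ 2 <= 4 ^ n)%N.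
Proof.
have := odd_double_half n; case: (odd n) => /= nE; last first.
  rewrite add0n in nE; set k := n./2 in nE *; rewrite -nE.
  have -> : (4 ^ k.*2 = 16 ^ k)%N by rewrite -mul2n expnM.
  by apply: leq_trans (central_bin_even k); rewrite mulnC leq_mul2l leqnSn orbT.
have := central_bin_even n./2.+1; set k := n./2 in nE *.
have nk : n = k.*2.+1 by lia.
have -> : ('C(k.+1.*2, k.+1) = 2 * 'C(n, k))%N.
  rewrite nk doubleS binS; have := bin_sub (n := k.*2.+1) (m := k).
  have -> : (k.*2.+1 - k = k.+1)%N by lia.
  by move=> ->; lia.
have -> : (16 ^ k.+1 = 4 * 4 ^ n)%N.
  have -> : (16 = 4 ^ 2)%N by [].
  by rewrite -expnM nk -expnS; congr (_ ^ _)%N; lia.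
move=> h; rewrite -(leq_pmul2l (isT : 0 < 4)%N); apply: leq_trans h.
by rewrite expnMn nk; nia.
Qed.
End CentralBinomial.

Section Sperner.
Context {T : finType}.
Implicit Types (J A X : {set T}) (F : {set {set T}}).

Lemma card_dep_pairs (D : {set {set T}}) (B : {set T} -> {set T}) :
  #|[set p : {set T} * T | (p.1 \in D) && (p.2 \in B p.1)]| = (\sum_(A in D) #|B A|)%N.
Proof.
rewrite -sum1_card; under [RHS]eq_bigr do rewrite -sum1_card.
rewrite (pair_big_dep (mem D) (fun A x => x \in B A) (fun _ _ => 1%N)) /=.
by apply: eq_bigl => p; rewrite inE.
Qed.

Variables (J : {set T}) (F : {set {set T}}) (B : {set T} -> {set T}) (g : nat).
Hypothesis g0 : (0 < g)%N.
Hypothesis FJ : forall A, A \in F -> A \subset J.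
Hypothesis BJ : forall A, A \in F -> B A \subset J :\: A.
Hypothesis Bg : forall A, A \in F -> (g <= #|B A|)%N.
Hypothesis BF : forall A A', A \in F -> A' \in F -> A \subset A' ->
  forall x, x \in B A -> x \notin A'.

(** A set is dead once it contains a member A of F together with a point of B A.
    By BF no member of F is dead, while death is inherited by larger sets. *)
Let dead k := [set X : {set T} | [&& X \subset J, #|X| == k &
  [exists A in F, exists x in B A, x |: A \subset X]]].
Let Fk k := [set A in F | #|A| == k].

(** Double counting of the pairs (X, x) with X of size k and x |: X dead: a dead
    X admits every x of J outside it, a member X of F every x in B X, and a dead
    set of size k + 1 arises from at most k + 1 pairs. *)
Lemma dead_step k : (k < #|J|)%N ->
  ((#|J| - k) * #|dead k| + g * #|Fk k| <= k.+1 * #|dead k.+1|)%N.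
Proof.
move=> kn.
pose S1 := [set p : {set T} * T | (p.1 \in dead k) && (p.2 \in J :\: p.1)].
pose S2 := [set p : {set T} * T | (p.1 \in Fk k) && (p.2 \in B p.1)].
pose S3 := [set p : {set T} * T | (p.1 \in dead k.+1) && (p.2 \in p.1)].
have c1 : #|S1| = ((#|J| - k) * #|dead k|)%N.
  rewrite card_dep_pairs mulnC -sum_nat_const; apply: eq_bigr => A.
  rewrite inE => /and3P[AJ /eqP Ak _]; rewrite cardsD (setIidPr AJ) Ak //.
have c2 : (g * #|Fk k| <= #|S2|)%N.
  rewrite card_dep_pairs mulnC -sum_nat_const; apply: leq_sum => A.
  by rewrite inE => /andP[AF _]; rewrite Bg.
have c3 : #|S3| = (k.+1 * #|dead k.+1|)%N.
  rewrite (card_dep_pairs _ id) mulnC -sum_nat_const; apply: eq_bigr => A.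
  by rewrite inE => /and3P[_ /eqP Ak _].
rewrite -c1 -c3; apply: leq_trans (leq_add (leqnn _) c2) _.
have dis : S1 :&: S2 = set0.
  apply/setP => -[A x]; rewrite !inE /=; apply/negP => /andP[/andP[]].
  move=> /and3P[_ _ /exists_inP[A' A'F /exists_inP[y yB sub]]] _ /andP[/andP[AF _] _].
  have AA : A' \subset A by apply: subset_trans sub; apply: subsetUr.
  by have := BF A'F AF AA yB; rewrite (subsetP sub) // setU11.
have -> : (#|S1| + #|S2| = #|S1 :|: S2|)%N by rewrite cardsU dis cards0 subn0.
pose h (p : {set T} * T) := (p.2 |: p.1, p.2).
have ne p : p \in S1 :|: S2 -> p.2 \notin p.1.
  rewrite inE => /orP[|]; rewrite !inE => /andP[].
    by move=> _ /andP[].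
  by move=> /andP[pF _] /(subsetP (BJ pF)); rewrite inE => /andP[].
rewrite -(card_in_imset (f := h)); last first.
  move=> [A x] [A' x'] /ne /= h1 /ne /= h2 [] /= e1 e2; subst x'.
  by rewrite -(setU1K h1) e1 setU1K.
apply/subset_leq_card/subsetP => _ /imsetP[[A x] pS ->].
have xA := ne _ pS; rewrite /= in xA.
rewrite !inE /= eqxx /= andbT cardsU1 xA /= add1n.
move: pS; rewrite !inE /= => /orP[/andP[/and3P[AJ /eqP Ak ex]]|].
  rewrite xA /= => xJ; rewrite subUset sub1set xJ AJ Ak eqxx /=.
  move: ex => /exists_inP[A' A'F /exists_inP[y yB sub]].
  apply/exists_inP; exists A' => //; apply/exists_inP; exists y => //.
  by apply: subset_trans sub _; apply: subsetUr.
move=> /andP[/andP[AF /eqP Ak] xB].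
have := subsetP (BJ AF) _ xB; rewrite inE => /andP[_ xJ].
rewrite subUset sub1set xJ (FJ AF) Ak eqxx /=.
by apply/exists_inP; exists A => //; apply/exists_inP; exists x.
Qed.

Local Open Scope ring_scope.

(** By dead_step the proportion of dead sets among the sets of size k grows by
    at least g |F_k| / ((|J| - k) C(|J|, k)) from one level to the next, and it
    never exceeds 1. *)
Lemma sperner_bound : (g * #|F| <= #|J| * 'C(#|J|, #|J|./2))%N.
Proof.
set n := #|J|; set M := 'C(n, n./2).
have M0 : (0 < M)%N by rewrite bin_gt0; have := odd_double_half n; lia.
have [n0|n0] := posnP n.
  suff -> : F = set0 by rewrite cards0 muln0.
  apply/setP => A; rewrite inE; apply/negP => AF.
  have := leq_trans (Bg AF) (subset_leq_card (BJ AF)).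
  have : (#|J :\: A| <= n)%N by apply/subset_leq_card/subsetDl.
  by rewrite n0; lia.
have nM : 0 < (n * M)%:R :> rat by rewrite ltr0n muln_gt0 n0.
have ind k : (k <= n)%N ->
  (g * \sum_(j < k) #|Fk j|)%:R / (n * M)%:R <= #|dead k|%:R / 'C(n, k)%:R :> rat.
  elim: k => [|k IH] kn; first by rewrite big_ord0 muln0 mul0r divr_ge0.
  have Ck : 0 < 'C(n, k)%:R :> rat by rewrite ltr0n bin_gt0 ltnW.
  have Ck1 : 0 < 'C(n, k.+1)%:R :> rat by rewrite ltr0n bin_gt0.
  have nk : 0 < (n - k)%:R :> rat by rewrite ltr0n subn_gt0.
  rewrite big_ord_recr /= mulnDr natrD mulrDl.
  have dead1 : (#|dead k|%:R / 'C(n, k)%:R + (g * #|Fk k|)%:R / ((n - k) * 'C(n, k))%:R)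
       <= #|dead k.+1|%:R / 'C(n, k.+1)%:R :> rat.
    have e : (k.+1%:R * 'C(n, k.+1)%:R = (n - k)%:R * 'C(n, k)%:R :> rat).
      by rewrite -!natrM mul_bin_left.
    have k1 : 0 < k.+1%:R :> rat by rewrite ltr0n.
    have -> : #|dead k.+1|%:R / 'C(n, k.+1)%:R =
       (k.+1 * #|dead k.+1|)%:R / ((n - k) * 'C(n, k))%:R :> rat.
      by rewrite !natrM -e; field; rewrite nat1r !gt_eqF.
    have -> : #|dead k|%:R / 'C(n, k)%:R =
       ((n - k) * #|dead k|)%:R / ((n - k) * 'C(n, k))%:R :> rat.
      by rewrite !natrM; field; rewrite (gt_eqF Ck) (gt_eqF nk).
    rewrite -mulrDl -natrD ler_wpM2r ?invr_ge0 // ler_nat.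
    exact: dead_step.
  apply: le_trans dead1; apply: lerD; first exact: IH (ltnW kn).
  rewrite ler_wpM2l // lef_pV2 ?posrE //; last by rewrite natrM mulr_gt0.
  by rewrite ler_nat leq_mul ?leq_subr ?bin_le_half.
have := ind n (leqnn n); rewrite binn divr1.
have -> : (\sum_(j < n) #|Fk j| = #|F|)%N.
  rewrite -sum1_card (partition_big (fun A : {set T} => inord #|A| : 'I_n.+1) xpredT) //=.
  rewrite big_ord_recr /= [X in (_ + X)%N]big_pred0 ?addn0.
    apply: eq_bigr => j _; rewrite -sum1_card; apply: eq_bigl => A; rewrite inE.
    have [AF|//] := boolP (A \in F); rewrite /= -val_eqE /= inordK //.
    by rewrite ltnS subset_leq_card ?FJ.
  move=> A; apply/negP => /andP[AF /eqP/(congr1 val)] /=.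
  rewrite inordK ?ltnS ?subset_leq_card ?FJ // => An.
  have := leq_trans (Bg AF) (subset_leq_card (BJ AF)).
  by rewrite cardsD (setIidPr (FJ AF)) An -/n subnn; lia.
rewrite ler_pdivrMr // => h; rewrite -(ler_nat rat); apply: le_trans h _.
apply: ler_piMl; first exact: ltW.
rewrite (ler_nat _ _ 1).
have : (#|dead n| <= #|[set J]|)%N; last by rewrite cards1.
apply/subset_leq_card/subsetP => X; rewrite !inE => /and3P[XJ /eqP Xn _].
by rewrite eqEcard XJ /= Xn.
Qed.

End Sperner.

(** * Resonances with many large entries form a Sperner family *)

Section SymDiff.
Context {T : finType}.
Implicit Types Y K Z : {set T}.

Definition symdiff K Y : {set T} := [set x | (x \in Y) (+) (x \in K)].

Lemma symdiffK K : involutive (symdiff K).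
Proof. by move=> Y; apply/setP => x; rewrite !inE addbK. Qed.

Lemma symdiff_sub K Y (J : {set T}) : K \subset J -> Y \subset J -> symdiff K Y \subset J.
Proof.
move=> /subsetP KJ /subsetP YJ; apply/subsetP => x; rewrite inE.
by have [/YJ//|_] := boolP (x \in Y) => /= /KJ.
Qed.

Lemma symdiffU1_notin K Z x : x \notin K -> symdiff K (x |: Z) = x |: symdiff K Z.
Proof.
move=> /negbTE xK; apply/setP => y; rewrite !inE.
by case: eqP => //= ->; rewrite xK.
Qed.

Lemma symdiffU1_in K Z x : x \in K -> symdiff K (x |: Z) = symdiff K Z :\ x.
Proof.
move=> xK; apply/setP => y; rewrite !inE.
by case: eqP => //= ->; rewrite xK.
Qed.
End SymDiff.

Section SpectralSperner.
Context {R : rcfType}.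
Variables (n : nat) (J K : {set 'I_n}) (A : {set 'I_n} -> 'M[R]_n).
Variables (v l0 s s' c : R).
Implicit Types Y Z : {set 'I_n}.
Hypothesis KJ : K \subset J.
Hypothesis sA : forall Y, (A Y)^T = A Y.
Hypothesis v0 : 0 < v.
Hypothesis A_flip : forall (Y : {set 'I_n}) x, x \in J -> x \notin Y -> A (x |: Y) = bump_mx v x (A Y).
Hypotheses (c0 : 0 < c) (vc : 8 * s <= v * c) (sc : 8 * s <= (s' - s) * c).

(** Up to the constant #|K| this is the number of eigenvalues above l0 + s minus
    the number of points of K in Y; adding #|K :\: Y| instead avoids
    subtraction. *)
Definition rel_count Y : nat := (count_ge (A Y) (l0 + s) + #|K :\: Y|)%N.

Definition peaked Y (G : {set 'I_n}) : Prop := exists l (u : 'rV[R]_n),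
  [/\ dotr u u = 1, u *m A Y = l *: u, `|l - l0| < s, spectral_gap (A Y) l0 s s' &
   forall x, x \in G -> c <= u 0 x ^+ 2].

(** In the coordinate Z, the symmetric difference of Y and K, adding a point
    outside K raises a diagonal entry, while adding a point of K lowers one but
    releases that point of K; interlacing settles both cases. *)
Lemma rel_countU1 Z x : x \in J -> x \notin Z ->
  (rel_count (symdiff K Z) <= rel_count (symdiff K (x |: Z)))%N.
Proof.
move=> xJ xZ; rewrite /rel_count; have [xK|xK] := boolP (x \in K).
  rewrite symdiffU1_in //; set Y := symdiff K Z.
  have xY : x \in Y by rewrite inE xK (negbTE xZ).
  have /andP[_] := count_ge_bump x (l0 + s) (sA (Y :\ x)) (ltW v0).
  rewrite -A_flip // ?setD1K ?setD11 // => h.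
  have -> : K :\: (Y :\ x) = x |: (K :\: Y).
    by apply/setP => y; rewrite !inE; case: eqP => [->|//]; rewrite xK.
  by rewrite cardsU1 in_setD xY /=; lia.
rewrite symdiffU1_notin //; set Y := symdiff K Z.
have xY : x \notin Y by rewrite inE (negbTE xK) (negbTE xZ).
have /andP[h _] := count_ge_bump x (l0 + s) (sA Y) (ltW v0).
rewrite -A_flip // in h.
have -> // : K :\: (x |: Y) = K :\: Y; last by lia.
by apply/setP => y; rewrite !inE; case: eqP => [->|//]; rewrite (negbTE xK) !andbF.
Qed.

Lemma rel_count_mono Z Z' : Z \subset Z' -> Z' \subset J ->
  (rel_count (symdiff K Z) <= rel_count (symdiff K Z'))%N.
Proof.
elim: {Z}#|Z' :\: Z| {-2}Z (erefl #|Z' :\: Z|) => [|m IH] Z mE ZZ' Z'J.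
  have -> // : Z = Z'.
  by apply/eqP; rewrite eqEsubset ZZ' /= -setD_eq0 -cards_eq0 mE.
have /card_gt0P[x] : (0 < #|Z' :\: Z|)%N by rewrite mE.
rewrite inE => /andP[xZ xZ'].
apply: leq_trans (rel_countU1 (subsetP Z'J _ xZ') xZ) _.
apply: IH => //; last by rewrite subUset sub1set xZ'.
by move: mE; rewrite (cardsD1 x) inE xZ xZ' add1n setDDl setUC => -[].
Qed.

(** At a large entry of an isolated resonance the inequality of rel_countU1 is
    strict: the raised entry pushes an eigenvalue up, respectively the lowered
    entry loses none. *)
Lemma rel_count_strict Z G x : peaked (symdiff K Z) G -> x \in G -> x \in J -> x \notin Z ->
  (rel_count (symdiff K Z) < rel_count (symdiff K (x |: Z)))%N.
Proof.
move=> [l [u [u1 uA ls gap hG]]] /hG ux xJ xZ; rewrite /rel_count.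
have [xK|xK] := boolP (x \in K).
  rewrite symdiffU1_in //; set Y := symdiff K Z in uA gap *.
  have xY : x \in Y by rewrite inE xK (negbTE xZ).
  have := count_ge_bump_down (- v) (sA Y) u1 uA ls gap c0 ux sc.
  have -> : bump_mx (- v) x (A Y) = A (Y :\ x).
    by rewrite -{1}(setD1K xY) A_flip ?setD11 // /bump_mx scaleNr addrK.
  have -> : K :\: (Y :\ x) = x |: (K :\: Y).
    by apply/setP => y; rewrite !inE; case: eqP => [->|//]; rewrite xK.
  by move=> h; rewrite cardsU1 in_setD xY /= add1n addnS ltnS leq_add2r.
rewrite symdiffU1_notin //; set Y := symdiff K Z in uA gap *.
have xY : x \notin Y by rewrite inE (negbTE xK) (negbTE xZ).
have := count_ge_bump_up (sA Y) u1 uA ls gap c0 ux vc sc.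
rewrite -A_flip //.
have -> : K :\: (x |: Y) = K :\: Y; last by move=> h; rewrite ltn_add2r.
by apply/setP => y; rewrite !inE; case: eqP => [->|//]; rewrite (negbTE xK) !andbF.
Qed.

(** If Y and Y' are both in F and Z contained in Z' are their symmetric
    differences with K, then Z' contains no large entry of Y outside Z:
    otherwise the relative count would grow strictly between them. *)
Lemma peaked_sperner (F : {set {set 'I_n}}) (g k : nat) : (0 < g)%N ->
  (forall Y, Y \in F -> [/\ Y \subset J, rel_count Y = k &
     exists G : {set 'I_n}, [/\ peaked Y G, (g <= #|G|)%N &
       forall x, x \in G -> x \in J /\ (x \in Y) = (x \in K)]]) ->
  (g * #|F| <= #|J| * 'C(#|J|, #|J|./2))%N.
Proof.
move=> g0 hF; pose F' := symdiff K @: F.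
have -> : #|F| = #|F'| by rewrite card_imset //; exact: inv_inj (symdiffK K).
have F'P Z : Z \in F' -> symdiff K Z \in F.
  by move=> /imsetP[Y YF ->]; rewrite symdiffK.
have [B BP] : exists B : {set 'I_n} -> {set 'I_n}, forall Z, Z \in F' ->
    [/\ B Z \subset J :\: Z, (g <= #|B Z|)%N & peaked (symdiff K Z) (B Z)].
  apply: (@fin_all_exists _ (fun=> {set 'I_n}) (fun Z b => Z \in F' ->
    [/\ b \subset J :\: Z, (g <= #|b|)%N & peaked (symdiff K Z) b])) => Z; have [ZF|_] := boolP (Z \in F'); last by exists set0.
  have [_ _ [G [pG gG hG]]] := hF _ (F'P _ ZF); exists G => _; split=> //.
  apply/subsetP => x /hG[xJ]; rewrite !inE xJ andbT => h.
  by move: h; case: (x \in Z); case: (x \in K).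
apply: (sperner_bound (B := B)) => //.
- move=> Z /F'P ZF; rewrite -[Z](symdiffK K) symdiff_sub //.
  by have [] := hF _ ZF.
- by move=> Z /BP[].
- by move=> Z /BP[].
move=> Z Z' ZF Z'F ZZ' x xB; apply/negP => xZ'.
have [BJ _ pB] := BP _ ZF; have := subsetP BJ _ xB; rewrite inE => /andP[xZ xJ].
have := rel_count_strict pB xB xJ xZ.
have [_ -> _] := hF _ (F'P _ ZF); rewrite ltnNge => /negP; apply.
have [Z'J <- _] := hF _ (F'P _ Z'F); apply: rel_count_mono.
  by rewrite subUset sub1set xZ'.
by rewrite -[Z'](symdiffK K) symdiff_sub.
Qed.

End SpectralSperner.

(** * Counting resonant configurations of the free sites *)

Section Fiber.
Context {R : archiRcfType}.

Lemma eigenvalue_eigvals n (A : 'M[R]_n) mu : A^T = A -> eigenvalue A mu ->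
  exists i, eigvals A 0 i = mu.
Proof.
move=> sA /eigenvalueP[u uA u0].
have PP : (eigbasis A)^T *m eigbasis A = 1%:M by apply/mulmx1C/eigbasis_orth.
have [c uE] : exists c, u = c *m eigbasis A.
  by exists (u *m (eigbasis A)^T); rewrite -mulmxA PP mulmx1.
have [i ci] : exists i, c 0 i != 0.
  by apply/rV0Pn; apply: contraNneq u0 => c0; rewrite uE c0 mul0mx.
exists i; move: uA; rewrite uE -mulmxA eigbasis_mul // mulmxA scalemxAl.
move/(congr1 (mulmx^~ (eigbasis A)^T)); rewrite -!mulmxA eigbasis_orth // !mulmx1.
move=> /rowP/(_ i); rewrite mul_mx_diag !mxE mulrC => /eqP.
by rewrite -subr_eq0 -mulrBl mulf_eq0 subr_eq0 (negbTE ci) orbF => /eqP.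
Qed.

(** Supplies a level that is not an eigenvalue of any of finitely many matrices.
    *)
Lemma fresh_real (s : seq R) a d : 0 < d -> exists2 x, a < x <= a + d & x \notin s.
Proof.
move=> d0; pose f k : R := a + d / k.+1%:R.
have f_inj : injective f.
  move=> i j /addrI/(mulfI (lt0r_neq0 d0))/invr_inj/eqP.
  by rewrite eqr_nat eqSS => /eqP.
have [/allP h|] := boolP (all [in s] [seq f k | k <- iota 0 (size s).+1]).
  have := uniq_leq_size (s1 := [seq f k | k <- iota 0 (size s).+1]) (s2 := s).
  by rewrite map_inj_uniq // iota_uniq size_map size_iota ltnn => /(_ isT h).
move=> /allPn[_ /mapP[k _ ->] fk]; exists (f k) => //.
rewrite ltrDl divr_gt0 //= lerD2l ler_pdivrMr ?ltr0n //.
by rewrite ler_peMr ?ler1n // ltW.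
Qed.

Variables (n : nat) (J : {set 'I_n}) (A0 B : 'M[R]_n) (S : 'I_n -> {set 'I_n}).
Variables (v l0 w b c : R) (m : nat) (s : nat -> R).
Implicit Types (Y : {set 'I_n}).

Definition site_mx (M : 'M[R]_n) (Y : {set 'I_n}) : 'M[R]_n := M + v *: diag_mx (indic Y).
Let A := site_mx A0.

Hypothesis v0 : 0 < v.
Hypotheses (sA0 : A0^T = A0) (sB : B^T = B).
Hypothesis B4 : forall f, `|qform B f| <= 4 * dotr f f.
Hypotheses (w0 : 0 < w) (b01 : 0 < b <= 1) (bw : 8 * b <= w) (c0 : 0 < c).
Hypothesis leak : forall Y (t : R), Y \subset J -> 0 <= t <= 1 ->
  window_leak (A Y + t *: B) B l0 w <= b ^+ 2.
Hypothesis win : forall Y (t : R), Y \subset J -> 0 <= t <= 1 ->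
  (#|window (A Y + t *: B) l0 w| <= m)%N.
Hypothesis S_own : forall x, x \in J -> x \in S x.
Hypothesis S_other : forall x y, x \in J -> y \in J -> x != y -> y \notin S x.
Hypothesis S_block : forall x i j, x \in J -> (i \in S x) != (j \in S x) ->
  (A0 + B) i j = 0.
Hypothesis s0 : forall k, 0 < s k.
Hypothesis s_step : forall k, (k <= m)%N -> 8 * s k <= (s k.+1 - s k) * c.
Hypothesis s_v : forall k, (k <= m)%N -> 8 * s k <= v * c.
Hypothesis s_w : s m.+1 <= w / 4.

Lemma site_mx_sym M Y : M^T = M -> (site_mx M Y)^T = site_mx M Y.
Proof. by move=> sM; rewrite /site_mx linearD linearZ /= tr_diag_mx sM. Qed.

Lemma site_mxU1 M Y x : x \notin Y -> site_mx M (x |: Y) = bump_mx v x (site_mx M Y).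
Proof.
move=> xY; rewrite /site_mx /bump_mx -addrA -scalerDr; congr (_ + _ *: _).
apply/matrixP => i j; rewrite !mxE !inE [in RHS]mulrb.
have [->|ix] := eqVneq i x; last by rewrite andFb addr0 -mulrb.
by rewrite (negbTE xY) /= [x == j]eq_sym; case: (j == x); rewrite ?mulr1n ?add0r ?addr0.
Qed.

Let s_lt k : (k <= m)%N -> s k < s k.+1.
Proof.
move=> km; have := s_step km; have := s0 k; have := c0 => h0 h1 h2.
by rewrite -subr_gt0 -(pmulr_lgt0 _ c0); lra.
Qed.

Let s_mono j k : (j <= k)%N -> (k <= m.+1)%N -> s j <= s k.
Proof.
move=> jk; rewrite -(subnKC jk); elim: (k - j)%N => [|d IH]; first by rewrite addn0.
by rewrite addnS => h; apply: le_trans (IH (ltnW h)) _; apply: ltW; apply: s_lt.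
Qed.

(** At most m eigenvalues cannot meet all of the m + 1 disjoint annuli s k <=
    |mu - l0| < s k.+1. *)
Lemma gap_exists Y : Y \subset J ->
  exists k : 'I_m.+1, spectral_gap (A Y) l0 (s k) (s k.+1).
Proof.
move=> YJ; have sA : (A Y)^T = A Y by exact: site_mx_sym.
pose ann k i := s k <= `|eigvals (A Y) 0 i - l0| < s k.+1.
have [/existsP[k /forallP h]|/existsPn h] :=
    boolP [exists k : 'I_m.+1, [forall i, ~~ ann k i]].
  exists k => mu /(eigenvalue_eigvals sA)[i <-]; exact/negP/h.
have [f hf] : exists f : 'I_m.+1 -> 'I_n, forall k : 'I_m.+1, ann k (f k).
  apply: (@fin_all_exists _ (fun=> 'I_n) (fun (k : 'I_m.+1) i => ann k i)) => k.
  have [i hi] := elimT forallPn (h k); by exists i; rewrite negbK in hi.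
have f_lt (j k : 'I_m.+1) : (j < k)%N -> f j != f k.
  move=> jk; apply/eqP => fE; have /andP[_ h1] := hf j; have /andP[h2 _] := hf k.
  move: h1; rewrite fE ltNge (le_trans _ h2) //; apply: s_mono => //.
  exact: ltnW (ltn_ord k).
have f_inj : injective f.
  move=> j k fE; apply/eqP; rewrite -val_eqE /= eqn_leq; apply/andP; split;
    rewrite leqNgt; apply/negP => /f_lt; rewrite fE eqxx //.
have := win (t := 0) YJ; rewrite lexx ler01 scale0r addr0 => /(_ isT).
rewrite leqNgt => /negP; case; apply: leq_trans (_ : #|f @: setT| <= _)%N.
  by rewrite card_imset // cardsT card_ord.
apply/subset_leq_card/subsetP => _ /imsetP[k _ ->]; rewrite inE.
have /andP[_ h1] := hf k; apply/ltW/(lt_le_trans h1).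
apply: le_trans (_ : s m.+1 <= _); first by apply: s_mono; rewrite ?ltn_ord.
by apply: le_trans s_w _; have := w0; lra.
Qed.

Let C Y := A Y + B.

Let sC Y : (C Y)^T = C Y.
Proof. by rewrite /C linearD /= sB site_mx_sym. Qed.

Let C_U1 Y x : x \notin Y -> C (x |: Y) = bump_mx v x (C Y).
Proof. by move=> xY; rewrite /C /A site_mxU1 // /bump_mx addrAC. Qed.

(** K consists of the sites whose addition to the empty configuration moves an
    eigenvalue across mu. As the decoupled operator has each site of J in its
    own block, count_ge_bump_block says that the other sites do not influence
    this. *)
Lemma decoupled_count : exists mu N (K : {set 'I_n}),
  [/\ `|mu - l0| <= w / 4, K \subset J &
   forall Y, Y \subset J -> count_ge (C Y) mu = (N + #|K :&: Y|)%N].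
Proof.
have w4 : 0 < w / 4 by have := w0; lra.
(* A generic level makes all the resolvents in the secular equations exist. *)
pose bad := flatten [seq [seq eigvals (C Y) 0 i | i <- enum 'I_n] | Y <- enum {set 'I_n}].
have [mu /andP[mu1 mu2] muB] := fresh_real bad l0 w4.
have unitC Y : C Y - mu%:M \in unitmx.
  rewrite -row_free_unit -kermx_eq0; apply: contraNT muB => h.
  have /(eigenvalue_eigvals (sC Y))[i <-] : eigenvalue (C Y) mu by [].
  apply/flattenP; exists [seq eigvals (C Y) 0 i | i <- enum 'I_n].
    by apply/mapP; exists Y; rewrite ?mem_enum.
  by apply/mapP; exists i; rewrite ?mem_enum.
pose N1 Y := count_ge (C Y) mu.
pose K := [set x in J | N1 [set x] == (N1 set0).+1].
have bump1 Y x : x \notin Y -> (N1 Y <= N1 (x |: Y) <= (N1 Y).+1)%N.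
  by move=> xY; rewrite /N1 C_U1 // count_ge_bump // ltW.
exists mu, (N1 set0), K; split.
- by rewrite ler_norml; apply/andP; split; lra.
- by apply/subsetP => x; rewrite inE => /andP[].
move=> Y; rewrite -/(N1 Y); elim: {Y}#|Y| {-2}Y (erefl #|Y|) => [|k IH] Y.
  by move/eqP; rewrite cards_eq0 => /eqP-> _; rewrite setI0 cards0 addn0.
move=> Yk; have /card_gt0P[x xY] : (0 < #|Y|)%N by rewrite Yk.
move=> YJ; have xJ := subsetP YJ _ xY.
rewrite -(setD1K xY); set Z := Y :\ x.
have xZ : x \notin Z by rewrite setD11.
have ZJ : Z \subset J by apply: subset_trans YJ; apply: subD1set.
have key : (N1 (x |: Z) - N1 Z = N1 [set x] - N1 set0)%N.
  have eqx : C [set x] = bump_mx v x (C set0).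
    by rewrite -(C_U1 (negbT (in_set0 x))) setU0.
  rewrite /N1 eqx (C_U1 xZ).
  have uZ : bump_mx v x (C Z) - mu%:M \in unitmx by rewrite -(C_U1 xZ).
  apply: (count_ge_bump_block (sC Z) (sC set0) v0 (S_own xJ) _ _ (unitC set0) uZ).
  - apply/matrixP => i j; rewrite !mul_diag_mx !mxE.
    have [iS|] := boolP (i \in S x); last by rewrite !mul0r.
    congr (_ * _); congr (_ + _); congr (_ + _ * _); rewrite in_set0.
    have [_|//] := eqVneq i j.
    suff -> : (i \in Z) = false by [].
    apply/negP => iZ; have := S_other xJ (subsetP ZJ _ iZ).
    rewrite iS => /(_ _)/negP; case=> //.
    by apply: contraNneq xZ => ->.
  - apply/matrixP => i j; rewrite mul_diag_mx mul_mx_diag !mxE [RHS]mulrC.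
    have [->//|ij] := eqVneq (i \in S x) (j \in S x).
    have := S_block xJ ij; rewrite mxE => h0.
    have -> : (i == j) = false by apply: contraNF ij => /eqP->.
    by rewrite mulr0n mulr0 addr0 h0 !mulr0.
have /andP[l1 h1] := bump1 _ _ xZ.
have /andP[l2 h2] := bump1 set0 x (negbT (in_set0 x)); rewrite setU0 in l2 h2.
have NZ : N1 Z = (N1 set0 + #|K :&: Z|)%N.
  by apply: (IH Z _ ZJ); move: Yk; rewrite (cardsD1 x) xY add1n => -[].
rewrite {}NZ in key l1 h1.
have [xK|xK] := boolP (x \in K).
  have -> : K :&: (x |: Z) = x |: (K :&: Z).
    by apply/setP => y; rewrite !(in_setI, in_setU1); case: eqP => [->|//]; rewrite xK.
  rewrite cardsU1 in_setI (negbTE xZ) andbF /=.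
  move: xK; rewrite inE => /andP[_ /eqP xK]; move: key l1 h1 l2 h2 xK; clear.
  by move: (N1 _) (N1 _) (N1 _) #|_| => p q r t; clear; lia.
have -> : K :&: (x |: Z) = K :&: Z.
  by apply/setP => y; rewrite !(in_setI, in_setU1); case: eqP => [->|//]; rewrite (negbTE xK).
move: xK; rewrite inE xJ /= => /eqP xK; move: key l1 h1 l2 h2 xK; clear.
by move: (N1 _) (N1 _) (N1 _) #|_| => p q r t; clear; lia.
Qed.


Let count_near mu N (K : {set 'I_n}) Y nu : `|mu - l0| <= w / 4 ->
  (forall Y, Y \subset J -> count_ge (C Y) mu = (N + #|K :&: Y|)%N) ->
  Y \subset J -> `|nu - l0| <= w / 4 ->
  (count_ge (A Y) nu <= N + #|K :&: Y| + m)%N /\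
  (N + #|K :&: Y| <= count_ge (A Y) nu + m)%N.
Proof.
move=> hmu cnt YJ hnu; rewrite -(cnt _ YJ).
apply: (count_ge_two_ends (l0 := l0) (w := w) (b := b)) => //.
- exact: site_mx_sym.
- by move=> t; exact: leak.
- by have := win (t := 1) YJ; rewrite ler01 lexx scale1r; exact.
Qed.

(** Each resonant Y receives a label: the half of the large entries (inside or
    outside the symmetric difference with K) that has at least g elements, an
    annulus free of eigenvalues, and the value of the relative count, which lies
    in an interval of length 2m by comparison with the decoupled operator. Each
    label class is a Sperner family; for the entries inside the symmetric
    difference this holds for - A as a function of the complement of Y. *)
Theorem fiber_bound (F : {set {set 'I_n}}) g : (0 < g)%N ->
  (forall Y, Y \in F -> Y \subset J /\ exists l (u : 'rV[R]_n),
    [/\ dotr u u = 1, u *m A Y = l *: u, `|l - l0| < s 0 &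
        (2 * g <= #|[set x in J | (c <= u 0 x ^+ 2)%R]|)%N]) ->
  (g * #|F| <= 2 * m.+1 * (2 * m).+1 * (#|J| * 'C(#|J|, #|J|./2)))%N.
Proof.
move=> g0 hF; have [mu [N [K [hmu KJ cnt]]]] := decoupled_count.
pose A0' := - (A0 + v *: diag_mx (indic J)); pose A' := site_mx A0'.
have sA0' : A0'^T = A0' by rewrite /A0' linearN linearD linearZ /= tr_diag_mx sA0.
have A'E Y : Y \subset J -> A' (J :\: Y) = - A Y.
  move=> YJ; rewrite /A' /A0' /A /site_mx !opprD -addrA; congr (_ + _).
  rewrite -scalerN -scalerN -scalerDr; congr (_ *: _).
  apply/matrixP => i j; rewrite !mxE !inE.
  have [_|_] := eqVneq i j; last by rewrite !mulr0n oppr0 addr0.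
  have [/(subsetP YJ)->|_] := boolP (i \in Y); first by rewrite addr0.
  by case: (i \in J); rewrite ?oppr0 ?addr0 // addNr.
have s_k (k : 'I_m.+1) : 0 < s k <= w / 4.
  by rewrite s0 (le_trans _ s_w) // s_mono // ltnW.
pose lbl := (bool * 'I_m.+1 * 'I_(2 * m).+1)%type.
(* The sign sg tells whether the large entries lie inside or outside the symmetric
   difference of Y and K. *)
pose G Y (u : 'rV[R]_n) (sg : bool) : {set 'I_n} :=
  [set x in J | (c <= u 0 x ^+ 2) && ((x \in Y) (+) (x \in K) == sg)].
pose good Y (a : lbl) (u : 'rV[R]_n) l := [/\ dotr u u = 1, u *m A Y = l *: u, 
  `|l - l0| < s a.1.2, spectral_gap (A Y) l0 (s a.1.2) (s a.1.2.+1) &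
  (g <= #|G Y u a.1.1|)%N].
pose relk Y (a : lbl) : nat := if a.1.1 then rel_count K A' (- l0) (s a.1.2) (J :\: Y)
   else rel_count K A l0 (s a.1.2) Y.
pose base (sg : bool) : nat := if sg then (n - N)%N else (N + #|K|)%N.
have [lab labP] : exists lab : {set 'I_n} -> lbl, forall Y, Y \in F ->
    (exists u l, good Y (lab Y) u l) /\
    (relk Y (lab Y) + m = base (lab Y).1.1 + (lab Y).2)%N.
  apply: (@fin_all_exists _ (fun=> lbl) (fun Y a => Y \in F ->
    (exists u l, good Y a u l) /\ (relk Y a + m = base a.1.1 + a.2)%N)) => Y.
  have [YF|_] := boolP (Y \in F); last by exists (true, ord0, ord0).
  have [YJ [l [u [u1 uA ls0 hg]]]] := hF _ YF.
  have [k gap] := gap_exists YJ; have /andP[sk0 skw] := s_k k.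
  have [sg hsg] : exists sg, (g <= #|G Y u sg|)%N.
    apply/existsP; apply: contraT => /existsPn h; move: hg; rewrite leqNgt => /negP; case.
    have h1 := h true; have h2 := h false; rewrite -ltnNge in h1; rewrite -ltnNge in h2.
    have -> : [set x in J | (c <= u 0 x ^+ 2)%R] = G Y u true :|: G Y u false.
      by apply/setP => x; rewrite !inE; case: (_ (+) _); rewrite /= ?andbT ?andbF ?orbF.
    by apply: leq_ltn_trans (leq_card_setU _ _) _; rewrite mul2n -addnn; rewrite -addSn; exact: leq_add h1 (ltnW h2).
  have cK : (#|K :&: Y| + #|K :\: Y| = #|K|)%N by rewrite cardsID.
  have KY : (#|K :&: Y| <= #|K|)%N by rewrite -cK leq_addr.
  have ls : `|l - l0| < s k.
    by apply: lt_le_trans ls0 _; apply: s_mono => //; apply: ltnW.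
  have [j hj] : exists j : 'I_(2 * m).+1,
      (relk Y (sg, k, j) + m = base sg + j)%N.
    suff [h1 h2] : (base sg <= relk Y (sg, k, ord0) + m)%N /\
        (relk Y (sg, k, ord0) <= base sg + m)%N.
      have lt : (relk Y (sg, k, ord0) + m - base sg < (2 * m).+1)%N.
        by move: h1 h2; move: (relk _ _) (base _) => r p h1 h2; clear -h1 h2; lia.
      by exists (Ordinal lt); rewrite /= subnKC.
    have [hle hge] : (count_ge (A Y) (l0 + s k) <= N + #|K :&: Y| + m)%N /\
       (N + #|K :&: Y| <= count_ge (A Y) (l0 + s k) + m)%N.
      by apply: (count_near hmu cnt YJ); rewrite addrAC subrr add0r gtr0_norm.
    case: sg {hsg} => /=; rewrite /relk /base /rel_count /=; last first.
      move: hle hge cK; move: (count_ge _ _) #|K :&: Y| #|K :\: Y| #|K| => p q r t.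
      by move=> h1 h2 h3; clear -h1 h2 h3; lia.
    rewrite A'E // setDDr.
    have -> : K :\: J = set0 by apply/eqP; rewrite setD_eq0.
    rewrite set0U.
    have sA : (A Y)^T = A Y by exact: site_mx_sym.
    have [hle' hge'] : (count_ge (A Y) l0 <= N + #|K :&: Y| + m)%N /\
       (N + #|K :&: Y| <= count_ge (A Y) l0 + m)%N.
      by apply: (count_near hmu cnt YJ); rewrite subrr normr0; apply/ltW/(lt_le_trans sk0).
    have [hle2 hge2] : (count_ge (A Y) (l0 - s k) <= N + #|K :&: Y| + m)%N /\
       (N + #|K :&: Y| <= count_ge (A Y) (l0 - s k) + m)%N.
      by apply: (count_near hmu cnt YJ); rewrite addrAC subrr add0r normrN gtr0_norm.
    have lt : l0 - s k < l0 by rewrite gtrBl.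
    have := count_geN_le sA lt; have := count_geN_ge (l0 - s k) sA.
    have Nn : (N <= n)%N.
      have := cnt set0 (sub0set J); rewrite setI0 cards0 addn0 => <-.
      by rewrite /count_ge; apply: leq_trans (max_card _) _; rewrite card_ord.
    have -> : - (l0 - s k) = - l0 + s k by rewrite opprB addrC.
    move: Nn hle' hge' hle2 hge2 {hle hge}.
    move: (count_ge (- A Y) _) (count_ge (A Y) l0) (count_ge (A Y) _) #|K :&: Y| => p q r t.
    by move=> h0 h1 h2 h3 h4 h5 h6; clear -h0 h1 h2 h3 h4 h5 h6; lia.
  exists (sg, k, j) => _; split => //.
  by exists u, l; split.
have -> : #|F| = (\sum_(a : lbl) #|[set Y in F | lab Y == a]|)%N.
  rewrite -sum1_card (partition_big lab xpredT) //=.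
  by apply: eq_bigr => a _; rewrite -sum1_card; apply: eq_bigl => Y; rewrite inE.
rewrite big_distrr /=; apply: leq_trans (_ : \sum_(a : lbl) (#|J| * 'C(#|J|, #|J|./2)) <= _)%N; last first.
  by rewrite sum_nat_const !card_prod !card_ord card_bool.
apply: leq_sum => -[[sg k] j] _; have /andP[sk0 skw] := s_k k.
have km : (k <= m)%N by rewrite -ltnS.
have [Fa0|[Y0 Y0F]] := set_0Vmem [set Y in F | lab Y == (sg, k, j)].
  by rewrite Fa0 cards0 muln0.
case: sg Y0 Y0F => Y0 Y0F.
  (* The complement in J, continued to an involution of all sets. *)
  rewrite -(card_imset (f := fun Y => J :\: Y :|: (Y :\: J))); last first.
    apply: (can_inj (g := fun Y => J :\: Y :|: (Y :\: J))) => Y.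
    by apply/setP => x; rewrite !inE; case: (x \in J); case: (x \in Y).
  apply: (peaked_sperner (A := A') (l0 := - l0) KJ _ v0 _ c0 (s_v km) (s_step km)
     (k := (base true + j - m)%N)) => //.
  - by move=> Y; exact: site_mx_sym.
  - by move=> Y x _; exact: site_mxU1.
  move=> _ /imsetP[Y + ->]; rewrite inE => /andP[YF /eqP labY].
  have [YJ _] := hF _ YF; have := labP _ YF; rewrite labY /good /relk /=.
  have -> : Y :\: J = set0 by apply/eqP; rewrite setD_eq0.
  rewrite setU0; move=> [[u [l [u1 uA ls gap hG]]] hk]; split.
  - exact: subsetDl.
  - by rewrite -hk addnK.
  exists (G Y u true); split=> //; last first.
    move=> x; rewrite !inE => /and3P[xJ _ h]; rewrite xJ andbT; split=> //.
    by move: h; case: (x \in Y); case: (x \in K).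
  exists (- l), u; split=> //.
  - by rewrite A'E // mulmxN uA scaleNr.
  - by rewrite -opprD normrN.
  - by rewrite A'E //; apply: spectral_gapN.
  - by move=> x; rewrite inE => /and3P[].
apply: (peaked_sperner (A := A) (l0 := l0) KJ _ v0 _ c0 (s_v km) (s_step km)
     (k := (base false + j - m)%N)) => //.
- by move=> Y; exact: site_mx_sym.
- by move=> Y x _; exact: site_mxU1.
move=> Y; rewrite inE => /andP[YF /eqP labY].
have [YJ _] := hF _ YF; have := labP _ YF; rewrite labY /good /relk /=.
move=> [[u [l [u1 uA ls gap hG]]] hk]; split=> //.
  by rewrite -hk addnK.
exists (G Y u false); split=> //; last first.
  move=> x; rewrite !inE => /and3P[xJ _ h]; split=> //.
  by move: h; case: (x \in Y); case: (x \in K).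
exists l, u; split=> //.
by move=> x; rewrite inE => /and3P[].
Qed.

End Fiber.

End SpectralCombinatorics.
Import SpectralCombinatorics.

Local Open Scope ring_scope.

(** * Boxes and walks in the lattice *)

Section Boxes.
Local Open Scope classical_set_scope.
Implicit Types (a b x y : site) (h : int).

Definition ibox h a : set site := [set x | `|a.1 - x.1| <= h /\ `|a.2 - x.2| <= h].

Lemma boxE (R : realType) (l : R) a : box l a = ibox (Num.floor ((l - 1) / 2)) a.
Proof.
apply/seteqP; split => x /=; rewrite /box /ibox /distoo /= -floor_ge_int ge_max.
  by move=> /andP[].
by move=> [-> ->].
Qed.

Let box_site (h : nat) a (p : 'I_(h.*2.+1) * 'I_(h.*2.+1)) : site :=
  (a.1 - h%:Z + (p.1 : nat)%:Z, a.2 - h%:Z + (p.2 : nat)%:Z).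

Let ibox_image (h : nat) a :
  ibox h%:Z a = [set` [fset @box_site h a p | p in predT]%fset].
Proof.
apply/seteqP; split=> x /=; rewrite /ibox /=.
  move=> [h1 h2]; apply/imfsetP => /=.
  have l1 : (absz (x.1 - (a.1 - h%:Z))%R < h.*2.+1)%N by lia.
  have l2 : (absz (x.2 - (a.2 - h%:Z))%R < h.*2.+1)%N by lia.
  exists (Ordinal l1, Ordinal l2) => //.
  by rewrite [LHS]surjective_pairing /box_site /=; congr pair; lia.
move=> /imfsetP[[i j] /= _ ->]; rewrite /box_site /=.
by have := ltn_ord i; have := ltn_ord j; lia.
Qed.

Lemma finite_ibox h a : finite_set (ibox h a).
Proof.
case: h => h; first by rewrite ibox_image.
by apply: (sub_finite_set (B := set0)) => // x [] /=; lia.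
Qed.

Lemma num_sites_ibox (h : nat) a : num_sites (ibox h%:Z a) = (h.*2.+1 ^ 2)%N.
Proof.
rewrite /num_sites ibox_image set_fsetK card_imfset /=; last first.
  move=> [i j] [i' j'] /= [] e1 e2; congr pair; apply: val_inj => /=; lia.
by rewrite -cardE card_prod !card_ord; ring.
Qed.

Lemma num_sites_sub (A B : set site) : finite_set B -> A `<=` B ->
  (num_sites A <= num_sites B)%N.
Proof.
move=> fB AB; apply: fsubset_leq_card; apply/fsubsetP => x.
have fA := sub_finite_set AB fB.
by rewrite !in_fset_set // !inE; exact: AB.
Qed.

Lemma adj_sym x y : adj x y = adj y x.
Proof. by rewrite /adj; lia. Qed.

Lemma joined_refl (A : set site) x : A x -> joined A x x.
Proof. by move=> Ax; exists [::]; split=> // c; rewrite inE => /eqP->. Qed.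

Lemma joined_snoc (A : set site) x y z : joined A x y -> adj y z -> A z -> joined A x z.
Proof.
move=> [p [px <- pA]] yz Az; exists (rcons p z); split.
- by rewrite rcons_path px.
- by rewrite last_rcons.
- by move=> c; rewrite -rcons_cons mem_rcons inE => /orP[/eqP->//|]; exact: pA.
Qed.

Lemma joined_left (A : set site) x y z : adj x y -> A x -> joined A y z -> joined A x z.
Proof.
move=> xy Ax [p [py <- pA]]; exists (y :: p); split=> //=; first by rewrite xy.
by move=> c; rewrite inE => /orP[/eqP->//|]; exact: pA.
Qed.

Lemma connected_ibox h a : connected_graph (ibox h a).
Proof.
move=> x [y1 y2].
have [m] : exists m, (absz (x.1 - y1)%R + absz (x.2 - y2)%R)%N = m by eexists.
elim: m x => [|m IH] [x1 x2] /=.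
  move=> h0 Ax _; have -> : (y1, y2) = (x1, x2) by congr pair; lia.
  exact: joined_refl.
move=> hm Ax Ay.
have [z [xz Az zm]] : exists z : site, [/\ adj (x1, x2) z, ibox h a z &
    (absz (z.1 - y1)%R + absz (z.2 - y2)%R)%N = m].
  rewrite /ibox /= in Ax Ay *; rewrite /adj /=.
  have [e|[e|[e|e]]] : x1 < y1 \/ y1 < x1 \/ x2 < y2 \/ y2 < x2 by lia.
  - by exists (x1 + 1, x2) => /=; split; lia.
  - by exists (x1 - 1, x2) => /=; split; lia.
  - by exists (x1, x2 + 1) => /=; split; lia.
  - by exists (x1, x2 - 1) => /=; split; lia.
by apply: (joined_left xz Ax); apply: IH.
Qed.

End Boxes.

Section Walk.
Context {R : realType}.

(** In the equation at (i + 1, j) the value at (i, j) is a combination of the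
    values at the centre and at the other three neighbours, so one of these is
    at least a fraction 1/M of it. All four have larger first coordinate, by one
    or two. *)
Lemma walk (U E : int -> int -> R) (H : int) (M : R) : 1 <= M ->
  (forall i j, U i j != 0 -> `|i| <= H /\ `|j| <= H) ->
  (forall i j, `|i| <= H -> `|j| <= H -> `|E i j| + 3 <= M /\
     U (i - 1) j + U (i + 1) j + U i (j - 1) + U i (j + 1) = E i j * U i j) ->
  forall (n : nat) i j e, 0 < e -> e <= `|U i j| -> i + n%:Z <= H ->
  exists i' j', [/\ i + n%:Z <= i' <= i + n%:Z + 1, `|j' - j| <= n%:Z &
     e / M ^+ n <= `|U i' j'|].
Proof.
move=> M1 supp eqn n i j e e0 eU.
have M0 : 0 < M by apply: lt_le_trans M1.
elim: n => [|n IH] hn.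
  by exists i, j; rewrite expr0 divr1; split=> //; lia.
have [|i1 [j1 [hi hj hU]]] := IH; first by lia.
have step : e / M ^+ n.+1 <= e / M ^+ n.
  by rewrite ler_wpM2l ?(ltW e0) // lef_pV2 ?posrE ?exprn_gt0 // exprS ler_peMl // exprn_ge0 // ltW.
have [i1E|i1E] : i1 = i + n%:Z \/ i1 = i + n%:Z + 1 by lia.
  have [q qE] : exists q, q = e / M ^+ n by eexists.
  have q0 : 0 < q by rewrite qE divr_gt0 // exprn_gt0.
  rewrite -qE in hU step.
  have U0 : U i1 j1 != 0 by rewrite -normr_gt0; apply: lt_le_trans hU.
  have [Hi Hj] := supp _ _ U0.
  have [||hE he] := eqn (i1 + 1) j1; [by clear -Hi hn i1E; lia | exact: Hj |].
  have qM : e / M ^+ n.+1 = q / M by rewrite exprSr invfM mulrA qE.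
  clear IH qE step.
  rewrite addrK in he.
  have [h|h] := leP (q / M) `|U (i1 + 1) j1|.
    by exists (i1 + 1), j1; rewrite qM; split; [clear -hi hj i1E; lia | clear -hi hj i1E; lia | done].
  have [h2|h2] := leP (q / M) `|U (i1 + 1 + 1) j1|.
    by exists (i1 + 1 + 1), j1; rewrite qM; split; [clear -hi hj i1E; lia | clear -hi hj i1E; lia | done].
  have [h3|h3] := leP (q / M) `|U (i1 + 1) (j1 - 1)|.
    by exists (i1 + 1), (j1 - 1); rewrite qM; split; [clear -hi hj i1E; lia | clear -hi hj i1E; lia | done].
  have [h4|h4] := leP (q / M) `|U (i1 + 1) (j1 + 1)|.
    by exists (i1 + 1), (j1 + 1); rewrite qM; split; [clear -hi hj i1E; lia | clear -hi hj i1E; lia | done].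
  exfalso; suff : `|U i1 j1| < q by rewrite ltNge hU.
  have -> : U i1 j1 = E (i1 + 1) j1 * U (i1 + 1) j1 - U (i1 + 1 + 1) j1
      - U (i1 + 1) (j1 - 1) - U (i1 + 1) (j1 + 1) by rewrite -he; ring.
  apply: le_lt_trans (ler_normB _ _) _.
  apply: le_lt_trans (lerD (ler_normB _ _) (lexx _)) _.
  apply: le_lt_trans (lerD (lerD (ler_normB _ _) (lexx _)) (lexx _)) _.
  rewrite normrM.
  have hEU : `|E (i1 + 1) j1| * `|U (i1 + 1) j1| <= (M - 3) * (q / M).
    by apply: ler_pM => //; [lra | exact: ltW].
  have : q = (M - 3) * (q / M) + 3 * (q / M) by field; rewrite gt_eqF.
  by lra.
exists i1, j1; split; [clear -hi hj i1E; lia | clear -hi hj i1E; lia | exact: le_trans hU].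
Qed.

End Walk.

Section Reach.
Context {R : realType}.
Local Open Scope classical_set_scope.

Definition oriented (s : bool) (i : int) : int := if s then i else - i.

Lemma walk_y (u E : site -> R) (H : int) (a0 : site) M (s : bool) : 1 <= M ->
  (forall x, u x != 0 -> ibox H a0 x) ->
  (forall x, ibox H a0 x -> `|E x| + 3 <= M /\
     u (x.1 - 1, x.2) + u (x.1 + 1, x.2) + u (x.1, x.2 - 1) + u (x.1, x.2 + 1) = E x * u x) ->
  forall (n : nat) i j e, 0 < e -> e <= `|u (a0.1 + j, a0.2 + oriented s i)| ->
  i + n%:Z <= H ->
  exists i' j', [/\ i + n%:Z <= i' <= i + n%:Z + 1, `|j' - j| <= n%:Z &
     e / M ^+ n <= `|u (a0.1 + j', a0.2 + oriented s i')|].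
Proof.
move=> M1 supp eqn.
pose U i j := u (a0.1 + j, a0.2 + oriented s i).
pose E' i j := E (a0.1 + j, a0.2 + oriented s i).
apply: (walk (U := U) (E := E') M1).
  by move=> i j /supp; rewrite /ibox /oriented /=; clear; case: s => -[]; lia.
move=> i j Hi Hj.
have [|hE he] := eqn (a0.1 + j, a0.2 + oriented s i).
  by rewrite /ibox /oriented /=; clear -Hi Hj; case: s; lia.
split=> //; rewrite /U -he /= /oriented; clear; move: (a0.1) (a0.2) => a1 a2.
have -> : a1 + (j - 1) = a1 + j - 1 by lia.
have -> : a1 + (j + 1) = a1 + j + 1 by lia.
case: s.
  have -> : a2 + (i - 1) = a2 + i - 1 by lia.
  have -> : a2 + (i + 1) = a2 + i + 1 by lia.
  ring.
have -> : a2 + - (i - 1) = a2 - i + 1 by lia.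
have -> : a2 + - (i + 1) = a2 - i - 1 by lia.
ring.
Qed.


Lemma walk_x (u E : site -> R) (H : int) (a0 : site) M (s : bool) : 1 <= M ->
  (forall x, u x != 0 -> ibox H a0 x) ->
  (forall x, ibox H a0 x -> `|E x| + 3 <= M /\
     u (x.1 - 1, x.2) + u (x.1 + 1, x.2) + u (x.1, x.2 - 1) + u (x.1, x.2 + 1) = E x * u x) ->
  forall (n : nat) i j e, 0 < e -> e <= `|u (a0.1 + oriented s i, a0.2 + j)| ->
  i + n%:Z <= H ->
  exists i' j', [/\ i + n%:Z <= i' <= i + n%:Z + 1, `|j' - j| <= n%:Z &
     e / M ^+ n <= `|u (a0.1 + oriented s i', a0.2 + j')|].
Proof.
move=> M1 supp eqn n i j e.
apply: (walk_y (u := fun x => u (x.2, x.1)) (E := fun x => E (x.2, x.1))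
  (a0 := (a0.2, a0.1)) (H := H)) => //.
  by move=> x /supp[].
move=> x [h1 h2]; have [|hE <-] := eqn (x.2, x.1); first by split.
by split=> //=; ring.
Qed.

(** Among K + 1 rows at distances D, 2 D, ... from the start, one is far from
    all K excluded boxes, since D exceeds the width of the forbidden range of
    rows around each of them. A vertical walk that starts in the direction of
    the middle row reaches it, and rho further steps towards the middle column
    move away from the sides of the large box. *)
Lemma reach_clear_box (u E : site -> R) (H h3 rho K : nat) (a0 a : site) (q : 'I_K -> site) M e :
  1 <= M ->
  (forall x, u x != 0 -> ibox H a0 x) ->
  (forall x, ibox H a0 x -> `|E x| + 3 <= M /\
     u (x.1 - 1, x.2) + u (x.1 + 1, x.2) + u (x.1, x.2 - 1) + u (x.1, x.2 + 1) = E x * u x) ->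
  (K.+2 * (4 * rho + 2 * h3 + 5) <= H)%N -> 0 < e -> e <= `|u a| ->
  exists p, [/\ ibox rho p `<=` ibox H a0,
     forall k x, ibox rho p x -> ~ ibox h3 (q k) x &
     e / M ^+ (K.+1 * (4 * rho + 2 * h3 + 5) + rho) <= `|u p|].
Proof.
move=> M1 supp eqn; set D := (4 * rho + 2 * h3 + 5)%N => KD e0 eu.
have M0 : 0 < M by apply: lt_le_trans M1.
have Ha : ibox H a0 a by apply: supp; rewrite -normr_gt0; apply: lt_le_trans eu.
pose s := (a.2 <= a0.2); pose i0 := oriented s (a.2 - a0.2).
have i0P : - H%:Z <= i0 <= 0.
  move: Ha => []; rewrite /i0 /s /oriented.
  by move: (a.1) (a.2) (a0.1) (a0.2) => x1 x2 y1 y2; clear; case: (leP x2 y2) => *; apply/andP; split; lia.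
have aE : a = (a0.1 + (a.1 - a0.1), a0.2 + oriented s i0).
  rewrite [LHS]surjective_pairing /i0 /oriented; congr pair; first by lia.
  by case: (s); lia.
pose c k : int := oriented s ((q k).2 - a0.2).
have [t tP] : exists t : 'I_K.+1, forall k,
    ~ (`|c k - (i0 + (t.+1 * D)%:Z)| <= (2 * rho + 2 + h3)%:Z).
  have [/existsP[t /forallP tP]|/existsPn h] := boolP [exists t : 'I_K.+1,
     [forall k, ~~ (`|c k - (i0 + (t.+1 * D)%:Z)| <= (2 * rho + 2 + h3)%:Z)]].
    by exists t => k; apply/negP/tP.
  (* Each excluded box spoils at most one candidate row, so all K + 1 cannot be
     spoilt. *)
  have [f hf] : exists f : 'I_K.+1 -> 'I_K, forall t : 'I_K.+1,
     `|c (f t) - (i0 + (t.+1 * D)%:Z)| <= (2 * rho + 2 + h3)%:Z.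
    apply: (@fin_all_exists _ (fun=> 'I_K) (fun (t : 'I_K.+1) k =>
      `|c k - (i0 + (t.+1 * D)%:Z)| <= (2 * rho + 2 + h3)%:Z)) => t.
    by have := h t; rewrite negb_forall => /existsP[k]; rewrite negbK; exists k.
  have f_inj : injective f.
    move=> t t' ft; apply/eqP; rewrite -val_eqE /=; apply/negPn/negP => ne.
    have := hf t; have := hf t'; rewrite ft; move: (c _) => ck h1 h2.
    have : (t < t' \/ t' < t)%N by move: ne; clear; lia.
    have DD : (D > 2 * (2 * rho + 2 + h3))%N by rewrite /D; clear; lia.
    move: (nat_of_ord t) (nat_of_ord t') h1 h2 => n n' h1 h2; clear -h1 h2 DD.
    move: DD h1 h2; move: D (2 * rho + 2 + h3)%N => d w; clear; nia.
  by have := leq_card f f_inj; rewrite !card_ord ltnn.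
have tD : (t.+1 * D + D <= H)%N.
  apply: leq_trans KD; rewrite -mulSnr leq_mul2r; apply/orP; right.
  by have := ltn_ord t.
rewrite aE in eu.
have [|i1 [j1 [hi1 hj1 u1]]] := walk_y M1 supp eqn (n := t.+1 * D) (i := i0) e0 eu.
  by move: i0P tD; move: (t.+1 * D)%N => td; clear; lia.
set e1 := e / _ in u1.
have e10 : 0 < e1 by rewrite divr_gt0 // exprn_gt0.
have Hp1 : ibox H a0 (a0.1 + j1, a0.2 + oriented s i1).
  by apply: supp; rewrite -normr_gt0; apply: lt_le_trans u1.
pose s' := (j1 <= 0).
have j1E : j1 = oriented s' (oriented s' j1) by rewrite /oriented; case: (s'); clear; lia.
rewrite {1}j1E in u1.
have DE : D = (4 * rho + 2 * h3 + 5)%N by [].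
have [|j2 [i2 [hj2 hi2 u2]]] := walk_x M1 supp eqn (n := rho) e10 u1.
  by rewrite /s' /oriented; move: tD DE; move: (t.+1 * D)%N (D) => td d; clear; case: (leP j1 0); lia.
exists (a0.1 + oriented s' j2, a0.2 + i2); split.
- move=> x; rewrite /ibox /=.
  move: Hp1 => [] /= hp1 hp2.
  move: hp1 hp2 hi1 hj2 hi2 tD DE i0P; move: (t.+1 * D)%N (D) => td d.
  rewrite /s' /oriented; move: (a0.1) (a0.2) (i0) (j1) (s) => a1 a2 i00 j11 ss.
  clear; case: x => x1 x2 /=; case: (leP j11 0); case: ss; lia.
- move=> k x; have := tP k; rewrite /ibox /=.
  move: hi1 hi2; rewrite /c /oriented; move: (t.+1 * D)%N => td.
  move: (a0.1) (a0.2) (i0) (q k) (s) => a1 a2 i00 [q1 q2] ss.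
  clear; case: x => x1 x2 /=; case: ss; lia.
apply: le_trans u2; rewrite /e1 -mulrA -invfM -exprD ler_wpM2l ?(ltW e0) //.
rewrite lef_pV2 ?posrE ?exprn_gt0 //; apply: ler_weXn2l => //.
by rewrite leq_add2r leq_mul2r ltn_ord orbT.
Qed.

End Reach.

(** * Operators on a finite set of sites *)

Section Sites.
Local Open Scope classical_set_scope.
Variable S : set site.
Hypothesis fS : finite_set S.
Notation n := (num_sites S).

Lemma site_of_in (i : 'I_n) : S (site_of i).
Proof.
have : site_of i \in fset_set S by rewrite /site_of mem_nth.
by rewrite in_fset_set // inE.
Qed.

Lemma site_of_inj : injective (@site_of S).
Proof.
move=> i j /eqP; rewrite /site_of nth_uniq ?fset_uniq // => /eqP; exact: val_inj.
Qed.

Lemma site_of_surj x : S x -> exists i : 'I_n, site_of i = x.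
Proof.
move=> Sx; have xS : x \in fset_set S by rewrite in_fset_set // inE.
have lt : (index x (fset_set S) < num_sites S)%N by rewrite index_mem.
by exists (Ordinal lt); rewrite /site_of /= nth_index.
Qed.

Definition index_set (A : set site) : {set 'I_n} := [set i | `[< A (site_of i) >]]%SET.

Lemma in_index_set A i : (i \in index_set A) = `[< A (site_of i) >].
Proof. by rewrite inE. Qed.

Lemma index_setP A i : reflect (A (site_of i)) (i \in index_set A).
Proof. by rewrite inE; exact: asboolP. Qed.

Lemma card_index_set A : A `<=` S -> #|index_set A| = num_sites A.
Proof.
move=> AS; have fA : finite_set A by apply: sub_finite_set fS.
rewrite /num_sites.
have -> : fset_set A = [fset site_of i | i in index_set A]%fset.
  apply/fsetP => x; rewrite in_fset_set //; apply/idP/imfsetP.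
    rewrite inE => Ax; have [i ix] := site_of_surj (AS _ Ax).
    by exists i => //=; apply/index_setP; rewrite ix.
  by move=> [i /= /index_setP Ai ->]; rewrite inE.
by rewrite card_imfset /= -?cardE //; exact: site_of_inj.
Qed.

Lemma num_sites_setD (A B : set site) : A `<=` S -> B `<=` S ->
  num_sites (A `\` B) = (num_sites A - num_sites (A `&` B))%N.
Proof.
move=> AS BS; rewrite -(card_index_set AS).
have /card_index_set<- : A `\` B `<=` S by move=> x [] /AS.
have /card_index_set<- : A `&` B `<=` S by move=> x [] /AS.
have -> : index_set (A `\` B) = index_set A :\: index_set B.
  apply/setP => i; rewrite finset.in_setD; apply/index_setP/andP.
    by move=> [Ai Bi]; split; [apply/negP => /index_setP | apply/index_setP].
  by move=> [/negP Bi /index_setP Ai]; split=> // /index_setP.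
have -> : index_set (A `&` B) = index_set A :&: index_set B.
  apply/setP => i; rewrite finset.in_setI; apply/index_setP/andP.
    by move=> [Ai Bi]; split; apply/index_setP.
  by move=> [/index_setP Bi /index_setP Ai]; split.
by rewrite cardsD.
Qed.

End Sites.

Section Operators.
Context {R : realType}.
Local Open Scope classical_set_scope.
Variable S : set site.
Hypothesis fS : finite_set S.
Notation n := (num_sites S).

Definition neighbors (x : site) : seq site :=
  [:: (x.1 - 1, x.2); (x.1 + 1, x.2); (x.1, x.2 - 1); (x.1, x.2 + 1)].

Lemma mem_neighbors x y : (y \in neighbors x) = adj x y.
Proof.
case: x y => [x1 x2] [y1 y2]; rewrite !inE /adj /= !xpair_eqE.
apply/idP/idP; lia.
Qed.

Lemma uniq_neighbors x : uniq (neighbors x).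
Proof. case: x => x1 x2; rewrite /= !inE !xpair_eqE; lia. Qed.

Definition extend (u : 'rV[R]_n) (x : site) : R := \sum_(i | site_of i == x) u 0 i.

Lemma extend_site u i : extend u (site_of i) = u 0 i.
Proof.
rewrite /extend (big_pred1 i) // => j.
by rewrite (inj_eq (@site_of_inj S)).
Qed.

Lemma extend_out u x : ~ S x -> extend u x = 0.
Proof.
move=> Sx; rewrite /extend big_pred0 // => i; apply/negbTE/eqP => ix.
by apply: Sx; rewrite -ix; exact: site_of_in.
Qed.

Lemma sum_extend_neighbors u x :
  \sum_(y <- neighbors x) extend u y = \sum_(i | adj x (site_of i)) u 0 i.
Proof.
rewrite /extend; under eq_bigr do rewrite big_mkcond /=.
rewrite exchange_big /= [RHS]big_mkcond; apply: eq_bigr => i _.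
rewrite -big_mkcond -big_filter -mem_neighbors.
rewrite (eq_filter (a2 := pred1 (site_of i))); last by move=> y; rewrite /= eq_sym.
case: ifP => ix; first by rewrite filter_pred1_uniq ?uniq_neighbors // big_seq1.
rewrite (eq_in_filter (a2 := pred0)) ?filter_pred0 ?big_nil // => y yx /=.
by apply: contraFF ix => /eqP<-.
Qed.

Lemma kernelH_sym (V : site -> R) x y : kernelH V x y = kernelH V y x.
Proof. by rewrite /kernelH [y == x]eq_sym adj_sym; case: eqP => // ->. Qed.

Lemma dirichletH_sym (V : site -> R) : (dirichletH S V)^T = dirichletH S V.
Proof. by apply/matrixP => i j; rewrite !mxE kernelH_sym. Qed.

Lemma mul_dirichletH (V : site -> R) (u : 'rV[R]_n) j :
  (u *m dirichletH S V) 0 j =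
  (4 + V (site_of j)) * u 0 j - \sum_(y <- neighbors (site_of j)) extend u y.
Proof.
rewrite sum_extend_neighbors mxE (bigD1 j) //= mxE /kernelH eqxx mulrC; congr (_ + _).
rewrite [in RHS](bigID (pred1 j)) /= [X in _ = - (X + _)]big1 ?add0r; last first.
  by move=> i /andP[+ /eqP ij]; rewrite ij /adj !subrr.
rewrite -sumrN [RHS]big_mkcond [LHS]big_mkcond /=; apply: eq_bigr => i _.
rewrite mxE /kernelH (inj_eq (@site_of_inj S)); case: eqP => //=; rewrite ?andbF //.
by rewrite andbT adj_sym; case: ifP; rewrite ?mulrN1 ?mulr0 // oppr0.
Qed.

Lemma eigenvector_neighbors (V : site -> R) l (u : 'rV[R]_n) x :
  u *m dirichletH S V = l *: u -> S x ->
  \sum_(y <- neighbors x) extend u y = (4 + V x - l) * extend u x.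
Proof.
move=> uA /site_of_surj[//|j <-]; have := mul_dirichletH V u j.
by rewrite uA mxE extend_site => h; rewrite mulrBl h opprB addrC subrK.
Qed.

Lemma schrodingerE (V u : site -> R) x :
  schrodinger V u x = (4 + V x) * u x - \sum_(y <- neighbors x) u y.
Proof.
rewrite /schrodinger /laplacian.
have -> : [set b | adj x b] = [set` neighbors x].
  by apply/seteqP; split=> y /=; rewrite mem_neighbors.
by rewrite -fsbig_seq ?uniq_neighbors //; ring.
Qed.

Lemma l2norm_trmx (u : 'rV[R]_n) : l2norm u^T = Num.sqrt (dotr u u).
Proof.
by rewrite /l2norm dotrE; congr Num.sqrt; apply: eq_bigr => i _; rewrite mxE expr2.
Qed.

Definition norm2_on (E : set site) (u : 'rV[R]_n) : R :=
  \sum_(i in index_set S E) u 0 i ^+ 2.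

Lemma l2norm_on_trmx E (u : 'rV[R]_n) : l2norm_on E u^T = Num.sqrt (norm2_on E u).
Proof.
rewrite /l2norm_on; congr Num.sqrt; apply: eq_big => i.
  by rewrite inE; apply/idP/asboolP; rewrite inE.
by rewrite mxE.
Qed.

End Operators.

(** * Cells, clusters and radii *)

Section Lattice.
Local Open Scope classical_set_scope.
Implicit Types (a b q x y : site) (rd k h : int).

Lemma multiple_gap rd (m N s : int) : 0 < rd -> s < rd ->
  `|rd * m| <= N * rd + s -> `|rd * m| <= N * rd.
Proof.
move=> rd0 srd h; have : `|m| <= N; last by nia.
rewrite -ltzD1; nia.
Qed.

Lemma lattice_apart rd b b' x h h' : lattice rd b -> lattice rd b' -> 0 < rd ->
  h + h' < rd -> ibox h b x -> ibox h' b' x -> b = b'.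
Proof.
move=> [i [j ->]] [i' [j' ->]] rd0 hh [/= h1 h2] [/= h3 h4].
have e1 : `|rd * (i - i')| <= 0 * rd by apply: (multiple_gap (s := h + h')) => //; lia.
have e2 : `|rd * (j - j')| <= 0 * rd by apply: (multiple_gap (s := h + h')) => //; lia.
congr pair; nia.
Qed.

(** All radii and centres are multiples of rd up to errors below rd, so a dyadic
    box that comes near a cell contains its centre, even without the margin hr.
    *)
Lemma dyadic_contains rd N q b x h hr : lattice rd b -> lattice (N * rd) q -> 0 < rd ->
  h + hr < rd -> ibox h b x -> ibox (N * rd + hr) q x -> ibox (N * rd) q b.
Proof.
move=> [i [j ->]] [i' [j' ->]] rd0 hh [/= h1 h2] [/= h3 h4]; split=> /=.
  have -> : N * rd * i' - rd * i = rd * (N * i' - i) by ring.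
  apply: (multiple_gap (s := h + hr)) => //.
  have -> : rd * (N * i' - i) = N * rd * i' - rd * i by ring.
  by move: (N * rd * i') h1 h3 => w; lia.
have -> : N * rd * j' - rd * j = rd * (N * j' - j) by ring.
apply: (multiple_gap (s := h + hr)) => //.
have -> : rd * (N * j' - j) = N * rd * j' - rd * j by ring.
by move: (N * rd * j') h2 h4 => w; lia.
Qed.

Lemma ibox_add h h' a b x : ibox h a b -> ibox h' b x -> ibox (h + h') a x.
Proof. by move=> [/= h1 h2] [/= h3 h4]; split=> /=; lia. Qed.

Lemma ibox_le h h' a x : h <= h' -> ibox h a x -> ibox h' a x.
Proof. by move=> hh [/= h1 h2]; split=> /=; lia. Qed.

Lemma ibox_adj h a x y : ibox h a x -> adj x y -> ibox (h + 1) a y.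
Proof. by rewrite /adj => -[/= h1 h2] xy; split=> /=; lia. Qed.

End Lattice.

Section Clusters.
Context {R : realType}.
Local Open Scope classical_set_scope.
Variables (eps0 : R) (r : nat) (hO hT : int).
Hypotheses (OE : forall a, Omega eps0 r a = ibox hO a)
  (TE : forall a, tOmega eps0 r a = ibox hT a).
Hypotheses (hO0 : 0 <= hO) (hOT : hO + 1 <= hT).
Implicit Types (V : site -> R) (a : site).

Lemma Omega_cluster V a : Omega eps0 r a `<=` Defs.cluster eps0 r V a.
Proof.
move=> x Ox; exists (Omega eps0 r a); split=> //.
by rewrite OE; exact: connected_ibox.
Qed.

Lemma cluster_sub V a :
  Defs.cluster eps0 r V a `<=` Omega eps0 r a `|` (frame eps0 r a `&` zeros V).
Proof. by move=> x [A [_ + _]]; exact. Qed.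

Lemma cluster_ext V V' a : (forall x, frame eps0 r a x -> V x = V' x) ->
  Defs.cluster eps0 r V a = Defs.cluster eps0 r V' a.
Proof.
have half V1 V2 : (forall x, frame eps0 r a x -> V1 x = V2 x) ->
    Defs.cluster eps0 r V1 a `<=` Defs.cluster eps0 r V2 a.
  move=> VV x [A [OA AO cA Ax]]; exists A; split=> // y /AO[|[fy zy]]; [by left|right].
  by split=> //; rewrite /zeros /= -VV.
move=> VV; apply/seteqP; split; apply: half => // x fx.
by rewrite VV.
Qed.

(** A path that leaves Omega and reaches the outside of tOmega has a last
    stretch of zeros in the frame, from the outer boundary of Omega to the inner
    boundary of tOmega; admissibility forbids it. *)
Lemma cluster_tOmega V a : admissible eps0 r V a ->
  Defs.cluster eps0 r V a `<=` tOmega eps0 r a.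
Proof.
move=> [_ adm] x [A [OA AO cA Ax]].
have Oa : Omega eps0 r a a by rewrite OE; split; rewrite subrr normr0.
have [p [pth lst pA]] := cA a x (OA _ Oa) Ax.
suff key : forall y, tOmega eps0 r a y ->
   (Omega eps0 r a y \/ exists2 z, outer_bd (Omega eps0 r a) z &
      joined (frame eps0 r a `&` zeros V) z y) ->
   forall p, path adj y p -> (forall c, c \in p -> A c) -> tOmega eps0 r a (last y p).
  rewrite -lst; apply: key pth _; last by move=> c cp; apply: pA; rewrite inE cp orbT.
    by rewrite TE; move: Oa; rewrite OE; apply: ibox_le; have := hOT; lia.
  by left.
move=> y Ty yP {p pth lst pA} p; elim: p y Ty yP => [//|z p IH] y Ty yP /= /andP[yz pth] pA.
have Az : A z by apply: pA; rewrite inE eqxx.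
have pA' : forall c, c \in p -> A c by move=> c cp; apply: pA; rewrite inE cp orbT.
case: (AO _ Az) => [Oz|fz].
  apply: IH pth pA'; last by left.
  by rewrite TE; move: Oz; rewrite OE; apply: ibox_le; have := hOT; lia.
have [Oy|[z0 z0O z0y]] := yP.
  apply: IH pth pA'.
    rewrite TE; rewrite OE in Oy; have := ibox_adj Oy yz.
    by apply: ibox_le.
  right; exists z; last exact: joined_refl.
  split; first by case: fz => -[].
  by exists y => //; rewrite adj_sym.
have z0z : joined (frame eps0 r a `&` zeros V) z0 z by apply: joined_snoc z0y yz fz.
apply: IH pth pA'; last by right; exists z0.
apply: contrapT => Tz; apply: (adm z0 y) => //.
by split=> //; exists z.
Qed.

Lemma edge_bd_pair (C : set site) x y : edge_bd C [set x; y] ->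
  adj x y /\ ((C x /\ ~ C y) \/ (C y /\ ~ C x)).
Proof.
move=> [a [b [exy [Ca _] [Cb _] ab]]].
have /orP[] : ((x == a) && (y == b)) || ((x == b) && (y == a)).
  have ha : [set x; y] a by rewrite exy; left.
  have hb : [set x; y] b by rewrite exy; right.
  have ne : a != b by apply/eqP => e; apply: Ca; rewrite e.
  by case: ha ne => /= ->; case: hb => /= ->; rewrite ?eqxx /= ?orbT.
- by move=> /andP[/eqP-> /eqP->]; split=> //; right.
by move=> /andP[/eqP-> /eqP->]; split; [rewrite adj_sym | left].
Qed.

Lemma edge_bd_adj (C : set site) x y : C x -> ~ C y -> adj x y -> edge_bd C [set x; y].
Proof.
move=> Cx Cy xy; exists y, x; split.
- by rewrite setUC.
- by split=> //; exists x => //; rewrite adj_sym.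
- by split=> //; exists y.
- by rewrite adj_sym.
Qed.

End Clusters.

Section Radii.
Context {R : realType}.
Variables (eps0 : R) (r : nat).
Hypotheses (e0 : 0 < eps0) (e1 : eps0 < 1 / 100) (er : 16 <= eps0 * r%:R).

(** The gaps between the three radii and the lattice spacing are of order eps0
    r, and eps0 r >= 16 leaves room for the roundings. *)
Lemma radii_facts (hO hT hr : int) :
  hO = Num.floor (((1 - 2 * eps0) * r%:R - 1) / 2) ->
  hT = Num.floor (((1 - 3 / 2 * eps0) * r%:R - 1) / 2) ->
  hr = Num.floor ((r%:R - 1 : R) / 2) ->
  [/\ 0 <= hO, hO + 1 <= hT, hT <= hr & hT + 1 + hr < rdot eps0 r].
Proof.
move=> hOE hTE hrE.
have h0 := e0; have h1 := e1; have h2 := er.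
have r0 : (1600 : R) <= r%:R by rewrite -(ler_pM2l e0); lra.
have h3 : eps0 * r%:R <= 1 / 100 * r%:R by rewrite ler_wpM2r ?ler0n // ltW.
have := floor_itv (((1 - 2 * eps0) * r%:R - 1) / 2).
have := floor_itv (((1 - 3 / 2 * eps0) * r%:R - 1) / 2).
have := floor_itv ((r%:R - 1 : R) / 2).
have := ceil_ge ((1 - eps0 / 2) * (r%:R - 1)).
rewrite -/(rdot eps0 r) -hOE -hTE -hrE => hd.
move=> /andP[hr1 hr2] /andP[hT1 hT2] /andP[hO1 hO2].
rewrite !intrD !mulr1z in hr2 hT2 hO2.
split.
- by rewrite hOE floor_ge_int mulr0z; lra.
- by rewrite -ltzD1 -(ltr_int R) !intrD ?mulr1z; lra.
- by rewrite -ltzD1 -(ltr_int R) !intrD ?mulr1z; lra.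
- by rewrite -(ltr_int R) !intrD ?mulr1z; lra.
Qed.

Lemma dyadic_floor (N : int) (hr : int) : hr = Num.floor ((r%:R - 1 : R) / 2) ->
  Num.floor (((2 * N * rdot eps0 r)%:~R + r%:R - 1 : R) / 2) = N * rdot eps0 r + hr.
Proof.
move=> ->; have -> : ((2 * N * rdot eps0 r)%:~R + r%:R - 1 : R) / 2 =
   (N * rdot eps0 r)%:~R + (r%:R - 1) / 2 by rewrite -!mulrA intrM; field.
by rewrite floorDzr ?intr_int // intrKfloor.
Qed.

End Radii.

(** * The law of the potential *)

Section Law.
Context {R : realType}.
Local Open Scope classical_set_scope.
Variable S : set site.
Hypothesis fS : finite_set S.
Notation n := (num_sites S).
Variables (Vbar : R).
Hypothesis Vbar0 : Vbar != 0.

Definition pot (X : {set 'I_n}) (x : site) : R :=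
  if [exists i in X, site_of i == x] then Vbar else 0.

Lemma pot_site X i : pot X (site_of i) = if i \in X then Vbar else 0.
Proof.
rewrite /pot; have [iX|iX] := boolP (i \in X).
  by rewrite (_ : [exists _ in _, _] = true) //; apply/existsP; exists i; rewrite iX eqxx.
rewrite (_ : [exists _ in _, _] = false) //; apply/negbTE/existsPn => j.
by rewrite (inj_eq (@site_of_inj S)); apply: contra iX => /andP[jX /eqP<-].
Qed.

Lemma pot_two_valued X A : two_valued Vbar A (pot X).
Proof. by move=> a _; rewrite /pot; case: ifP; [right|left]. Qed.

Variables (d : measure_display) (T : measurableType d) (P : probability T R).
Variable V : site -> {RV P >-> R}.
Hypothesis iidV : iid_potential Vbar V.

Definition config_of (w : T) : {set 'I_n} := [set i | V (site_of i) w != 0]%SET.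

Lemma potential_config w x : S x -> V x w = pot (config_of w) x.
Proof.
move=> /(site_of_surj fS)[i <-]; rewrite pot_site inE.
have [VV _ _ _] := iidV.
by case: (VV (site_of i) w) => ->; rewrite ?eqxx // Vbar0.
Qed.

(** All configurations have the same probability, by independence. *)
Lemma prob_config X : measurable [set w | config_of w = X] /\
  P [set w | config_of w = X] = ((2 ^- n)%:E)%E.
Proof.
have [VV V0 V1 ind] := iidV.
pose B (a : site) : set R := [set pot X a].
have E : [set w | config_of w = X] = \bigcap_(a in [set` fset_set S]) (V a @^-1` B a).
  apply/seteqP; split=> w /=.
    by move=> wX a /=; rewrite in_fset_set // inE => Sa; rewrite /B /= -wX; apply: potential_config.
  move=> h; apply/setP => i; rewrite inE.
  have := h (site_of i); rewrite /= in_fset_set // inE => /(_ (site_of_in fS i)).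
  by rewrite /B /= pot_site => ->; case: (i \in X); rewrite ?eqxx.
have mB a : measurable (B a) by exact: measurable_set1.
have mE : measurable [set w | config_of w = X].
  rewrite E; apply: fin_bigcap_measurable => // a _.
  by rewrite -[X in measurable X]setTI; exact: measurable_funPT.
split=> //.
have fin : P [set w | config_of w = X] \is a fin_num by apply: fin_num_measure.
rewrite -(fineK fin); congr (_%:E).
rewrite E ind // (eq_bigr (fun=> 2^-1)).
  by rewrite big_const_seq count_predT iter_mulr_1 exprVn.
by move=> a _; rewrite /B /pot; case: ifP => _; rewrite ?V0 ?V1.
Qed.

Lemma prob_configs_seq (s : seq {set 'I_n}) : uniq s ->
  measurable [set w | config_of w \in s] /\
  P [set w | config_of w \in s] = (((size s)%:R / 2 ^+ n)%:E)%E.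
Proof.
elim: s => [_|X s IH /= /andP[Xs us]].
  have -> : [set w | config_of w \in [::]] = set0 by apply/seteqP; split.
  by rewrite measure0 mul0r; split.
have [ms Ps] := IH us; have [mX PX] := prob_config X.
have E : [set w | config_of w \in X :: s] =
    [set w | config_of w = X] `|` [set w | config_of w \in s].
  apply/seteqP; split=> w /=; first by rewrite inE => /orP[/eqP|]; [left|right].
  by move=> [->|]; rewrite inE ?eqxx // => ->; rewrite orbT.
rewrite E; split; first exact: measurableU.
have dis : [set w | config_of w = X] `&` [set w | config_of w \in s] = set0.
  by apply/seteqP; split=> w //= [-> h]; rewrite h in Xs.
transitivity (P [set w | config_of w = X] + P [set w | config_of w \in s])%E.
  exact: measureU.
rewrite Ps PX -EFinD; congr (_%:E).
by rewrite /= -[in RHS](addn1 (size s)) natrD mulrDl mul1r addrC.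
Qed.

Lemma prob_configs (p : pred {set 'I_n}) :
  P [set w | p (config_of w)] = ((#|p|%:R / 2 ^+ n)%:E)%E.
Proof.
have [_] := prob_configs_seq (enum_uniq p); rewrite -cardE => <-.
by congr (P _); apply/seteqP; split=> w /=; rewrite mem_enum.
Qed.

Lemma cond_prob_configs (A B : set T) (p q : pred {set 'I_n}) :
  A = [set w | p (config_of w)] -> B = [set w | q (config_of w)] ->
  cond_prob P A B = #|predI p q|%:R / #|q|%:R.
Proof.
move=> -> ->; rewrite /cond_prob.
have -> : [set w | p (config_of w)] `&` [set w | q (config_of w)] =
   [set w | predI p q (config_of w)].
  by apply/seteqP; split=> w /=; [move=> [-> ->] | move=> /andP[]].
rewrite !prob_configs /=.
by rewrite invfM invrK mulrACA mulVf ?mulr1 // expf_neq0.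
Qed.

End Law.

Section Counting.
Context {I : finType}.
Implicit Types (X U : {set I}) (p q : pred {set I}).
Local Open Scope nat_scope.

(** The involution that exchanges the parts in U of two configurations maps the
    pairs (X, Y) with p X and q X to the pairs with p X and q Y. *)
Lemma card_independent p q U :
  (forall X Y, X :&: U = Y :&: U -> p X = p Y) ->
  (forall X Y, X :\: U = Y :\: U -> q X = q Y) ->
  #|predI p q| * 2 ^ #|I| = #|p| * #|q|.
Proof.
move=> pU qU.
have -> : 2 ^ #|I| = #|predT : pred {set I}| 
  by rewrite -(cardsT I) -card_powerset; apply: eq_card => X; rewrite !inE finset.subsetT.
rewrite -!cardX; pose mixp (X Y : {set I}) := X :&: U :|: (Y :\: U).
pose h (z : {set I} * {set I}) := (mixp z.1 z.2, mixp z.2 z.1).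
have hK : involutive h.
  by case=> X Y; congr pair; apply/setP => i; rewrite !inE; case: (i \in U); rewrite /= ?andbF ?orbF ?andbT.
rewrite -(fintype.card_image (inv_inj hK)); apply: eq_card => z.
have e1 (X Y : {set I}) : p (mixp X Y) = p X.
  by apply: pU; apply/setP => i; rewrite !inE; case: (i \in U); rewrite /= ?andbF ?orbF ?andbT.
have e2 (X Y : {set I}) : q (mixp X Y) = q Y.
  by apply: qU; apply/setP => i; rewrite !inE; case: (i \in U); rewrite /= ?andbF ?orbF ?andbT.
apply/fintype.imageP/idP => [[[X Y]]|].
  by rewrite !inE /= => /andP[/andP[pX qX] _] ->; rewrite !unfold_in /= e1 e2 pX.
case: z => X Y; rewrite !unfold_in /= => /andP[pX qY].
exists (h (X, Y)); rewrite ?hK // !unfold_in /= e1 e2 pX; rewrite andbT; exact: qY.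
Qed.

(** Summation over the configurations X0 outside J, each with its fibre of
    subsets Y of J. *)
Lemma card_fibers p q J (a b : nat) :
  (forall X Y, X :\: J = Y :\: J -> q X = q Y) ->
  (forall X0, X0 \subset ~: J -> q X0 ->
     a * #|[set Y : {set I} | (Y \subset J) && p (X0 :|: Y)]| <= b * 2 ^ #|J|) ->
  a * #|predI p q| <= b * #|q|.
Proof.
move=> qJ H.
have fib (r : pred {set I}) : #|r| = \sum_(X0 : {set I} | X0 \subset ~: J)
     #|[set Y : {set I} | (Y \subset J) && r (X0 :|: Y)]|.
  rewrite -sum1_card (partition_big (fun X => X :\: J) (fun X0 => X0 \subset ~: J)) /=; last first.
    by move=> X _; apply/fintype.subsetP => i; rewrite !inE => /andP[].
  apply: eq_bigr => X0 X0J; rewrite sum1_card.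
  have inj : {in [set Y : {set I} | (Y \subset J) && r (X0 :|: Y)] &, injective (fun Y : {set I} => X0 :|: Y)}.
    move=> Y Y'; rewrite !inE => /andP[YJ _] /andP[Y'J _] /setP e; apply/setP => i.
    have := e i; rewrite !inE; case: (boolP (i \in X0)) => //= /(fintype.subsetP X0J).
    rewrite inE => iJ _; apply/idP/idP => [/(fintype.subsetP YJ)|/(fintype.subsetP Y'J)]; by rewrite (negbTE iJ).
  rewrite -(card_in_imset inj); apply: eq_card => X.
  apply/idP/finset.imsetP => [|[Y]].
    rewrite unfold_in => /andP[rX /eqP XE]; exists (X :&: J).
      by rewrite inE finset.subsetIr /= -XE finset.setUC finset.setID.
    by rewrite -XE finset.setUC finset.setID.
  rewrite !inE => /andP[YJ rX] ->; rewrite !unfold_in rX /=.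
  apply/eqP/setP => i; rewrite !inE.
  case: (boolP (i \in J)) => iJ /=.
    by apply/esym/negP => /(fintype.subsetP X0J); rewrite inE iJ.
  by rewrite orbC (_ : (i \in Y) = false) //; apply: contraNF iJ => /(fintype.subsetP YJ).
rewrite (fib (predI p q)) (fib q) !big_distrr /=; apply: leq_sum => X0 X0J.
have qX0 (Y : {set I}) : Y \subset J -> q (X0 :|: Y) = q X0.
  move=> YJ; apply: qJ; apply/setP => i; rewrite !inE.
  by case: (boolP (i \in J)) => //= iJ; rewrite (_ : (i \in Y) = false) ?orbF //;
    apply: contraNF iJ => /(fintype.subsetP YJ).
have [q0|q0] := boolP (q X0); last first.
  rewrite eq_card0 ?muln0 // => Y; rewrite !inE /=.
  by have [/qX0->|//] := boolP (Y \subset J); rewrite (negbTE q0) !andbF.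
apply: leq_trans (_ : b * 2 ^ #|J| <= _).
  apply: leq_trans (H _ X0J q0); rewrite leq_mul2l; apply/orP; right.
  by apply/subset_leq_card/fintype.subsetP => Y; rewrite !inE => /andP[-> /andP[]].
rewrite leq_mul2l; apply/orP; right; rewrite -card_powerset.
by apply/subset_leq_card/fintype.subsetP => Y; rewrite !inE => YJ; rewrite YJ qX0.
Qed.

End Counting.

(** * Edge matrices and localised eigenvectors *)

Section CutOperator.
Context {R : realType}.
Local Open Scope classical_set_scope.
Variable S : set site.
Hypothesis fS : finite_set S.
Notation n := (num_sites S).

Lemma card_neighbors (x : site) : \sum_(i < n | adj x (site_of i)) (1 : R) <= 4.
Proof.
have := sum_extend_neighbors (const_mx 1 : 'rV[R]_n) x.
under [RHS]eq_bigr do rewrite mxE.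
move=> <-; have ext1 y : extend (const_mx 1 : 'rV[R]_n) y <= 1.
  have [Sy|/(extend_out fS (const_mx 1))->//] := pselect (S y).
  by have [i <-] := site_of_surj fS Sy; rewrite extend_site mxE.
rewrite /neighbors !big_cons big_nil.
have -> : (4 : R) = 1 + (1 + (1 + (1 + 0))) by ring.
by do 4!apply: lerD => //.
Qed.

Variable edges : site -> site -> bool.
Hypothesis edges_sym : forall x y, edges x y = edges y x.
Hypothesis edges_adj : forall x y, edges x y -> adj x y.

Definition edge_mx : 'M[R]_n := \matrix_(i, j) (edges (site_of i) (site_of j))%:R.

Lemma edge_mx_sym : edge_mx^T = edge_mx.
Proof. by apply/matrixP => i j; rewrite !mxE edges_sym. Qed.

Lemma edge_mx_row (i : 'I_n) : \sum_j edge_mx i j <= 4.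
Proof.
apply: le_trans (card_neighbors (site_of i)); rewrite [leRHS]big_mkcond.
apply: ler_sum => j _; rewrite mxE.
by case: (boolP (edges _ _)) => [/edges_adj->//|_]; case: ifP.
Qed.

Lemma edge_mx_ge0 i j : 0 <= edge_mx i j.
Proof. by rewrite mxE. Qed.

Lemma edge_mx_sqr i j : edge_mx i j ^+ 2 = edge_mx i j.
Proof. by rewrite mxE; case: edges; rewrite ?expr1n ?expr0n. Qed.

Lemma edge_mx_form_bound (E : set site) (u : 'rV[R]_n) :
  (forall x y, edges x y -> E x) ->
  \sum_j \sum_i edge_mx i j * u 0 i ^+ 2 <= 4 * norm2_on E u.
Proof.
move=> edgesE; rewrite exchange_big /= /norm2_on mulr_sumr [leRHS]big_mkcond /=.
apply: ler_sum => i _; rewrite -mulr_suml.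
case: ifPn => [_|iE]; first by rewrite ler_wpM2r ?sqr_ge0 ?edge_mx_row.
rewrite big1 ?mul0r // => j _; rewrite mxE.
have [/edgesE h|//] := boolP (edges _ _).
by rewrite in_index_set in iE; case/negP: iE; apply/asboolP.
Qed.

Lemma edge_mx_qform (u : 'rV[R]_n) : `|qform edge_mx u| <= 4 * dotr u u.
Proof.
have qE : qform edge_mx u = \sum_j \sum_i edge_mx i j * (u 0 i * u 0 j).
  rewrite /qform dotrE; apply: eq_bigr => j _; rewrite mxE mulr_suml.
  by apply: eq_bigr => i _; ring.
have bound : \sum_j \sum_i edge_mx i j * u 0 i ^+ 2 <= 4 * dotr u u.
  apply: le_trans (edge_mx_form_bound (E := setT) u _) _ => //.
  rewrite ler_wpM2l // /norm2_on dotrE big_mkcond /=; apply: ler_sum => i _.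
  by case: ifP => _; rewrite -expr2 ?sqr_ge0.
have bound' : \sum_j \sum_i edge_mx i j * u 0 j ^+ 2 <= 4 * dotr u u.
  rewrite exchange_big /=; under eq_bigr do under eq_bigr do rewrite -edge_mx_sym mxE.
  exact: bound.
rewrite qE; apply: le_trans (ler_norm_sum _ _ _) _.
apply: le_trans (ler_sum _ (fun j _ => ler_norm_sum _ _ _)) _.
have : \sum_j \sum_i `|edge_mx i j * (u 0 i * u 0 j)| <=
    2^-1 * (\sum_j \sum_i edge_mx i j * u 0 i ^+ 2 + \sum_j \sum_i edge_mx i j * u 0 j ^+ 2).
  rewrite -big_split mulr_sumr /=; apply: ler_sum => j _.
  rewrite -big_split mulr_sumr /=; apply: ler_sum => i _.
  rewrite normrM (ger0_norm (edge_mx_ge0 i j)) -mulrDr mulrCA.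
  rewrite ler_wpM2l ?edge_mx_ge0 //.
  have h1 := sqr_ge0 (u 0 i - u 0 j); have h2 := sqr_ge0 (u 0 i + u 0 j).
  by rewrite ler_norml; apply/andP; split; lra.
by lra.
Qed.

(** Each row and each column of the matrix has at most four nonzero entries. *)
Lemma edge_mx_mul_bound (E : set site) (u : 'rV[R]_n) :
  (forall x y, edges x y -> E x) ->
  dotr (u *m edge_mx) (u *m edge_mx) <= 16 * norm2_on E u.
Proof.
move=> edgesE; rewrite dotrE.
have step j : (u *m edge_mx) 0 j * (u *m edge_mx) 0 j <=
    4 * \sum_i edge_mx i j * u 0 i ^+ 2.
  rewrite -expr2 mxE.
  have -> : \sum_i u 0 i * edge_mx i j = \sum_i edge_mx i j * (edge_mx i j * u 0 i).
    by apply: eq_bigr => i _; rewrite mulrA -expr2 edge_mx_sqr mulrC.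
  apply: le_trans (sum_cauchy_schwarz xpredT _ _) _; apply: ler_pM.
  - by apply: sumr_ge0 => i _; exact: sqr_ge0.
  - by apply: sumr_ge0 => i _; exact: sqr_ge0.
  - under eq_bigr do rewrite edge_mx_sqr -edge_mx_sym mxE; exact: edge_mx_row.
  - by apply: ler_sum => i _; rewrite exprMn edge_mx_sqr.
apply: le_trans (ler_sum _ (fun j _ => step j)) _; rewrite -mulr_sumr.
by have := edge_mx_form_bound u edgesE; lra.
Qed.

End CutOperator.

Section Localization.
Context {R : realType}.
Local Open Scope classical_set_scope.
Variable S : set site.
Hypothesis fS : finite_set S.
Notation n := (num_sites S).
Variables (A B : 'M[R]_n) (l0 w tau : R) (E G : set site) (m : nat).
Hypotheses (sA : A^T = A) (GS : G `<=` S) (tau0 : 0 <= tau).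
Hypothesis loc : forall l (u : 'rV[R]_n), `|l - l0| <= w -> u *m A = l *: u ->
  norm2_on E u <= tau * dotr u u /\ dotr u u <= 4 * norm2_on G u.

(** Every eigenvector of the window has mass at least 1/4 in G, and orthonormal
    vectors have total mass at most one at each site. *)
Lemma card_window_loc : (#|window A l0 w| <= 4 * num_sites G)%N.
Proof.
rewrite -(ler_nat R) natrM.
have h i : i \in window A l0 w -> 1 <= 4 * norm2_on G (eigvec A i).
  rewrite inE => iw; have [_] := loc iw (eigvec_mul i sA).
  by rewrite eigvec_orth // eqxx.
have -> : #|window A l0 w|%:R = \sum_(i in window A l0 w) (1 : R) by rewrite sumr_const.
apply: le_trans (ler_sum _ h) _; rewrite -mulr_sumr ler_wpM2l //.
rewrite /norm2_on exchange_big /= -(card_index_set fS GS).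
have -> : #|index_set S G|%:R = \sum_(i in index_set S G) (1 : R) by rewrite sumr_const.
apply: ler_sum => x _.
have PP : (eigbasis A)^T *m eigbasis A = 1%:M by apply/mulmx1C/eigbasis_orth.
have := congr1 (fun M : 'M[R]_n => M x x) PP; rewrite !mxE eqxx => PPx; rewrite (_ : 1 = true%:R :> R) // -PPx.
rewrite [leLHS]big_mkcond /=; apply: ler_sum => i _; rewrite !mxE.
by case: ifP => _; rewrite -expr2 ?sqr_ge0.
Qed.

Lemma window_leak_loc :
  (forall u : 'rV[R]_n, dotr (u *m B) (u *m B) <= 16 * norm2_on E u) ->
  window_leak A B l0 w <= (4 * num_sites G)%:R * (16 * tau).
Proof.
move=> hB; apply: le_trans (_ : \sum_(i in window A l0 w) (16 * tau) <= _).
  apply: ler_sum => i; rewrite inE => iw; apply: le_trans (hB _) _.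
  have [h _] := loc iw (eigvec_mul i sA); rewrite ler_wpM2l //.
  by move: h; rewrite eigvec_orth // eqxx mulr1.
rewrite sumr_const -[leLHS]mulr_natl ler_wpM2r ?mulr_ge0 // ler_nat.
exact: card_window_loc.
Qed.

End Localization.

(** * Bits away from the exceptional boxes *)

Section FreeBits.
Context {R : realType}.
Local Open Scope classical_set_scope.
Variables (eps0 : R) (r : nat) (hO hT hr : int) (H h3 K : nat).
Variables (a0 : site) (q : 'I_K -> site) (Theta D : set site) (V' : site -> R).
Notation rd := (rdot eps0 r).
Hypotheses (OE : forall a, Omega eps0 r a = ibox hO a)
  (TE : forall a, tOmega eps0 r a = ibox hT a)
  (rE : forall a, box (r%:R : R) a = ibox hr a).
Hypotheses (hO0 : 0 <= hO) (hOT : hO + 1 <= hT) (hTr : hT <= hr) (hTrd : hT + 1 + hr < rd).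
Notation Q := (ibox H%:Z a0).
Notation Qs := (\bigcup_(k in [set: 'I_K]) ibox h3%:Z (q k)).
Hypothesis latQ : exists N, lattice (N * rd) a0 /\ H%:Z = N * rd + hr.
Hypothesis latq : forall k, exists N, lattice (N * rd) (q k) /\ h3%:Z = N * rd + hr.
Hypothesis ThetaQ : Theta `<=` Q.
Hypothesis DQ : D `<=` lattice rd `&` Q.
Hypothesis QTheta : Q `\` Theta = \bigcup_(b in D) Omega eps0 r b.

Definition free_bits : set site :=
  [set b | D b /\ Omega eps0 r b `&` Qs = set0].

Let rd0 : 0 < rd.
Proof. by move: hO0 hOT hTr hTrd; lia. Qed.

Let self h b : 0 <= h -> ibox h b b.
Proof. by move=> h0; split; rewrite subrr normr0. Qed.

Lemma bit_inside b : D b -> box (r%:R : R) b `<=` Q.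
Proof.
move=> /DQ[lb Qb] x; rewrite rE => hx.
have [N [lN HE]] := latQ; rewrite HE in Qb *.
apply: ibox_add hx; apply: (dyadic_contains (x := b) (h := 0) lb lN rd0 _ _ Qb).
  by move: hO0 hOT hTr hTrd; lia.
exact: self.
Qed.

Lemma Omega_free b x : D b -> Omega eps0 r b x -> (Q `\` Theta) x.
Proof. by move=> Db Ox; rewrite QTheta; exists b. Qed.

(** The frame of a bit is inside Q and meets no cell, since distinct cells are
    apart and a frame does not meet its own cell. *)
Lemma frame_Theta b : D b -> frame eps0 r b `<=` Theta.
Proof.
move=> Db x [rx Ox]; apply: contrapT => Tx.
have : (Q `\` Theta) x by split=> //; exact: bit_inside Db _ rx.
rewrite QTheta => -[b' Db' Ox']; apply: Ox.
have [[lb _] [lb' _]] := (DQ Db, DQ Db').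
rewrite (_ : b = b') //; rewrite rE in rx; rewrite OE in Ox'.
by apply: (lattice_apart lb lb' rd0 _ rx Ox'); move: hO0 hOT hTr hTrd; lia.
Qed.

Lemma free_bit_ok b : free_bits b -> [/\ lattice rd b, box (r%:R : R) b `<=` Q
                          & Omega eps0 r b `&` (Theta `|` Qs) = set0].
Proof.
move=> [Db Ob]; split; first by have [] := DQ Db.
  exact: bit_inside.
rewrite setIUr Ob setU0; apply/seteqP; split=> // x [Ox Tx].
by have [] := Omega_free Db Ox.
Qed.

Lemma free_bit_far b x : free_bits b -> ibox (hT + 1) b x -> ~ Qs x.
Proof.
move=> [Db Ob] hx [k _ kx].
have [N [lN hE]] := latq k; rewrite hE in kx.
have [lb _] := DQ Db.
have hb := dyadic_contains lb lN rd0 hTrd hx kx.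
have : (Omega eps0 r b `&` Qs) b; last by rewrite Ob.
split; first by rewrite OE; apply: self.
exists k => //; rewrite hE; apply: ibox_le hb.
by move: hO0 hOT hTr hTrd; lia.
Qed.

Lemma free_bit_at x : (Q `\` Theta) x -> ~ Qs x -> exists2 b, free_bits b & Omega eps0 r b x.
Proof.
rewrite QTheta => -[b Db Ox] Qx; exists b => //; split=> //.
apply/seteqP; split=> // y [Oy [k _ ky]]; apply: Qx; exists k => //.
have [N [lN hE]] := latq k; rewrite hE in ky *.
have [lb _] := DQ Db; rewrite OE in Oy Ox.
have hb : ibox (N * rd) (q k) b.
  by apply: (dyadic_contains lb lN rd0 _ Oy ky); move: hO0 hOT hTr hTrd; lia.
apply: ibox_le (ibox_add hb Ox).
by move: hO0 hOT hTr hTrd; lia.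
Qed.

Notation bit_cluster := (Defs.cluster eps0 r V').

Lemma bit_cluster_box b : bit_cluster b `<=` ibox hr b.
Proof.
move=> x /cluster_sub[|[[+ _] _]]; last by rewrite rE.
by rewrite OE; apply: ibox_le; move: hO0 hOT hTr hTrd; lia.
Qed.

Lemma bit_cluster_disj b b' x : D b -> D b' -> bit_cluster b x -> Omega eps0 r b' x -> b = b'.
Proof.
move=> Db Db' /bit_cluster_box bx; rewrite OE => bx'.
have [[lb _] [lb' _]] := (DQ Db, DQ Db').
by apply: (lattice_apart lb lb' rd0 _ bx bx'); move: hO0 hOT hTr hTrd; lia.
Qed.

(** The clusters are those of V' and not of V: they depend on the frames only,
    which lie in Theta, so the cut edges are the same for all compatible
    configurations. *)
Definition cut_edge (x y : site) : bool :=
  `[< exists2 b, free_bits b & edge_bd (bit_cluster b) [set x; y] >].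

Lemma cut_edge_sym x y : cut_edge x y = cut_edge y x.
Proof. by rewrite /cut_edge setUC. Qed.

Lemma cut_edge_adj x y : cut_edge x y -> adj x y.
Proof. by move=> /asboolP[b _ /edge_bd_pair[]]. Qed.

Definition compat (V : site -> R) : Prop := forall x, Theta x -> V x = V' x.

Lemma compat_cluster V b : compat V -> D b -> Defs.cluster eps0 r V b = bit_cluster b.
Proof. by move=> cV Db; apply: cluster_ext => x /(frame_Theta Db)/cV. Qed.

Hypothesis adm : forall b, free_bits b -> admissible eps0 r V' b.

Lemma cut_edge_far x y : cut_edge x y -> (~` Qs) x.
Proof.
move=> /asboolP[b fb /edge_bd_pair[xy Cxy]]; apply: (free_bit_far fb).
have hC z : bit_cluster b z -> ibox hT b z.
  by rewrite -TE; apply: (cluster_tOmega OE TE hO0 hOT); exact: adm.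
case: Cxy => -[/hC h _]; last by apply: ibox_adj h _; rewrite adj_sym.
by apply: ibox_le h; lia.
Qed.

Let fQ : finite_set Q := finite_ibox H%:Z a0.
Notation n := (num_sites Q).
Variable Vbar : R.
Hypothesis Vbar0 : Vbar != 0.

Definition cut_mx : 'M[R]_n := edge_mx Q cut_edge.

Lemma cutHE V t : compat V ->
  cutH eps0 r Q V free_bits t = dirichletH Q V + t *: cut_mx.
Proof.
move=> cV; apply/matrixP => i j; rewrite !mxE /cut_kernel.
have -> : `[< exists2 a, free_bits a & edge_bd (Defs.cluster eps0 r V a)
     [set site_of i; site_of j] >] = cut_edge (site_of i) (site_of j).
  apply/asboolP/asboolP => -[b fb h]; exists b => //; move: h;
    by rewrite compat_cluster //; case: fb.
have [/[dup] /cut_edge_adj ij ce|_] := boolP (cut_edge _ _); last by rewrite mulr0 addr0.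
rewrite mulr1 /kernelH ij; case: eqP => [e|_]; last by rewrite addrC.
by move: ij; rewrite e /adj !subrr.
Qed.

Lemma dirichletH_pot X : dirichletH Q (pot Vbar X) =
  site_mx Vbar (dirichletH Q (fun=> 0)) X.
Proof.
apply/matrixP => i j; rewrite !mxE /kernelH (inj_eq (@site_of_inj Q)) pot_site.
case: eqP => [->|_]; last by rewrite mulr0n mulr0 addr0.
by rewrite addr0 mulr1n; case: (_ \in X); rewrite ?mulr1 ?mulr0.
Qed.

Lemma site_mxU (M : 'M[R]_n) (X Y : {set 'I_n}) : X \subset ~: Y ->
  site_mx Vbar (site_mx Vbar M X) Y = site_mx Vbar M (X :|: Y).
Proof.
move=> XY; rewrite /site_mx -addrA -scalerDr; congr (_ + _ *: _).
apply/matrixP => i j; rewrite !mxE inE -mulrnDl; congr (_ *+ _).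
have [iX|_] := boolP (i \in X); last by rewrite add0r.
by have := fintype.subsetP XY _ iX; rewrite inE => /negbTE->; rewrite addr0.
Qed.

Definition shift_site (b o : site) : site := (b.1 + o.1, b.2 + o.2).
Definition bit_sites (o : site) : {set 'I_n} :=
  index_set Q [set x | exists2 b, free_bits b & x = shift_site b o].
Definition cluster_at (o : site) (i : 'I_n) : {set 'I_n} :=
  index_set Q (bit_cluster ((site_of i).1 - o.1, (site_of i).2 - o.2)).

Lemma shift_siteK b o : ((shift_site b o).1 - o.1, (shift_site b o).2 - o.2) = b.
Proof. by case: b => b1 b2; rewrite /shift_site /=; congr pair; lia. Qed.

Lemma shift_Omega b o : ibox hO (0, 0) o -> Omega eps0 r b (shift_site b o).
Proof. by rewrite OE => -[/= h1 h2]; split=> /=; lia. Qed.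

Lemma bit_sitesP o i : reflect (exists2 b, free_bits b & site_of i = shift_site b o)
  (i \in bit_sites o).
Proof. exact: index_setP. Qed.

Lemma bit_sites_own o i : ibox hO (0, 0) o -> i \in bit_sites o -> i \in cluster_at o i.
Proof.
move=> Oo /bit_sitesP[b fb ib]; apply/index_setP; rewrite ib shift_siteK.
by apply: (Omega_cluster OE); exact: shift_Omega.
Qed.

Lemma bit_sites_other o i j : ibox hO (0, 0) o -> i \in bit_sites o -> j \in bit_sites o ->
  i != j -> j \notin cluster_at o i.
Proof.
move=> Oo /bit_sitesP[b fb ib] /bit_sitesP[b' fb' jb'] ij; apply/negP => /index_setP.
rewrite ib shift_siteK jb' => bC; case/negP: ij; apply/eqP/(@site_of_inj Q).
rewrite ib jb'; congr shift_site.
by apply: bit_cluster_disj bC (shift_Omega _ Oo); [case: fb | case: fb'].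
Qed.

(** Inside Q an entry between the cluster of a bit and its complement is either
    absent or a cut edge, where the entry -1 is cancelled. *)
Lemma bit_sites_block V o x i j : x \in bit_sites o ->
  (i \in cluster_at o x) != (j \in cluster_at o x) ->
  (dirichletH Q V + cut_mx) i j = 0.
Proof.
move=> /bit_sitesP[b fb xb]; rewrite /cluster_at xb shift_siteK !in_index_set => hij.
have ij : i != j by apply: contraNneq hij => ->.
rewrite !mxE /kernelH (inj_eq (@site_of_inj Q)) (negbTE ij).
have [aij|aij] := boolP (adj _ _); last first.
  have -> : cut_edge (site_of i) (site_of j) = false; last by rewrite addr0.
  by apply: contraNF aij; exact: cut_edge_adj.
suff -> : cut_edge (site_of i) (site_of j) by rewrite addNr.
have [Ci|Ci] := pselect (bit_cluster b (site_of i)).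
  have [Cj|Cj] := pselect (bit_cluster b (site_of j)); first by rewrite !asboolT in hij.
  by apply/asboolP; exists b => //; exact: edge_bd_adj.
have [Cj|Cj] := pselect (bit_cluster b (site_of j)); last by rewrite !asboolF in hij.
rewrite cut_edge_sym; apply/asboolP; exists b => //.
by apply: edge_bd_adj => //; rewrite adj_sym.
Qed.

Lemma bit_sites_Theta o i : ibox hO (0, 0) o -> i \in bit_sites o -> ~ Theta (site_of i).
Proof.
move=> Oo /bit_sitesP[b [Db _] ->].
by have [] := Omega_free Db (shift_Omega b Oo).
Qed.

Lemma compat_pot X Y o : ibox hO (0, 0) o -> X :\: bit_sites o = Y :\: bit_sites o ->
  compat (pot Vbar X) -> compat (pot Vbar Y).
Proof.
move=> Oo /setP XY cX x Tx; rewrite -cX //.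
have [i ix] := site_of_surj fQ (ThetaQ Tx); rewrite -ix !pot_site.
have := XY i; rewrite !finset.in_setD.
have [/(bit_sites_Theta Oo)|_ /= ->//] := boolP (i \in bit_sites o).
by rewrite ix.
Qed.

Variables (l0 w tau b c : R) (G : set site) (s : nat -> R) (g : nat).
Let m := (4 * num_sites G)%N.
Hypothesis GQ : G `<=` Q.
Hypotheses (V0 : 0 < Vbar) (w0 : 0 < w) (tau0 : 0 <= tau).
Hypotheses (b01 : 0 < b <= 1) (bw : 8 * b <= w) (c0 : 0 < c).
Hypothesis taub : m%:R * (16 * tau) <= b ^+ 2.
Hypothesis loc : forall (X : {set 'I_n}) t l (u : 'rV[R]_n), compat (pot Vbar X) -> 0 <= t <= 1 ->
  `|l - l0| <= w -> u *m (dirichletH Q (pot Vbar X) + t *: cut_mx) = l *: u ->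
  norm2_on (~` Qs) u <= tau * dotr u u /\ dotr u u <= 4 * norm2_on G u.
Hypothesis s0 : forall k, 0 < s k.
Hypothesis s_step : forall k, (k <= m)%N -> 8 * s k <= (s k.+1 - s k) * c.
Hypothesis s_v : forall k, (k <= m)%N -> 8 * s k <= Vbar * c.
Hypothesis s_w : s m.+1 <= w / 4.
Hypothesis g0 : (0 < g)%N.

Definition resonant_at o (X : {set 'I_n}) : bool :=
  `[< exists l (u : 'rV[R]_n),
    [/\ dotr u u = 1, u *m dirichletH Q (pot Vbar X) = l *: u, `|l - l0| < s 0 &
      (2 * g <= #|[set x in bit_sites o | (c <= u 0 x ^+ 2)%R]%SET|)%N] >].

(** The data of fiber_bound: B is the matrix of cut edges, and the block of a
    site is the cluster of its bit. *)
Lemma resonant_fiber o (X0 : {set 'I_n}) : ibox hO (0, 0) o -> X0 \subset ~: bit_sites o ->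
  compat (pot Vbar X0) ->
  (g * #|[set Y : {set 'I_n} | (Y \subset bit_sites o) && resonant_at o (X0 :|: Y)]%SET|
   <= 2 * m.+1 * (2 * m).+1 * (#|bit_sites o| * 'C(#|bit_sites o|, #|bit_sites o|./2)))%N.
Proof.
move=> Oo X0J cX0; set J := bit_sites o.
have dis (Y : {set 'I_n}) : Y \subset J -> X0 \subset ~: Y.
  by move=> YJ; apply: fintype.subset_trans X0J _; rewrite finset.setCS.
have AE (Y : {set 'I_n}) : Y \subset J -> site_mx Vbar (dirichletH Q (pot Vbar X0)) Y =
    dirichletH Q (pot Vbar (X0 :|: Y)).
  by move=> YJ; rewrite !dirichletH_pot site_mxU // dis.
have cXY (Y : {set 'I_n}) : Y \subset J -> compat (pot Vbar (X0 :|: Y)).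
  move=> YJ; apply: compat_pot Oo _ cX0; apply/setP => i; rewrite !finset.in_setD finset.in_setU -/J.
  have [//|iJ] /= := boolP (i \in J).
  by rewrite (_ : (i \in Y) = false) ?orbF //; apply: contraNF iJ; exact: (fintype.subsetP YJ).
have sCut : cut_mx^T = cut_mx by apply: edge_mx_sym; exact: cut_edge_sym.
have locX (Y : {set 'I_n}) t : Y \subset J -> 0 <= t <= 1 -> let A' := site_mx Vbar (dirichletH Q (pot Vbar X0)) Y + t *: cut_mx in
    A'^T = A' /\ (forall l (u : 'rV[R]_n), `|l - l0| <= w -> u *m A' = l *: u ->
      norm2_on (~` Qs) u <= tau * dotr u u /\ dotr u u <= 4 * norm2_on G u).
  move=> YJ t01 A'; rewrite /A' AE //; split.
    by rewrite linearD linearZ /= sCut dirichletH_sym.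
  by move=> l u; apply: loc => //; exact: cXY.
apply: (@fiber_bound R n J (dirichletH Q (pot Vbar X0)) cut_mx (cluster_at o) Vbar l0 w b c m s) => //.
- exact: dirichletH_sym.
- by move=> f; apply: edge_mx_qform => //; [exact: cut_edge_sym|exact: cut_edge_adj].
- move=> Y t YJ t01; apply: le_trans taub; have [sA' lA'] := locX Y t YJ t01.
  apply: (window_leak_loc fQ sA' GQ tau0 lA') => u.
  apply: (edge_mx_mul_bound fQ) => //; [exact: cut_edge_sym|exact: cut_edge_adj|exact: cut_edge_far].
- move=> Y t YJ t01; have [sA' lA'] := locX Y t YJ t01.
  exact: (card_window_loc fQ sA' GQ lA').
- by move=> x; exact: bit_sites_own.
- by move=> x y; exact: bit_sites_other.
- by move=> x i j; exact: bit_sites_block.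
move=> Y; rewrite inE => /andP[YJ /asboolP[l [u [u1 uA ul hg]]]]; split=> //.
by exists l, u; rewrite AE.
Qed.

(** Summing resonant_fiber over fibres, with C(k, k/2) <= 2^k / sqrt k and k at
    most the number of sites of Q. *)
Lemma resonant_count o : ibox hO (0, 0) o ->
  (g * #|predI (resonant_at o) (fun X => `[< compat (pot Vbar X) >])| <=
   2 * m.+1 * (2 * m).+1 * H.*2.+1 *
     #|[pred X : {set 'I_n} | `[< compat (pot Vbar X) >]]|)%N.
Proof.
move=> Oo; apply: (card_fibers (J := bit_sites o)) => [X Y XY|X0 X0J cX0].
  by apply/asboolP/asboolP; apply: compat_pot Oo _.
apply: leq_trans (resonant_fiber Oo X0J _) _; first exact/asboolP.
rewrite -[leqRHS]mulnA leq_mul2l; apply/orP; right.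
set N := #|bit_sites o|.
have hN : (N <= H.*2.+1 ^ 2)%N.
  by apply: leq_trans (max_card _) _; rewrite card_ord num_sites_ibox.
rewrite -leq_sqr expnMn; apply: leq_trans (_ : N * 4 ^ N <= _)%N.
  by rewrite expnS expn1 -mulnA leq_mul2l central_bin_le orbT.
have -> : ((H.*2.+1 * 2 ^ N) ^ 2 = H.*2.+1 ^ 2 * 4 ^ N)%N.
  by rewrite expnMn -expnM mulnC (mulnC N) expnM mulnC.
by rewrite leq_mul2r hN orbT.
Qed.

End FreeBits.

(** * Regular sets and the continuation event *)

Section Regularity.
Context {R : realType}.
Local Open Scope classical_set_scope.
Implicit Types (Theta E : set site) (x y : site).

Lemma tilted_square1 x : tilted_square [set x].
Proof.
exists `[x.1 + x.2, x.1 + x.2]%O, `[x.1 - x.2, x.1 - x.2]%O; split.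
  by rewrite !set_itv1; exact: cardinality.eq_card1.
apply/seteqP; split=> y; rewrite /tilted_rect /= !in_itv /=.
  by move=> ->; split; rewrite !lexx.
case: x y => x1 x2 [y1 y2] /= [h1 h2]; congr pair; lia.
Qed.

Lemma num_sites1 x : num_sites [set x] = 1%N.
Proof. by rewrite /num_sites fset_set1 cardfs1. Qed.

(** A single site of Theta is a tilted square in which Theta is not sparse, so
    regularity bounds the density of Theta. *)
Lemma regular_density (eta : R) Theta E : finite_set E -> eta < 1 ->
  regular eta Theta E -> (num_sites (Theta `&` E))%:R <= eta * (num_sites E)%:R.
Proof.
move=> fE eta1 reg; have fT : finite_set (Theta `&` E) by apply: sub_finite_set fE => x [].
have := reg (num_sites (Theta `&` E)) (fun i => [set site_of i]).
have -> : \sum_(i < num_sites (Theta `&` E)) (num_sites [set site_of i])%:R =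
    (num_sites (Theta `&` E))%:R :> R.
  by under eq_bigr do rewrite num_sites1; rewrite sumr_const card_ord.
apply.
  move=> i; have [Ti Ei] := site_of_in fT i; split.
  - exact: tilted_square1.
  - by move=> x ->.
  move=> sp; have := sp ((site_of i).1 + (site_of i).2) true.
  have -> : Defs.diagonal true ((site_of i).1 + (site_of i).2) `&` Theta `&` [set site_of i] = [set site_of i].
    by apply/seteqP; split=> x; [case | move=> ->].
  have -> : Defs.diagonal true ((site_of i).1 + (site_of i).2) `&` [set site_of i] = [set site_of i].
    by apply/seteqP; split=> x; [case | move=> ->].
  by rewrite num_sites1 mulr1 leNgt eta1.
by apply/trivIsetP => i j _ _ ij; apply/seteqP; split=> // x [-> /site_of_inj/eqP]; rewrite (negbTE ij).
Qed.

Lemma regular_capr (eta : R) Theta E : regular eta Theta E -> regular eta (Theta `&` E) E.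
Proof.
move=> reg n T TP; apply: reg => i; have [t1 t2 t3] := TP i; split=> // sp; apply: t3 => k s.
have := sp k s; congr (_%:R <= _); congr num_sites.
apply/seteqP; split=> x; last by move=> [[h1 [h2 _]] h3].
by move=> [[h1 h2] h3]; split=> //; split=> //; split=> //; exact: t2.
Qed.

Lemma continuation_event_ext (e alpha l : R) a Theta1 Theta2 Vbar l0 V1 V2 :
  (forall x, box l a x -> V1 x = V2 x) ->
  box l a `\` Theta1 = box l a `\` Theta2 ->
  continuation_event e alpha l a Theta1 Vbar l0 V1 ->
  continuation_event e alpha l a Theta2 Vbar l0 V2.
Proof.
move=> V12 TE ce lam u lamP eqn; rewrite -TE; apply: (ce lam u) => // x bx.
by rewrite -eqn // /schrodinger V12.
Qed.

End Regularity.

Section ContinuationCount.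
Context {R : realType}.
Local Open Scope classical_set_scope.
Variables (S : set site) (Vbar : R) (Theta : set site) (V' : site -> R).
Hypotheses (fS : finite_set S) (Vbar0 : Vbar != 0).
Notation n := (num_sites S).
Variables (d : measure_display) (T : measurableType d) (P : probability T R).
Variable V : site -> {RV P >-> R}.
Hypothesis iidV : iid_potential Vbar V.

(** The continuation event depends on the potential in the box only; by
    independence the condition that V = V' on the rest of Theta does not change
    its probability. *)
Lemma continuation_failure_count (e alpha l l0 eta : R) a :
  box l a `<=` S -> Theta `<=` S ->
  1 - eta <= cond_prob P
    [set w | continuation_event e alpha l a (Theta `&` box l a) Vbar l0 (fun x => V x w)]
    [set w | forall x, (Theta `&` box l a) x -> V x w = V' x] ->
  (#|[pred X : {set 'I_n} | ~~ `[< continuation_event e alpha l a Theta Vbar l0 (pot Vbar X) >]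
      && `[< compat Theta V' (pot Vbar X) >]]|)%:R <=
  eta * (#|[pred X : {set 'I_n} | `[< compat Theta V' (pot Vbar X) >]]|)%:R.
Proof.
move=> bS TS; set B := box l a.
have BT : B `\` (Theta `&` B) = B `\` Theta.
  by apply/seteqP; split=> x [h1 h2]; split=> // h; apply: h2 => //; case: h.
pose p (X : {set 'I_n}) := `[< continuation_event e alpha l a Theta Vbar l0 (pot Vbar X) >].
pose q1 (X : {set 'I_n}) := `[< compat (Theta `&` B) V' (pot Vbar X) >].
pose q2 (X : {set 'I_n}) := `[< compat (Theta `\` B) V' (pot Vbar X) >].
rewrite (cond_prob_configs fS Vbar0 iidV (p := p) (q := q1)); first last.
- apply/seteqP; split=> w /= h.
    by apply/asboolP => x Tx; rewrite -(potential_config fS Vbar0 iidV) ?h //; apply: TS; case: Tx.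
  by move=> x Tx; rewrite (potential_config fS Vbar0 iidV); [move/asboolP: h; exact | apply: TS; case: Tx].
- apply/seteqP; split=> w /= h.
    apply/asboolP; apply: continuation_event_ext h => // x bx.
    by rewrite (potential_config fS Vbar0 iidV) //; exact: bS.
  move/asboolP: h; apply: continuation_event_ext => // x bx.
  by rewrite (potential_config fS Vbar0 iidV) //; exact: bS.
move=> hc.
have h1 : #|predI (predC p) q1|%:R <= eta * #|q1|%:R.
  have E : #|q1| = (#|predI p q1| + #|predI (predC p) q1|)%N.
    rewrite -(cardID p q1) addnC addnC; congr (_ + _)%N; apply: eq_card => X.
    by rewrite !inE /= !unfold_in /= andbC.
  have [q0|q0] := posnP #|q1|.
    by move: E; rewrite q0 mulr0 => /esym/eqP; rewrite addn_eq0 => /andP[_ /eqP->].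
  have q0' : 0 < #|q1|%:R :> R by rewrite ltr0n.
  have Er : #|q1|%:R = #|predI p q1|%:R + #|predI (predC p) q1|%:R :> R.
    by rewrite -natrD -E.
  by move: hc; rewrite ler_pdivlMr // => hc; lra.
have compE X : `[< compat Theta V' (pot Vbar X) >] = q1 X && q2 X.
  apply/asboolP/andP => [h|[/asboolP h1' /asboolP h2] x Tx].
    by split; apply/asboolP => x [Tx _]; exact: h.
  by have [Bx|Bx] := pselect (B x); [apply: h1' | apply: h2].
pose U := index_set S B.
have potU (X Y : {set 'I_n}) x : B x -> X :&: U = Y :&: U -> pot Vbar X x = pot Vbar Y x.
  move=> Bx /setP XY; have [i ix] := site_of_surj fS (bS _ Bx).
  rewrite -ix !pot_site; have := XY i; rewrite !finset.in_setI.
  by have -> : i \in U; [apply/index_setP; rewrite ix | rewrite !andbT => ->].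
have potUC (X Y : {set 'I_n}) x : S x -> ~ B x -> X :\: U = Y :\: U -> pot Vbar X x = pot Vbar Y x.
  move=> Sx Bx /setP XY; have [i ix] := site_of_surj fS Sx.
  rewrite -ix !pot_site; have := XY i; rewrite !finset.in_setD.
  have -> : i \notin U by apply/negP => /index_setP; rewrite ix.
  by move=> /= ->.
have q2U (X Y : {set 'I_n}) : X :\: U = Y :\: U -> q2 X = q2 Y.
  move=> XY; apply/asboolP/asboolP => h x Tx; rewrite -h //; have [Tx' Bx] := Tx;
    by rewrite (potUC _ _ _ (TS _ Tx') Bx XY).
have q1U (X Y : {set 'I_n}) : X :&: U = Y :&: U -> q1 X = q1 Y.
  move=> XY; apply/asboolP/asboolP => h x Tx; rewrite -h //; have [Tx' Bx] := Tx;
    by rewrite (potU _ _ _ Bx XY).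
have pU (X Y : {set 'I_n}) : X :&: U = Y :&: U -> p X = p Y.
  have half (X1 X2 : {set 'I_n}) : X1 :&: U = X2 :&: U ->
      continuation_event e alpha l a Theta Vbar l0 (pot Vbar X1) ->
      continuation_event e alpha l a Theta Vbar l0 (pot Vbar X2).
    move=> XY h lam u lamP eqn; apply: (h lam u) => // x bx.
    by rewrite -eqn // /schrodinger (potU _ _ _ bx XY).
  by move=> XY; apply/asboolP/asboolP; apply: half.
have i1 := card_independent (p := predI (predC p) q1) (q := q2) (U := U) _ q2U.
have i2 := card_independent (p := q1) (q := q2) (U := U) q1U q2U.
have {i1} i1 := i1 (fun X Y XY => congr2 andb (congr1 negb (pU X Y XY)) (q1U X Y XY)).
have n0 : 0 < (2 ^ #|'I_n|)%:R :> R by rewrite ltr0n expn_gt0.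
rewrite -(ler_pM2r n0) -mulrA -!natrM.
rewrite (_ : #|[pred X | _ && _]| = #|predI (predI (predC p) q1) q2|); last first.
  by apply: eq_card => X; rewrite !unfold_in /= compE andbA.
rewrite (_ : #|[pred X | `[< _ >]]| = #|predI q1 q2|); last first.
  by apply: eq_card => X; rewrite !unfold_in /= compE.
by rewrite i1 i2 !natrM mulrA ler_wpM2r.
Qed.

End ContinuationCount.

(** * Eigenvectors have many large entries *)

Section Resolvent.
Context {R : realType}.

Lemma resolvent_of_gap n (A : 'M[R]_n) l0 t : A^T = A -> 0 < t ->
  (forall i, t <= `|eigvals A 0 i - l0|) -> resolvent_le A l0 t^-1.
Proof.
move=> sA t0 gap.
have un : A - l0%:M \in unitmx.
  rewrite -row_free_unit -kermx_eq0; apply/negPn/negP => h.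
  have /(eigenvalue_eigvals sA)[i ei] : eigenvalue A l0 by [].
  by have := gap i; rewrite ei subrr normr0; lra.
split=> //; apply: ge_sup.
  exists 0; exists 0; last by rewrite mulmx0 /l2norm big1 ?sqrtr0 // => i _; rewrite mxE expr0n.
  by rewrite /l2norm big1 ?sqrtr0 ?ler01 // => i _; rewrite mxE expr0n.
move=> _ [u u1 ->]; set v := _ *m u.
have uE : u = (A - l0%:M) *m v by rewrite mulmxA mulmxV // mul1mx.
have l2E (x : 'cV[R]_n) : l2norm x = Num.sqrt (dotr x^T x^T).
  by rewrite /l2norm dotrE; congr Num.sqrt; apply: eq_bigr => i _; rewrite mxE expr2.
have PP : (eigbasis A)^T *m eigbasis A = 1%:M by apply/mulmx1C/eigbasis_orth.
have [c cE] : exists c, v^T = c *m eigbasis A.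
  by exists (v^T *m (eigbasis A)^T); rewrite -mulmxA PP mulmx1.
have sAl : (A - l0%:M)^T = A - l0%:M by rewrite linearB /= sA tr_scalar_mx.
have uT : u^T = \row_i ((eigvals A 0 i - l0) * c 0 i) *m eigbasis A.
  rewrite uE trmx_mul sAl cE -mulmxA mulmxBr eigbasis_mul // mul_mx_scalar -mul_scalar_mx.
  rewrite -mulmxBl mulmxA; congr (_ *m _); apply/rowP => j.
  rewrite mulmxBr mul_mx_diag mul_mx_scalar !mxE; ring.
have uv : t ^+ 2 * dotr v^T v^T <= dotr u^T u^T.
  rewrite uT cE !dotr_eigbasis // !dotrE mulr_sumr; apply: ler_sum => i _.
  rewrite !mxE [leRHS]mulrACA ler_wpM2r //; first by rewrite -expr2 sqr_ge0.
  rewrite -[leRHS]expr2 -(real_normK (num_real (eigvals A 0 i - l0))).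
  by rewrite ler_pXn2r ?nnegrE ?normr_ge0 ?(ltW t0) ?gap.
rewrite l2E; have : dotr v^T v^T <= (t^-1) ^+ 2.
  have u2 : dotr u^T u^T <= 1.
    by rewrite l2E -(sqrtr1 R) ler_sqrt // in u1.
  by rewrite exprVn -[leRHS]mul1r ler_pdivlMr ?exprn_gt0 // mulrC (le_trans uv).
move=> h; rewrite -(ler_pXn2r (n := 2)) ?nnegrE ?sqrtr_ge0 ?invr_ge0 ?(ltW t0) //.
by rewrite sqr_sqrtr ?dotr_ge0.
Qed.

End Resolvent.

Section Peaks.
Context {R : realType}.
Local Open Scope classical_set_scope.

Lemma large_entry n N (u : 'rV[R]_n) : dotr u u = 1 -> (n <= N ^ 2)%N ->
  exists i, N%:R^-1 <= `|u 0 i|.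
Proof.
move=> u1 nN; have [/existsP[i hi]|/existsPn h] := boolP [exists i, N%:R^-1 <= `|u 0 i|].
  by exists i.
exfalso; have N0 : (0 < N)%N.
  rewrite lt0n; apply/eqP => N0; move: nN u u1 h; rewrite N0 leqn0 => /eqP-> u u1 _.
  by move: u1; rewrite dotrE big_ord0 => /esym/eqP; rewrite oner_eq0.
have Nr : 0 < N%:R :> R by rewrite ltr0n.
have lt i : u 0 i * u 0 i < N%:R^-1 ^+ 2.
  have := h i; rewrite -ltNge => hi; rewrite -expr2 -real_normK ?num_real //.
  by rewrite ltr_pXn2r ?nnegrE ?normr_ge0 ?invr_ge0 ?(ltW Nr) ?hi.
have n0 : (0 < n)%N.
  case: n u u1 {h lt nN} => // u; rewrite dotrE big_ord0 => /esym/eqP.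
  by rewrite oner_eq0.
have : dotr u u < n%:R * N%:R^-1 ^+ 2.
  rewrite dotrE; have -> : n%:R * N%:R^-1 ^+ 2 = \sum_(i < n) (N%:R^-1 ^+ 2 : R).
    by rewrite sumr_const card_ord mulr_natl.
  by apply: ltr_sum => //; apply/hasP; exists (Ordinal n0) => //; rewrite mem_index_enum.
rewrite u1 ltNge => /negP; apply.
by rewrite exprVn ler_pdivrMr ?exprn_gt0 // mul1r -natrX ler_nat.
Qed.

Variables (H h3 rho K : nat) (a0 : site) (q : 'I_K -> site) (Theta : set site).
Notation Q := (ibox H%:Z a0).
Let fQ : finite_set Q := finite_ibox H%:Z a0.
Notation n := (num_sites Q).
Variables (Vbar l0 l e alpha R6 M c1 : R) (V : site -> R) (u : 'rV[R]_n).
Hypothesis KD : (K.+2 * (4 * rho + 2 * h3 + 5) <= H)%N.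
Hypothesis boxR6 : forall a, box R6 a = ibox rho%:Z a.
Hypothesis R6_100 : 100 <= R6.
Hypothesis M1 : 1 <= M.
Hypothesis EM : forall x, Q x -> `|4 + V x - l| + 3 <= M.
Hypotheses (u1 : dotr u u = 1) (uA : u *m dirichletH Q V = l *: u).
Hypothesis ll0 : `|l - l0| <= (ell R6 * Vbar) `^ (- (alpha * ell R6)).
Hypothesis c10 : 0 < c1.
Hypothesis small : c1 * (ell R6 * Vbar) `^ (alpha * ell R6) <
  (H.*2.+1)%:R^-1 / M ^+ (K.+1 * (4 * rho + 2 * h3 + 5) + rho).

Definition clear_center (p : site) : Prop :=
  ibox rho%:Z p `<=` Q /\ forall k x, ibox rho%:Z p x -> ~ ibox h3%:Z (q k) x.

Hypothesis cont : forall p, clear_center p ->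
  continuation_event e alpha R6 p Theta Vbar l0 V.

(** Divide u by c1. If |u| > c1 held on too few sites of the box at p, the
    continuation event would bound u p by c1 times the growth factor, against
    the lower bound of reach_clear_box. *)
Lemma peak_sites : exists2 p, clear_center p &
  e ^+ 3 * (num_sites (ibox rho%:Z p `\` Theta))%:R <=
   (num_sites [set x | (ibox rho%:Z p `\` Theta) x /\ c1 < `|extend u x|])%:R.
Proof.
have [i hi] : exists i, (H.*2.+1)%:R^-1 <= `|u 0 i|.
  by apply: (large_entry u1); rewrite num_sites_ibox.
have [p [pQ pq up]] : exists p, [/\ ibox rho p `<=` ibox H a0,
     forall k x, ibox rho p x -> ~ ibox h3 (q k) x &
     (H.*2.+1)%:R^-1 / M ^+ (K.+1 * (4 * rho + 2 * h3 + 5) + rho) <= `|extend u p|].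
  apply: (reach_clear_box (E := fun x => 4 + V x - l) (a := site_of i)) => //.
  - move=> x; apply: contraNP => Qx; apply/eqP; exact: (extend_out fQ).
  - move=> x Qx; split; first exact: EM.
    rewrite -(eigenvector_neighbors fQ uA Qx) /neighbors !big_cons big_nil.
    by rewrite addr0 !addrA.
  - by rewrite extend_site.
have cp : clear_center p by split.
exists p => //; rewrite leNgt; apply/negP => lt.
have fB : finite_set (ibox rho%:Z p `\` Theta) by apply: sub_finite_set (finite_ibox rho%:Z p) => x [].
have ce := cont cp.
have := ce l (fun x => extend u x / c1) ll0.
have c1N : c1 != 0 by rewrite gt_eqF.
have eqn x : box R6 p x -> schrodinger V (fun x => extend u x / c1) x = l * (extend u x / c1).
  rewrite boxR6 => /pQ Qx; rewrite schrodingerE.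
  under eq_bigr do rewrite mulrC.
  rewrite -mulr_sumr (eigenvector_neighbors fQ uA Qx); field; exact: c1N.
move=> /(_ eqn); rewrite boxR6.
set B := ibox rho%:Z p `\` Theta in fB lt *.
set F2 := [set x | B x /\ c1 < `|extend u x|] in lt.
pose F1 := [set x | B x /\ `|extend u x / c1| <= 1].
have cnt : (num_sites B = num_sites F1 + num_sites F2)%N.
  have F1B : F1 `<=` B by move=> x [].
  have F2B : F2 `<=` B by move=> x [].
  have -> : F2 = B `\` F1.
    apply/seteqP; split=> x [Bx].
      by move=> h; split=> // -[_]; rewrite normrM normfV (gtr0_norm c10) ler_pdivrMr // mul1r leNgt h.
    move=> h; split=> //; rewrite ltNge; apply/negP => h'; apply: h; split=> //.
    by rewrite normrM normfV (gtr0_norm c10) ler_pdivrMr // mul1r.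
  rewrite (num_sites_setD fB _ F1B) //.
  have -> : B `&` F1 = F1 by apply/seteqP; split=> x; [case | move=> h; split=> //; exact: F1B].
  by rewrite subnKC // num_sites_sub.
have h1 : (1 - e ^+ 3) * (num_sites B)%:R <= (num_sites F1)%:R.
  have := congr1 (fun k => k%:R : R) cnt; rewrite natrD => cr.
  by lra.
have hb : box (1 / 100 * R6) p p.
  rewrite /box /distoo /= !subrr normr0 maxxx mulr0z; have := R6_100; lra.
move=> /(_ h1 p hb).
rewrite normrM normfV (gtr0_norm c10) ler_pdivrMr // mulrC => h.
by have := lt_le_trans small (le_trans up h); rewrite ltxx.
Qed.

End Peaks.

(** * The probability of a resonance *)

Lemma ibox_offset h b x : ibox h b x -> ibox h (0, 0) (x.1 - b.1, x.2 - b.2).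
Proof. by move=> [h1 h2]; split=> /=; rewrite sub0r opprB. Qed.

Lemma shift_offset (b x : site) : x = shift_site b (x.1 - b.1, x.2 - b.2).
Proof. by case: x => x1 x2; rewrite /shift_site /=; congr pair; lia. Qed.

Lemma card_bigcup_sum (T1 T2 : finType) (F : T1 -> {set T2}) :
  (#|\bigcup_(i : T1) F i| <= \sum_i #|F i|)%N.
Proof.
elim/big_rec2: _ => [|i y1 y2 _ h]; first by rewrite cards0.
by apply: leq_trans (leq_card_setU _ _) _; rewrite leq_add2l.
Qed.

Lemma card_bigcup_le (T1 T2 : finType) (F : T1 -> {set T2}) (k : nat) : (0 < #|T1|)%N ->
  (forall i, #|F i| < k)%N -> (#|\bigcup_(i : T1) F i| < k * #|T1|)%N.
Proof.
move=> T0 Fk; apply: leq_ltn_trans (card_bigcup_sum F) _.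
case: k Fk => [|k] Fk; first by have [i _] := card_gt0P T0; have := Fk i.
apply: (@leq_ltn_trans (\sum_(i : T1) k)); first by apply: leq_sum => i _; exact: Fk.
by rewrite sum_nat_const mulnC ltn_mul2r T0 ltnSn.
Qed.

Lemma compat_exists (R : realType) (S Theta : set site) (V' : site -> R) (Vbar : R) :
  finite_set S -> (Theta `<=` S)%classic -> Vbar != 0 -> two_valued Vbar Theta V' ->
  exists X : {set 'I_(num_sites S)}, compat Theta V' (pot Vbar X).
Proof.
move=> fS TS V0 V'2; exists (index_set S [set x | Theta x /\ V' x = Vbar]%classic) => x Tx.
have [i ix] := site_of_surj fS (TS _ Tx).
rewrite -ix pot_site in_index_set ix; case: (V'2 _ Tx) => V'x; last by rewrite asboolT.
by rewrite asboolF // => -[_]; rewrite V'x => /esym; exact/eqP.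
Qed.

Section Core.
Context {R : realType}.
Local Open Scope classical_set_scope.
Variables (eps0 : R) (r : nat) (hO hT hr : int) (H h3 rho K : nat).
Variables (a0 : site) (q : 'I_K -> site) (Theta D : set site) (V' : site -> R).
Notation rd := (rdot eps0 r).
Hypotheses (OE : forall a, Omega eps0 r a = ibox hO a)
  (TE : forall a, tOmega eps0 r a = ibox hT a)
  (rE : forall a, box (r%:R : R) a = ibox hr a).
Hypotheses (hO0 : 0 <= hO) (hOT : hO + 1 <= hT) (hTr : hT <= hr) (hTrd : hT + 1 + hr < rd).
Notation Q := (ibox H%:Z a0).
Notation Qs := (\bigcup_(k in [set: 'I_K]) ibox h3%:Z (q k)).
Hypothesis latQ : exists N, lattice (N * rd) a0 /\ H%:Z = N * rd + hr.
Hypothesis latq : forall k, exists N, lattice (N * rd) (q k) /\ h3%:Z = N * rd + hr.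
Hypothesis ThetaQ : Theta `<=` Q.
Hypothesis DQ : D `<=` lattice rd `&` Q.
Hypothesis QTheta : Q `\` Theta = \bigcup_(b in D) Omega eps0 r b.
Notation bits := (free_bits eps0 r h3 q D).
Hypothesis adm : forall b, bits b -> admissible eps0 r V' b.
Let fQ : finite_set Q := finite_ibox H%:Z a0.
Notation n := (num_sites Q).
Variables (Vbar l0 w tau b c1 : R) (G : set site) (s : nat -> R) (g : nat).
Let m := (4 * num_sites G)%N.
Let c := c1 ^+ 2.
Hypothesis GQ : G `<=` Q.
Hypotheses (V0 : 0 < Vbar) (w0 : 0 < w) (w1 : w <= 1) (tau0 : 0 <= tau).
Hypotheses (b01 : 0 < b <= 1) (bw : 8 * b <= w) (c10 : 0 < c1).
Hypothesis taub : m%:R * (16 * tau) <= b ^+ 2.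
Hypothesis loc : forall (X : {set 'I_n}) t l (u : 'rV[R]_n),
  compat Theta V' (pot Vbar X) -> 0 <= t <= 1 ->
  `|l - l0| <= w -> u *m cutH eps0 r Q (pot Vbar X) bits t = l *: u ->
  norm2_on (Q `\` Qs) u <= tau * dotr u u /\ dotr u u <= 4 * norm2_on G u.
Hypothesis s0 : forall k, 0 < s k.
Hypothesis s_step : forall k, (k <= m)%N -> 8 * s k <= (s k.+1 - s k) * c.
Hypothesis s_v : forall k, (k <= m)%N -> 8 * s k <= Vbar * c.
Hypothesis s_w : s m.+1 <= w / 4.
Hypothesis g0 : (0 < g)%N.
Hypothesis V'2 : two_valued Vbar Theta V'.
Variables (e alpha R6 M eta : R).
Hypothesis KD : (K.+2 * (4 * rho + 2 * h3 + 5) <= H)%N.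
Hypothesis boxR6 : forall a, box R6 a = ibox rho%:Z a.
Hypothesis R6_100 : 100 <= R6.
Hypotheses (l08 : 0 <= l0 <= 8) (VM : Vbar + 8 <= M).
Hypothesis s_uc : s 0%N <= (ell R6 * Vbar) `^ (- (alpha * ell R6)).
Hypothesis small : c1 * (ell R6 * Vbar) `^ (alpha * ell R6) <
  (H.*2.+1)%:R^-1 / M ^+ (K.+1 * (4 * rho + 2 * h3 + 5) + rho).
Hypotheses (e0 : 0 < e) (e1 : e < 1).
Hypothesis reg : forall a, box R6 a `<=` Q `\` Qs -> regular e Theta (box R6 a).
Notation offsets := (num_sites (ibox hO (0, 0))).
Hypothesis many : (2 * g * offsets)%:R <= e ^+ 3 * ((1 - e) * ((rho.*2.+1 ^ 2)%N)%:R).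
Hypothesis eta0 : 0 <= eta.
Variables (d : measure_display) (T : measurableType d) (P : probability T R).
Variable V : site -> {RV P >-> R}.
Hypothesis iidV : iid_potential Vbar V.
Hypothesis uc : forall a, clear_center H h3 rho a0 q a ->
  1 - eta <= cond_prob P
    [set w | continuation_event e alpha R6 a (Theta `&` box R6 a) Vbar l0 (fun x => V x w)]
    [set w | forall x, (Theta `&` box R6 a) x -> V x w = V' x].

Let Vn0 : Vbar != 0. Proof. by rewrite gt_eqF. Qed.

Let compatb (X : {set 'I_n}) : bool := `[< compat Theta V' (pot Vbar X) >].
Let fails p (X : {set 'I_n}) : bool :=
  ~~ `[< continuation_event e alpha R6 p Theta Vbar l0 (pot Vbar X) >].

Lemma clear_center_box p : clear_center H h3 rho a0 q p -> box R6 p `<=` Q `\` Qs.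
Proof.
move=> [pQ pq] x; rewrite boxR6 => px; split; first exact: pQ.
by move=> [k _ kx]; apply: (pq k x).
Qed.

(** The large entries found by peak_sites number at least 2g times the number of
    offsets, and all lie in cells of free bits. *)
Lemma resonance_dichotomy X : compatb X ->
  ~ resolvent_le (dirichletH Q (pot Vbar X)) l0 (s 0%N)^-1 ->
  (exists2 i : 'I_n, clear_center H h3 rho a0 q (site_of i) & fails (site_of i) X) \/
  (exists o : 'I_offsets, resonant_at eps0 r h3 q D Vbar l0 c s g (site_of o) X).
Proof.
move=> /asboolP cX bad.
have [[i ci fi]|nofail] := pselect (exists2 i : 'I_n,
    clear_center H h3 rho a0 q (site_of i) & fails (site_of i) X); first by left; exists i.
right; set A := dirichletH Q (pot Vbar X) in bad.
have sA : A^T = A by exact: dirichletH_sym.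
have [i hi] : exists i, `|eigvals A 0 i - l0| < s 0%N.
  apply: contrapT => h; apply: bad; apply: resolvent_of_gap => // i.
  by rewrite leNgt; apply/negP => hi; apply: h; exists i.
pose u := eigvec A i; pose l := eigvals A 0 i.
have u1 : dotr u u = 1 by rewrite eigvec_orth // eqxx.
have uA : u *m A = l *: u by exact: eigvec_mul.
have sw : s 0%N <= w.
  have sm k : (k <= m.+1)%N -> s 0%N <= s k.
    elim: k => // k IH km; apply: le_trans (IH (ltnW km)) _.
    have := s_step km; have := s0 k; have c0 : 0 < c by rewrite exprn_gt0.
    by move=> h1 h2; rewrite -subr_ge0 -(pmulr_lge0 _ c0); lra.
  by apply: le_trans (sm _ (leqnn _)) (le_trans s_w _); have := w0; lra.
have [] := @peak_sites R H h3 rho K a0 q Theta Vbar l0 l e alpha R6 M c1 (pot Vbar X) u.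
- exact: KD.
- exact: boxR6.
- exact: R6_100.
- by have := VM; have := V0; lra.
- move=> x _; have potx : 0 <= pot Vbar X x <= Vbar.
    by rewrite /pot; case: ifP; rewrite ?lexx (ltW V0).
  have : `|l - l0| <= 1 by apply: ltW; apply: lt_le_trans hi (le_trans sw w1).
  rewrite ler_norml => /andP[h1 h2]; have := l08; have := VM; move: potx.
  move=> /andP[p1 p2] vm /andP[p3 p4].
  suff : `|4 + pot Vbar X x - l| <= Vbar + 5 by lra.
  by rewrite ler_norml; apply/andP; split; lra.
- exact: u1.
- exact: uA.
- by apply: ltW; apply: lt_le_trans hi s_uc.
- exact: c10.
- exact: small.
- move=> p cp; apply: contrapT => nce; apply: nofail.
  have Qp : Q p by apply: cp.1; split; rewrite subrr normr0.
  have [j jp] := site_of_surj fQ Qp.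
  by exists j; rewrite jp //; apply/negP => /asboolP.
move=> p cp; set B := ibox rho%:Z p `\` Theta; set F2 := [set x | _] => hF.
have fB0 := finite_ibox rho%:Z p.
have dens : (1 - e) * ((rho.*2.+1 ^ 2)%N)%:R <= (num_sites B)%:R.
  have := regular_density fB0 e1 (_ : regular e Theta (ibox rho%:Z p)).
  rewrite -boxR6 => /(_ (reg (clear_center_box cp))); rewrite boxR6.
  have fTB : Theta `&` ibox rho%:Z p = ibox rho%:Z p `&` Theta by rewrite setIC.
  have cnt : (num_sites B + num_sites (ibox rho%:Z p `&` Theta) = num_sites (ibox rho%:Z p))%N.
    have -> : B = ibox rho%:Z p `\` (ibox rho%:Z p `&` Theta).
      by rewrite setDIr setDv set0U.
    rewrite (num_sites_setD fB0 (fun x hx => hx)); last by move=> x [].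
    by rewrite setIA setIid subnK // num_sites_sub // => x [].
  rewrite fTB num_sites_ibox in cnt *; move/(congr1 (fun k => k%:R : R)): cnt.
  by rewrite natrD; lra.
have hF2 : (2 * g * offsets <= num_sites F2)%N.
  rewrite -(ler_nat R); apply: le_trans many (le_trans _ hF).
  by rewrite ler_wpM2l // exprn_ge0 // ltW.
have F2Q : F2 `<=` Q by move=> x [[px _] _]; exact: cp.1.
apply: contrapT => none.
have le2 (o : 'I_offsets) : (#|[set x in bit_sites eps0 r H h3 a0 q D (site_of o) | (c <= u 0 x ^+ 2)%R]%SET| < 2 * g)%N.
  rewrite ltnNge; apply/negP => h; apply: none; exists o; apply/asboolP.
  by exists l, u.
have fO := finite_ibox hO (0, 0).
have cover : index_set Q F2 \subset (\bigcup_(o : 'I_offsets)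
    [set x in bit_sites eps0 r H h3 a0 q D (site_of o) | (c <= u 0 x ^+ 2)%R])%SET.
  apply/fintype.subsetP => j /index_setP[[pj Tj] uj].
  have nQs : ~ Qs (site_of j) by move=> [k _]; exact: cp.2.
  have [bb fb Ob] := free_bit_at OE hO0 hOT hTr hTrd latq DQ QTheta (conj (cp.1 _ pj) Tj) nQs.
  pose o : site := ((site_of j).1 - bb.1, (site_of j).2 - bb.2).
  have Oo : ibox hO (0, 0) o.
    by move: Ob; rewrite OE; exact: ibox_offset.
  have [k ko] := site_of_surj fO Oo.
  apply/bigcupP; exists k => //; rewrite inE; apply/andP; split.
    apply/bit_sitesP; exists bb => //; rewrite ko; exact: shift_offset.
  move: uj; rewrite extend_site => uj.
  by rewrite -(real_normK (num_real (u 0 j))) ler_pXn2r ?nnegrE ?normr_ge0 ?(ltW c10) ?(ltW uj).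
have := subset_leq_card cover; rewrite (card_index_set fQ F2Q) => hc.
have O0 : (0 < #|'I_offsets|)%N.
  have self : ibox hO (0, 0) (0, 0) by split; rewrite subrr normr0; exact: hO0.
  by have [k _] := site_of_surj fO self; apply/card_gt0P; exists k.
have := leq_ltn_trans hc (card_bigcup_le O0 le2).
by rewrite card_ord ltnNge hF2.
Qed.

Notation bad_bits := (2 * m.+1 * (2 * m).+1 * H.*2.+1)%N.

Lemma wegner_core : 1 - ((H.*2.+1 ^ 2)%:R * eta + offsets%:R * (bad_bits%:R / g%:R)) <=
  cond_prob P [set w | resolvent_le (dirichletH Q (fun x => V x w)) l0 (s 0%N)^-1]
    [set w | forall x, Theta x -> V x w = V' x].
Proof.
pose p (X : {set 'I_n}) := `[< resolvent_le (dirichletH Q (pot Vbar X)) l0 (s 0%N)^-1 >].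
rewrite (cond_prob_configs fQ Vn0 iidV (p := p) (q := compatb)); first last.
- apply/seteqP; split=> z /= h.
    by apply/asboolP => x Tx; rewrite -(potential_config fQ Vn0 iidV) ?h //; exact: ThetaQ.
  by move=> x Tx; rewrite (potential_config fQ Vn0 iidV); [move/asboolP: h; exact | exact: ThetaQ].
- have HE z : dirichletH Q (fun x => V x z) = dirichletH Q (pot Vbar (config_of Q V z)).
    apply/matrixP => i j; rewrite !mxE /kernelH; case: eqP => // _.
    by rewrite (potential_config fQ Vn0 iidV) //; exact: (site_of_in fQ i).
  by apply/seteqP; split=> z /=; rewrite HE => h; apply/asboolP.
have q0 : 0 < #|compatb|%:R :> R.
  have [X cX] := compat_exists fQ ThetaQ Vn0 V'2.
  by rewrite ltr0n; apply/card_gt0P; exists X; exact/asboolP.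
have E : #|compatb| = (#|predI p compatb| + #|predI (predC p) compatb|)%N.
  rewrite -(cardID p compatb); congr (_ + _)%N; apply: eq_card => X;
    by rewrite !inE /= !unfold_in /= andbC.
have Er : #|compatb|%:R = #|predI p compatb|%:R + #|predI (predC p) compatb|%:R :> R.
  by rewrite -natrD -E.
suff bad : #|predI (predC p) compatb|%:R <=
    ((H.*2.+1 ^ 2)%:R * eta + offsets%:R * (bad_bits%:R / g%:R)) * #|compatb|%:R :> R.
  by rewrite ler_pdivlMr //; lra.
pose F (i : 'I_n) := [set X : {set 'I_n} |
   `[< clear_center H h3 rho a0 q (site_of i) >] && (fails (site_of i) X && compatb X)]%SET.
pose G' (o : 'I_offsets) := [set X : {set 'I_n} |
   resonant_at eps0 r h3 q D Vbar l0 c s g (site_of o) X && compatb X]%SET.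
have cover : [set X : {set 'I_n} | ~~ p X && compatb X]%SET \subset
    (\bigcup_(i : 'I_n) F i :|: \bigcup_(o : 'I_offsets) G' o)%SET.
  apply/fintype.subsetP => X; rewrite inE => /andP[/asboolP bX cX].
  rewrite finset.in_setU; apply/orP.
  have [[i ci fi]|[k rk]] := resonance_dichotomy cX bX; [left|right].
    by apply/bigcupP; exists i => //; rewrite inE asboolT // fi.
  by apply/bigcupP; exists k => //; rewrite inE rk.
have -> : #|predI (predC p) compatb| = #|[set X : {set 'I_n} | ~~ p X && compatb X]%SET|.
  by apply: eq_card => X; rewrite !inE.
have le1 := subset_leq_card cover.
have le2 := leq_trans le1 (leq_trans (leq_card_setU _ _) (leq_add (card_bigcup_sum F) (card_bigcup_sum G'))).
rewrite -(ler_nat R) natrD !natr_sum in le2; apply: le_trans le2 _; rewrite mulrDl; apply: lerD.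
  have -> : (H.*2.+1 ^ 2)%:R * eta * #|compatb|%:R = \sum_(i < n) (eta * #|compatb|%:R).
    have nE : #|'I_n| = (H.*2.+1 ^ 2)%N by rewrite card_ord num_sites_ibox.
    by rewrite sumr_const nE -mulrA mulr_natl.
  apply: ler_sum => i _; have [ci|ci] := pselect (clear_center H h3 rho a0 q (site_of i)); last first.
    rewrite (_ : F i = finset.set0); first by rewrite cards0 mulr_ge0 // ltW.
    by apply/setP => X; rewrite !inE asboolF.
  have := continuation_failure_count fQ Vn0 iidV _ ThetaQ (uc ci).
  rewrite boxR6 => /(_ ci.1); apply: le_trans; rewrite ler_nat; apply: subset_leq_card.
  by apply/fintype.subsetP => X; rewrite !inE => /andP[_].
have -> : offsets%:R * (bad_bits%:R / g%:R) * #|compatb|%:R =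
    \sum_(o < offsets) ((bad_bits%:R / g%:R) * #|compatb|%:R) :> R.
  by rewrite sumr_const card_ord -mulrA mulr_natl.
apply: ler_sum => o _.
have Oo := site_of_in (finite_ibox hO (0, 0)) o.
have c0 : 0 < c by exact: exprn_gt0.
have locc (X : {set 'I_n}) t l (u : 'rV[R]_n) : compat Theta V' (pot Vbar X) -> 0 <= t <= 1 ->
  `|l - l0| <= w -> u *m (dirichletH Q (pot Vbar X) + t *: cut_mx eps0 r H h3 a0 q D V') = l *: u ->
  norm2_on (~` Qs) u <= tau * dotr u u /\ dotr u u <= 4 * norm2_on G u.
  move=> cX t01 ll; rewrite -(cutHE h3 q OE rE hO0 hOT hTr hTrd latQ DQ QTheta t cX) => uA.
  have [h1 h2] := loc cX t01 ll uA; split=> //.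
  suff -> : norm2_on (~` Qs) u = norm2_on (Q `\` Qs) u by [].
  rewrite /norm2_on; apply: eq_bigl => i; apply/index_setP/index_setP; last by case.
  by split=> //; exact: (site_of_in fQ i).
have := resonant_count OE TE rE hO0 hOT hTr hTrd latq ThetaQ DQ QTheta adm Vn0 GQ V0 w0 tau0 b01 bw c0 taub locc s0 s_step s_v s_w g0 Oo.
have gr : 0 < g%:R :> R by rewrite ltr0n.
rewrite -(ler_nat R) !natrM => h; rewrite mulrAC ler_pdivlMr // mulrC.
apply: le_trans h; rewrite ler_pM2l // ler_nat; apply: subset_leq_card.
by apply/fintype.subsetP => X; rewrite !inE.
Qed.

End Core.

(** * Scales *)

Section Growth.
Context {R : realType}.
Implicit Types x a : R.

Lemma powR_ge1 x a : 1 <= x -> 0 <= a -> 1 <= x `^ a.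
Proof. by move=> x1 a0; rewrite -(powRr0 x) ler_powR. Qed.

Lemma ln_le_powR x a : 0 < x -> 0 < a -> ln x <= a^-1 * x `^ a.
Proof.
move=> x0 a0; rewrite mulrC ler_pdivlMr //.
have y0 : 0 < x `^ a by exact: powR_gt0.
by rewrite mulrC -ln_powR; apply/ltW/ln_sublinear.
Qed.

Lemma log_le_powR (A B a : R) : 0 < a ->
  exists2 M : R, 1 <= M & forall x, M <= x -> A + B * ln x <= x `^ a.
Proof.
move=> a0; pose c := `|A| + `|B| * (2 / a).
have a2 : 0 < a / 2 by lra.
exists (1 + c `^ (2 / a)); first by have := powR_ge0 c (2 / a); lra.
move=> x xM; have cp := powR_ge0 c (2 / a).
have x1 : 1 <= x by lra.
have x0 : 0 < x by lra.
have ln0 : 0 <= ln x by exact: ln_ge0.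
have c0 : 0 <= c by rewrite addr_ge0 // mulr_ge0 // divr_ge0 // ltW.
set y := x `^ (a / 2).
have y1 : 1 <= y by apply: powR_ge1 => //; lra.
have cy : c <= y.
  have -> : c = (c `^ (2 / a)) `^ (a / 2).
    rewrite -powRrM (_ : 2 / a * (a / 2) = 1) ?powRr1 //; field; lra.
  by apply: ge0_ler_powR; rewrite ?nnegrE; lra.
have -> : x `^ a = y * y.
  by rewrite /y -powRD; [congr (_ `^ _); lra | apply/implyP => /eqP; lra].
have ly : ln x <= 2 / a * y by have := ln_le_powR x0 a2; rewrite invf_div.
have hA := ler_norm A; have hB := ler_norm B.
apply: le_trans (_ : c * y <= _); last by rewrite ler_wpM2r //; lra.
rewrite /c mulrDl -mulrA; apply: lerD.
  by apply: le_trans hA _; rewrite ler_peMr.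
by apply: le_trans (ler_wpM2r ln0 hB) _; rewrite ler_wpM2l.
Qed.

End Growth.

Section Thresholds.
Context {R : realType}.
Lemma fifth_root (eps0 eps1 : R) : 0 < eps1 < 1 / 100 -> 0 < eps0 < eps1 ^+ 10 ->
  [/\ eps0 < 1 / 100, 0 < eps0 `^ (1 / 5), eps0 `^ (1 / 5) <= eps1 & eps0 `^ (1 / 5) < 1].
Proof.
move=> /andP[p1 l1] /andP[p0 l0].
have pow_le n : eps1 ^+ n.+1 <= eps1.
  by rewrite exprS ler_piMr ?exprn_ile1 //; lra.
have e_le : eps0 `^ (1 / 5) <= eps1.
  apply: (@le_trans _ _ ((eps1 ^+ 10) `^ (1 / 5))).
    by apply: ge0_ler_powR; rewrite ?nnegrE ?exprn_ge0 ?(ltW p1) ?(ltW p0) ?(ltW l0) //; lra.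
  rewrite -powR_mulrn ?(ltW p1) // -powRrM (_ : 10 * (1 / 5) = 2%:R); last lra.
  by rewrite powR_mulrn ?(ltW p1).
split=> //; [|exact: powR_gt0|lra].
by apply: lt_trans l0 (le_lt_trans (pow_le 9%N) l1).
Qed.

Lemma threshold (c2 eps0 M r U x : R) : 0 < c2 -> 0 < eps0 -> 1 <= M ->
  M / c2 + 16 / eps0 + 5 < r -> expR (r ^+ 2) < U -> expR (c2 * r) <= x ->
  [/\ 16 <= eps0 * r, M <= x, 26 <= U, 1 <= ln U & c2 * r <= ln x].
Proof.
move=> c20 p0 M1 rC rU cx.
have M0 : 0 <= M / c2 by rewrite divr_ge0; lra.
have e16 : 0 <= 16 / eps0 by rewrite divr_ge0; lra.
have r25 : 25 <= r ^+ 2.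
  by have : 0 <= (r - 5) * (r + 5); [rewrite mulr_ge0; lra | rewrite expr2; lra].
have U26 : 26 <= U by have := expR_ge1Dx (r ^+ 2); lra.
have x0 : 0 < x := lt_le_trans (expR_gt0 _) cx.
split=> //.
- by rewrite mulrC -ler_pdivrMr //; lra.
- have : M <= c2 * r by rewrite mulrC -ler_pdivrMr //; lra.
  by have := expR_ge1Dx (c2 * r); lra.
- rewrite -ler_expR lnK ?posrE; last lra.
  by apply: le_trans (ltW rU); rewrite ler_expR; lra.
- by rewrite -ler_expR lnK ?posrE.
Qed.

End Thresholds.

Lemma natr_double_succ (R : realType) (h : nat) : (h.*2.+1)%:R = 2 * h%:R + 1 :> R.
Proof. by rewrite -addn1 -mul2n natrD natrM. Qed.

Section Scales.
Context {R : realType}.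
Variables (eps delta alpha e c2 kap : R) (K : nat).
Hypotheses (d0 : 0 < delta) (de : delta < eps) (e100 : eps < 1 / 100).
Hypotheses (al1 : 1 < alpha) (e0 : 0 < e) (c20 : 0 < c2) (kap0 : 0 < kap).

(** Large enough to absorb the constants that multiply powers of r <= ln R_6 /
    c2. *)
Definition log_factor : R := 1 + 54 ^+ 2 / (kap * c2 ^+ 4) + 16 / (c2 ^+ 2 * kap).

(** A scale is large if fixed multiples of its logarithm are below the powers of
    it that the estimates offer; all later smallness conditions are
    consequences. *)
Definition large (x : R) : Prop :=
  [/\ 1000 + 2 * alpha <= x, 4 * ln 64 + 4 * ln x <= x,
      (60 + 26 * K%:R + alpha) + (alpha + 2) * ln x <= x `^ (delta / 2),
      2 / e * ln 4 + 2 / e * 5 * ln x <= x `^ 2^-1 &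
      0 + log_factor * ln x <= x `^ (1 / 10)].

Lemma large_eventually : exists2 M : R, 1 <= M & forall x, M <= x -> large x.
Proof.
have dd : 0 < delta / 2 by have := d0; lra.
have half0 : 0 < 2^-1 :> R by lra.
have tenth0 : 0 < 1 / 10 :> R by lra.
have [M2 _ h2] := log_le_powR (4 * ln 64) 4 (ltr01 : 0 < (1 : R)).
have [M3 _ h3] := log_le_powR (60 + 26 * K%:R + alpha) (alpha + 2) dd.
have [M4 _ h4] := log_le_powR (2 / e * ln 4) (2 / e * 5) half0.
have [M5 _ h5] := log_le_powR 0 log_factor tenth0.
have := al1 => a1.
exists (Num.max (1000 + 2 * alpha) (Num.max (Num.max M2 M3) (Num.max M4 M5))).
  by rewrite le_max; apply/orP; left; lra.
move=> x; rewrite !ge_max => /andP[x1 /andP[/andP[x2 x3] /andP[x4 x5]]].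
split=> //; [|exact: h3|exact: h4|exact: h5].
by apply: le_trans (h2 _ x2) _; rewrite powRr1 //; lra.
Qed.

Variables (Rs : nat -> R) (U : R).
Hypothesis mono : forall k, (k <= 5)%N -> Rs k.+1 <= Rs k.
Hypothesis step : forall k, (k <= 5)%N ->
  Rs k `^ (1 - 2^-1 * eps) <= Rs k.+1 <= Rs k `^ (1 - 2 * delta).
Hypothesis big : forall x, Rs 6%N <= x -> large x.
Hypotheses (U26 : 26 <= U) (lnU : 1 <= ln U).
Notation L := (Rs 0%N).

Lemma scale_ge j k : (j <= k)%N -> (k <= 6)%N -> Rs k <= Rs j.
Proof.
elim: k => [|k IH]; first by rewrite leqn0 => /eqP->.
rewrite leq_eqVlt => /orP[/eqP->//|jk] k6.
exact: le_trans (mono k6) (IH jk (ltnW k6)).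
Qed.

Lemma scale_large k : (k <= 6)%N -> large (Rs k).
Proof. by move=> k6; apply: big; exact: scale_ge. Qed.

Lemma scale_1000 k : (k <= 6)%N -> 1000 + 2 * alpha <= Rs k.
Proof. by move=> /scale_large[]. Qed.

Lemma scale_ge1 k : (k <= 6)%N -> 1000 <= Rs k.
Proof. by move=> /scale_1000; have := al1; lra. Qed.

Lemma scale_gap k : (k <= 5)%N -> Rs k.+1 * Rs k `^ (2 * delta) <= Rs k.
Proof.
move=> k5; have k1 := scale_ge1 (leqW k5); have /andP[_ h] := step k5.
apply: le_trans (ler_wpM2r (powR_ge0 _ _) h) _.
rewrite -powRD; last by apply/implyP => _; lra.
by rewrite subrK powRr1 //; lra.
Qed.

(** Six steps, each of which loses at most a power eps/2. *)
Lemma scale_lower : L `^ (1 - 3 * eps) <= Rs 6%N.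
Proof.
have h k : (k <= 6)%N -> L `^ (1 - k%:R * (2^-1 * eps)) <= Rs k.
  elim: k => [_|k IH k6]; first by rewrite mul0r subr0 powRr1 //; have := scale_ge1 (leq0n 6); lra.
  have /andP[h _] := step k6; apply: le_trans h.
  have ed := conj d0 (conj de e100).
  apply: le_trans (_ : (L `^ (1 - k%:R * (2^-1 * eps))) `^ (1 - 2^-1 * eps) <= _).
    rewrite -powRrM ler_powR //; first by have := scale_ge1 (leq0n 6); lra.
    have k0 : 0 <= k%:R :> R by []; rewrite -natr1.
    have : 0 <= k%:R * (2^-1 * eps) * (2^-1 * eps).
      by rewrite -mulrA mulr_ge0 // mulr_ge0 //; lra.
    lra.
  apply: ge0_ler_powR; rewrite ?nnegrE ?powR_ge0 ?IH //; [lra| |exact: ltnW].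
  by have := scale_ge1 (ltnW k6); lra.
by have := h 6%N (leqnn _); congr (_ `^ _ <= _); lra.
Qed.

Lemma scale_sqr : L <= Rs 6%N ^+ 2.
Proof.
have ed := conj d0 (conj de e100); have L1 := scale_ge1 (leq0n 6).
apply: le_trans (_ : (L `^ (1 - 3 * eps)) ^+ 2 <= _); last first.
  by rewrite ler_pXn2r ?nnegrE ?powR_ge0 ?scale_lower //; have := scale_ge1 (leqnn 6); lra.
rewrite -powR_mulrn ?powR_ge0 // -powRrM -[leLHS]powRr1; last by lra.
by apply: ler_powR; lra.
Qed.

(** A scale may be much larger than U, so a factor y is traded for a power of U
    with exponent ln y. *)
Lemma le_powU y : 1 <= y -> y <= U `^ ln y.
Proof.
move=> y1; have u0 : 0 < U by have := U26; lra.
rewrite -ler_ln ?posrE ?powR_gt0 //; last by lra.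
by rewrite ln_powR ler_peMr // ln_ge0.
Qed.

Lemma powU_gt0 y : 0 < U `^ y.
Proof. by apply: powR_gt0; have := U26; lra. Qed.

Lemma powUD y z : U `^ (y + z) = U `^ y * U `^ z.
Proof. by rewrite powRD //; apply/implyP => _; have := U26; lra. Qed.

Lemma ler_powU y z : y <= z -> U `^ y <= U `^ z.
Proof. by apply: ler_powR; have := U26; lra. Qed.

Lemma powU1 : U `^ 1 = U.
Proof. by rewrite powRr1 //; have := U26; lra. Qed.

Lemma window_margin (m : R) : m <= 4 * L `^ delta ->
  m * (16 * ((U `^ Rs 4%N)^-1) ^+ 2) <= (U `^ (- Rs 5%N) / 8) ^+ 2.
Proof.
move=> mL; have ed := conj d0 (conj de e100).
have L1 := scale_ge1 (leq0n 6); have r4 := scale_ge1 (isT : 4 <= 6)%N.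
have r6 := scale_ge1 (leqnn 6).
have x1 : 1024 * m <= (64 * Rs 6%N) ^+ 2.
  have : L `^ delta <= L by rewrite -[leRHS]powRr1; [apply: ler_powR; lra|lra].
  by have := scale_sqr; rewrite exprMn; lra.
have x2 : (64 * Rs 6%N) ^+ 2 <= expR (Rs 6%N / 2).
  have [_ h _ _ _] := scale_large (leqnn 6).
  have p6 : 0 < 64 * Rs 6%N by lra.
  rewrite -[leLHS]lnK ?posrE ?exprn_gt0 // ler_expR lnXn // lnM ?posrE //; last by lra.
  by rewrite mulr2n; lra.
have r45 : Rs 6%N / 2 <= Rs 4%N - Rs 5%N.
  have := scale_gap (isT : 4 <= 5)%N; have : 2 <= Rs 4%N `^ (2 * delta).
    have [_ _ h _ _] := scale_large (isT : 4 <= 6)%N.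
    apply: le_trans (_ : Rs 4%N `^ (delta / 2) <= _); last by apply: ler_powR; lra.
    apply: le_trans h; have : 0 <= (alpha + 2) * ln (Rs 4%N).
      by rewrite mulr_ge0 ?ln_ge0 //; have := al1; lra.
    by have : 0 <= K%:R :> R by []; have := al1; lra.
  have := scale_ge (isT : 4 <= 6)%N (leqnn 6).
  have := scale_ge (isT : 5 <= 6)%N (leqnn 6).
  move=> h1 h2 h3 h4.
  have : Rs 5%N * 2 <= Rs 5%N * Rs 4%N `^ (2 * delta) by rewrite ler_wpM2l //; lra.
  lra.
have x3 : expR (Rs 6%N / 2) <= U `^ (Rs 4%N - Rs 5%N).
  have u0 : 0 < U by have := U26; lra.
  rewrite -[leRHS]lnK ?posrE ?powU_gt0 // ler_expR ln_powR.
  by apply: (le_trans r45); rewrite ler_peMr //; lra.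
set y := U `^ Rs 4%N; set z := U `^ Rs 5%N.
have y0 : 0 < y := powU_gt0 _; have z0 : 0 < z := powU_gt0 _.
have yz : 1024 * m <= y / z.
  by rewrite -powRN -powUD; apply: le_trans x1 (le_trans x2 x3).
have zy : 1 <= y / z.
  rewrite -powRN -powUD; apply: powR_ge1; [have := U26; lra|lra].
rewrite powRN -/z !exprMn !exprVn; rewrite mulrA ler_pdivrMr ?exprn_gt0 //.
have : 1024 * m <= (y / z) ^+ 2.
  by apply: le_trans yz _; rewrite expr2 ler_peMl //; lra.
by rewrite exprMn exprVn; lra.
Qed.

Lemma scale_pow k : (k <= 6)%N ->
  (60 + 26 * K%:R + alpha) + (alpha + 2) * ln (Rs k) <= Rs k `^ (delta / 2).
Proof. by move=> /scale_large[]. Qed.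

Lemma scale_pow2 k : (k <= 6)%N -> Rs k `^ (delta / 2) <= Rs k `^ (2 * delta).
Proof. by move=> /scale_ge1 h; have d1 := d0; apply: ler_powR; lra. Qed.

(** The gaps between consecutive scales absorb L^delta: the m + 1 rungs of
    height 2 R_2 + 1 fit between R_5 and R_1. *)
Lemma ladder_fits (m : R) : m <= 4 * L `^ delta ->
  (m + 1) * (2 * Rs 2%N + 1) + Rs 5%N + 1 <= Rs 1%N.
Proof.
move=> mL; have ed := conj d0 (conj de e100); have a1 := al1.
have L1 := scale_ge1 (leq0n 6); have r2 := scale_ge1 (isT : 2 <= 6)%N.
have r1 := scale_ge1 (isT : 1 <= 6)%N.
have r52 := scale_ge (isT : 2 <= 5)%N isT.
have Ld : 1 <= L `^ delta by apply: powR_ge1; lra.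
have hp : 17 * L `^ delta <= Rs 1%N `^ (2 * delta).
  have /andP[h _] := step (isT : 0 <= 5)%N.
  apply: le_trans (_ : (L `^ (1 - 2^-1 * eps)) `^ (2 * delta) <= _); last first.
    by apply: ge0_ler_powR; rewrite ?nnegrE ?powR_ge0 //; lra.
  rewrite -powRrM; apply: le_trans (_ : L `^ (delta / 2 + delta) <= _); last first.
    apply: ler_powR; first lra.
    have : 0 <= delta * (1 - 2 * eps) by rewrite mulr_ge0 //; lra.
    lra.
  rewrite powRD; last by apply/implyP => _; lra.
  rewrite ler_wpM2r ?powR_ge0 //; apply: le_trans (scale_pow (leq0n 6)).
  have : 0 <= (alpha + 2) * ln L by rewrite mulr_ge0 ?ln_ge0 //; lra.
  have : 0 <= K%:R :> R by [].
  lra.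
have h1 : Rs 2%N * (17 * L `^ delta) <= Rs 1%N.
  apply: le_trans (scale_gap (isT : 1 <= 5)%N); rewrite ler_wpM2l //; lra.
have h2 : (m + 1) * (2 * Rs 2%N + 1) <= (5 * L `^ delta) * (3 * Rs 2%N).
  apply: (@le_trans _ _ ((5 * L `^ delta) * (2 * Rs 2%N + 1))).
    by rewrite ler_wpM2r //; lra.
  by rewrite ler_wpM2l //; lra.
have h3 : 2 * Rs 2%N <= (2 * Rs 2%N) * L `^ delta by rewrite ler_peMr //; lra.
lra.
Qed.

(** The radii of the annuli: each is U^(2 R_2 + 1) times the previous one, so
    that the squared size U^(-2 R_2) of a large entry is compensated with a
    factor U to spare. *)
Definition rung (k : nat) : R := U `^ (- Rs 1%N + k%:R * (2 * Rs 2%N + 1)).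

Lemma rung_gt0 k : 0 < rung k.
Proof. exact: powU_gt0. Qed.

Lemma rung0 : (rung 0)^-1 = U `^ Rs 1%N.
Proof. by rewrite /rung mul0r addr0 powRN invrK. Qed.

Lemma powU_le1 k : (k <= 6)%N -> U `^ (- Rs k) <= 1.
Proof.
move=> k6; rewrite powRN invf_le1 ?powU_gt0 //.
by apply: powR_ge1; [have := U26|have := scale_ge1 k6]; lra.
Qed.

Let peakE : (U `^ (- Rs 2%N)) ^+ 2 = U `^ (- (2 * Rs 2%N)).
Proof. by rewrite -powR_mulrn ?powR_ge0 // -powRrM; congr (_ `^ _); lra. Qed.

Lemma rungS k : rung k.+1 * (U `^ (- Rs 2%N)) ^+ 2 = rung k * U.
Proof.
rewrite peakE -[in RHS]powU1 -!powUD; congr (_ `^ _).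
by rewrite -[k.+1%:R]natr1; lra.
Qed.

Lemma rung_step k : 8 * rung k <= (rung k.+1 - rung k) * (U `^ (- Rs 2%N)) ^+ 2.
Proof.
rewrite mulrBl rungS.
have c1 : (U `^ (- Rs 2%N)) ^+ 2 <= 1 by rewrite exprn_ile1 ?powR_ge0 ?powU_le1.
have := ler_wpM2l (ltW (rung_gt0 k)) c1; rewrite mulr1.
have : 0 <= rung k * (U - 26) by rewrite mulr_ge0 ?(ltW (rung_gt0 k)) //; have := U26; lra.
have := rung_gt0 k; lra.
Qed.

Section Ladder.
Variable m : nat.
Hypothesis mL : m%:R <= 4 * L `^ delta.

Lemma rung_exponent k : (k <= m)%N ->
  (k%:R + 1) * (2 * Rs 2%N + 1) + Rs 5%N + 1 <= Rs 1%N.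
Proof.
move=> km; apply: le_trans (ladder_fits mL); rewrite !lerD2r ler_wpM2r //.
  by have := scale_ge1 (isT : 2 <= 6)%N; lra.
by rewrite lerD2r ler_nat.
Qed.

Lemma rung_barrier k : (k <= m)%N -> 8 * rung k <= U * (U `^ (- Rs 2%N)) ^+ 2.
Proof.
move=> km; rewrite peakE.
apply: (@le_trans _ _ (8 * U `^ (- (2 * Rs 2%N)))).
  rewrite ler_wpM2l //; apply: ler_powU; have := rung_exponent km.
  by have := scale_ge1 (isT : 5 <= 6)%N; lra.
by rewrite ler_wpM2r ?powR_ge0 //; have := U26; lra.
Qed.

Lemma rung_top : rung m.+1 <= U `^ (- Rs 5%N) / 4.
Proof.
rewrite [leRHS]mulrC; apply: (@le_trans _ _ (U `^ (- 1 - Rs 5%N))).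
  by apply: ler_powU; have := rung_exponent (leqnn m); rewrite -[m.+1%:R]natr1; lra.
rewrite powUD ler_wpM2r ?powR_ge0 // powRN powU1.
by have u1 := U26; rewrite lef_pV2 ?posrE; lra.
Qed.

End Ladder.

Section Radii.
Variables (rho h3 H : nat).
Hypotheses (rho6 : 2 * rho%:R <= Rs 6%N - 1 :> R) (h33 : 2 * h3%:R <= Rs 3%N - 1 :> R).
Hypotheses (HL : 2 * H%:R <= L - 1 :> R) (LH : L - 1 < 2 * H%:R + 2 :> R).

Lemma box_margin : (K.+2 * (4 * rho + 2 * h3 + 5) <= H)%N.
Proof.
have a1 := al1; have L1 := scale_ge1 (leq0n 6).
have r6 := scale_ge1 (leqnn 6); have r36 := scale_ge (isT : 3 <= 6)%N (leqnn 6).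
have r13 := scale_ge (isT : 1 <= 3)%N isT.
have K0 : 0 <= K%:R :> R by [].
have hp : 16 * (K%:R + 2) <= L `^ (2 * delta).
  apply: le_trans (scale_pow2 (leq0n 6)); apply: le_trans (scale_pow (leq0n 6)).
  have : 0 <= (alpha + 2) * ln L by rewrite mulr_ge0 ?ln_ge0 //; lra.
  lra.
have h1 : Rs 3%N * (16 * (K%:R + 2)) <= L.
  apply: le_trans (scale_gap (leq0n 5)); apply: (@le_trans _ _ (Rs 1%N * (16 * (K%:R + 2)))).
    by rewrite ler_wpM2r //; lra.
  by rewrite ler_wpM2l //; lra.
rewrite -(ler_nat R) natrM (natrD _ (4 * rho + 2 * h3)) (natrD _ (4 * rho)) !natrM.
have -> : K.+2%:R = K%:R + 2 :> R by rewrite -addn2 natrD.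
apply: (@le_trans _ _ ((K%:R + 2) * (4 * Rs 3%N))).
  by have q6 := rho6; have q3 := h33; rewrite ler_wpM2l //; lra.
by have := LH; lra.
Qed.

Lemma ell_bounds : Rs 6%N - 1 < 2 * rho%:R + 2 -> let l : R := 2 * rho%:R in
  [/\ 1 <= l, l <= Rs 6%N, Rs 6%N - 3 <= l & alpha <= l].
Proof. by have := rho6; have := scale_1000 (leqnn 6); have := al1; split; lra. Qed.

Variable l : R.
Hypotheses (l1 : 1 <= l) (l6 : l <= Rs 6%N).

Lemma continuation_factor : (l * U) `^ (alpha * l) <= U `^ (alpha * Rs 6%N * (1 + ln (Rs 6%N))).
Proof.
have a1 := al1; have ll1 := l1; have ll6 := l6; have u1 := U26.
have h1 : l * U <= U `^ (1 + ln (Rs 6%N)).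
  rewrite powUD powU1 mulrC ler_wpM2l //; first lra.
  by apply: le_trans (le_powU l1) (ler_powU _); rewrite ler_ln ?posrE //; lra.
apply: (@le_trans _ _ ((U `^ (1 + ln (Rs 6%N))) `^ (alpha * l))).
  apply: ge0_ler_powR; rewrite ?nnegrE ?powR_ge0 ?mulr_ge0 //; lra.
rewrite -powRrM; apply: ler_powU; rewrite mulrC; apply: ler_wpM2r.
  by apply: addr_ge0 => //; apply: ln_ge0; lra.
by rewrite ler_wpM2l //; lra.
Qed.

(** The exponents of U that are lost in transporting and continuing an
    eigenvector sum up to less than R_2. *)
Lemma continuation_budget :
  alpha * Rs 6%N * (1 + ln (Rs 6%N)) + ln L + 10 * (K%:R + 1) * Rs 3%N + 1 <= Rs 2%N.
Proof.
have a1 := al1; have L1 := scale_ge1 (leq0n 6).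
have r6 := scale_ge1 (leqnn 6); have r36 := scale_ge (isT : 3 <= 6)%N (leqnn 6).
have r23 := scale_ge (isT : 2 <= 3)%N isT.
have K0 : 0 <= K%:R :> R by [].
have lnL : ln L <= 2 * ln (Rs 6%N).
  have -> : 2 * ln (Rs 6%N) = ln (Rs 6%N ^+ 2) by rewrite lnXn ?mulr_natl //; lra.
  by rewrite ler_ln ?posrE ?exprn_gt0 ?scale_sqr //; lra.
have ln62 : ln (Rs 6%N) <= ln (Rs 2%N) by rewrite ler_ln ?posrE //; lra.
have ln6 : 0 <= ln (Rs 6%N) by apply: ln_ge0; lra.
have hp := le_trans (scale_pow (isT : 2 <= 6)%N) (scale_pow2 (isT : 2 <= 6)%N).
have h1 := scale_gap (isT : 2 <= 5)%N.
set y := ln (Rs 2%N) in hp ln62; set z := ln (Rs 6%N) in lnL ln62 ln6 *.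
have h2 : Rs 3%N * (alpha * (1 + y) + 2 * y + 10 * (K%:R + 1) + 1) <= Rs 2%N.
  apply: le_trans h1; rewrite ler_wpM2l //; first lra.
  by apply: le_trans hp; lra.
have h3' : alpha * Rs 6%N * (1 + z) <= alpha * Rs 3%N * (1 + y).
  by apply: ler_pM => //; rewrite ?mulr_ge0 ?ler_wpM2l //; lra.
have h4 : 2 * z <= Rs 3%N * (2 * y).
  by apply: le_trans (_ : 2 * y <= _); rewrite ?ler_peMl //; lra.
lra.
Qed.

Lemma continuation_window : U `^ (- Rs 1%N) <= (l * U) `^ (- (alpha * l)).
Proof.
have a1 := al1; have ll1 := l1; have u1 := U26.
rewrite !powRN lef_pV2 ?posrE ?powU_gt0 ?powR_gt0 ?mulr_gt0 //; try lra.
apply: le_trans continuation_factor (ler_powU _).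
have := continuation_budget; have L1 := scale_ge1 (leq0n 6).
have : 0 <= ln L by apply: ln_ge0; lra.
have : 0 <= 10 * (K%:R + 1) * Rs 3%N.
  have r3 := scale_ge1 (isT : 3 <= 6)%N; have K0 : 0 <= K%:R :> R by [].
  by apply: mulr_ge0; lra.
have := scale_ge (isT : 1 <= 2)%N isT.
lra.
Qed.

Lemma continuation_small : U `^ (- Rs 2%N) * (l * U) `^ (alpha * l) <
  (H.*2.+1)%:R^-1 / (U + 8) ^+ (K.+1 * (4 * rho + 2 * h3 + 5) + rho).
Proof.
set t := (_ + rho)%N; have u1 := U26; have L1 := scale_ge1 (leq0n 6).
have H0 : 0 < (H.*2.+1)%:R :> R by rewrite ltr0n.
have HL' : (H.*2.+1)%:R <= L.
  by rewrite natr_double_succ; have := HL; lra.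
have U80 : 0 < U + 8 by lra.
have hU : U + 8 <= U `^ 2.
  rewrite powR_mulrn; last lra.
  have : 0 <= (U - 26) * U by rewrite mulr_ge0; lra.
  by rewrite expr2; lra.
have ht : t%:R <= 5 * (K%:R + 1) * Rs 3%N.
  have r6 := scale_ge1 (leqnn 6); have r36 := scale_ge (isT : 3 <= 6)%N (leqnn 6).
  rewrite /t natrD natrM (natrD _ (4 * rho + 2 * h3)) (natrD _ (4 * rho)) !natrM -(addn1 K) natrD.
  have K0 : 0 <= K%:R :> R by [].
  have h1 : (K%:R + 1) * (4 * rho%:R + 2 * h3%:R + 5) <= (K%:R + 1) * (4 * Rs 3%N).
    by have q6 := rho6; have q3 := h33; rewrite ler_wpM2l //; lra.
  have : 0 <= K%:R * Rs 3%N by rewrite mulr_ge0 //; lra.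
  by have := rho6; lra.
have hP : (U + 8) ^+ t <= U `^ (2 * t%:R).
  rewrite powRrM powR_mulrn ?powR_ge0 //; apply: lerXn2r => //; rewrite nnegrE ?powR_ge0 //; lra.
rewrite -invfM -[ltRHS]mul1r ltr_pdivlMr ?mulr_gt0 ?exprn_gt0 //.
apply: (@le_lt_trans _ _ (U `^ (- Rs 2%N) * U `^ (alpha * Rs 6%N * (1 + ln (Rs 6%N))) *
   (U `^ ln L * U `^ (2 * t%:R)))).
  apply: ler_pM; rewrite ?mulr_ge0 ?powR_ge0 ?exprn_ge0 ?(ltW H0) ?(ltW U80) //.
    by rewrite ler_wpM2l ?powR_ge0 ?continuation_factor.
  rewrite ler_pM ?exprn_ge0 ?(ltW H0) ?(ltW U80) //.
  by apply: le_trans HL' (le_powU _); lra.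
rewrite -!powUD; apply: (@le_lt_trans _ _ (U `^ (- 1))).
  by apply: ler_powU; have := continuation_budget; lra.
by rewrite powRN powU1 invf_lt1; lra.
Qed.

End Radii.
Lemma log_factor_le k (y : R) : (k <= 6)%N -> 0 <= y -> y <= log_factor ->
  (y * ln (Rs k)) <= Rs k `^ (1 / 10).
Proof.
move=> k6 y0 yl; have [_ _ _ _ h] := scale_large k6; rewrite add0r in h.
apply: le_trans h; rewrite ler_wpM2r // ln_ge0 //.
by have := scale_ge1 k6; lra.
Qed.

Lemma log_factor_ge :
  [/\ 1 <= log_factor, 54 ^+ 2 / (kap * c2 ^+ 4) <= log_factor & 16 / (c2 ^+ 2 * kap) <= log_factor].
Proof.
have h1 : 0 <= 54 ^+ 2 / (kap * c2 ^+ 4) by rewrite divr_ge0 ?exprn_ge0 ?ler0n // mulr_ge0 ?exprn_ge0 ?ltW.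
have h2 : 0 <= 16 / (c2 ^+ 2 * kap) by rewrite divr_ge0 // mulr_ge0 ?exprn_ge0 ?ltW.
by rewrite /log_factor; split; move: h1 h2; set a := 54 ^+ 2 / _; set b := 16 / _; lra.
Qed.

Section Failure.
Variables (rho H O m g : nat) (r l : R).
Hypotheses (rho6 : Rs 6%N - 1 < 2 * rho%:R + 2 :> R) (HL : 2 * H%:R <= L - 1 :> R).
Hypotheses (O0 : (0 < O)%N) (Or : O%:R <= r ^+ 2) (r0 : 0 <= r) (rc : c2 * r <= ln (Rs 6%N)).

Lemma offsets_log : c2 ^+ 2 * O%:R <= ln (Rs 6%N) ^+ 2.
Proof.
apply: (@le_trans _ _ ((c2 * r) ^+ 2)); first by rewrite exprMn ler_wpM2l // exprn_ge0 // ltW.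
by rewrite lerXn2r // nnegrE ?mulr_ge0 ?(ltW c20) // ln_ge0 //; have := scale_ge1 (leqnn 6); lra.
Qed.

(** Half the share of one offset when a fraction kap of the sites of a box of
    length R_6 is divided among O offsets. *)
Definition peak_number : nat := Num.truncn (kap * ((rho.*2.+1 ^ 2)%N)%:R / (2 * O%:R)).

Lemma peak_number_le : (2 * peak_number * O)%:R <= kap * ((rho.*2.+1 ^ 2)%N)%:R :> R.
Proof.
have O1 : 0 < O%:R :> R by rewrite ltr0n.
have y0 : 0 <= kap * ((rho.*2.+1 ^ 2)%N)%:R / (2 * O%:R).
  by rewrite divr_ge0 ?mulr_ge0 ?(ltW kap0) // ltW.
have /andP[h _] := truncn_itv y0; rewrite ler_pdivlMr ?mulr_gt0 // in h.
rewrite (natrM _ (2 * peak_number)) (natrM _ 2); apply: le_trans h.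
by rewrite -mulrA mulrCA.
Qed.

Lemma peak_number_ge : kap * Rs 6%N ^+ 2 <= peak_number%:R * (16 * O%:R).
Proof.
have O1 : 0 < O%:R :> R by rewrite ltr0n.
have r6 := scale_ge1 (leqnn 6).
set y := kap * ((rho.*2.+1 ^ 2)%N)%:R / (2 * O%:R).
have k0 := kap0; have y0 : 0 <= y by rewrite divr_ge0 ?mulr_ge0 // ltW.
have yO : y * (8 * O%:R) = 4 * (kap * ((rho.*2.+1 ^ 2)%N)%:R) by rewrite /y; field; lra.
have h1 : kap * Rs 6%N ^+ 2 <= y * (8 * O%:R).
  have nx : ((rho.*2.+1 ^ 2)%N)%:R = (rho.*2.+1)%:R ^+ 2 :> R by rewrite natrX.
  rewrite yO nx [leRHS]mulrCA ler_wpM2l ?(ltW k0) //.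
  apply: (@le_trans _ _ ((2 * (rho.*2.+1)%:R) ^+ 2)); last by rewrite exprMn; lra.
  apply: lerXn2r; rewrite ?nnegrE; [lra|by rewrite mulr_ge0|].
  by rewrite natr_double_succ; have := rho6; lra.
have /andP[_ h2] := truncn_itv y0; rewrite -/peak_number -addn1 natrD in h2.
have h3 : 16 * O%:R <= kap * Rs 6%N ^+ 2.
  have [l1 _ l2] := log_factor_ge.
  have c2' := exprn_gt0 2 c20.
  have h := log_factor_le (leqnn 6) ler01 l1; rewrite mul1r in h.
  have ln6 : 0 <= ln (Rs 6%N) by apply: ln_ge0; lra.
  have hl : log_factor * ln (Rs 6%N) <= Rs 6%N.
    apply: le_trans (log_factor_le (leqnn 6) (le_trans ler01 l1) (lexx _)) _.
    by rewrite -[leRHS]powRr1; [apply: ler_powR; lra | lra].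
  have hh : 16 / (c2 ^+ 2 * kap) * ln (Rs 6%N) ^+ 2 <= Rs 6%N ^+ 2.
    apply: (@le_trans _ _ ((log_factor * ln (Rs 6%N)) ^+ 2)).
      rewrite exprMn ler_wpM2r ?exprn_ge0 //; apply: le_trans l2 _.
      by rewrite expr2 ler_peMl //; lra.
    by rewrite lerXn2r // nnegrE ?mulr_ge0 //; lra.
  apply: le_trans (_ : kap * (16 / (c2 ^+ 2 * kap) * ln (Rs 6%N) ^+ 2) <= _); last first.
    by rewrite ler_wpM2l // ltW.
  have -> : kap * (16 / (c2 ^+ 2 * kap) * ln (Rs 6%N) ^+ 2) = 16 * (ln (Rs 6%N) ^+ 2 / c2 ^+ 2).
    by field; rewrite !gt_eqF.
  by rewrite ler_wpM2l // ler_pdivlMr // mulrC offsets_log.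
have y2 : 2 <= y.
  have O8 : 0 < 8 * O%:R :> R by lra.
  by rewrite -(ler_pM2r O8); lra.
have : 0 <= (2 * peak_number%:R - y) * (8 * O%:R) by rewrite mulr_ge0 //; lra.
lra.
Qed.

Lemma peak_number_gt0 : (0 < peak_number)%N.
Proof.
rewrite lt0n; apply/eqP => p0; have := peak_number_ge; rewrite p0 mul0r leNgt => /negP; apply.
by rewrite mulr_gt0 // exprn_gt0 //; have := scale_ge1 (leqnn 6); lra.
Qed.

Hypotheses (mL : m%:R <= 4 * L `^ delta) (lge : Rs 6%N - 3 <= l).

Lemma continuation_failures :
  (H.*2.+1 ^ 2)%:R * expR (- (e * l `^ (2 / 3))) <= 2^-1 * L `^ (- 2^-1).
Proof.
have r6 := scale_ge1 (leqnn 6); have L1 := scale_ge1 (leq0n 6); have l3 := lge.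
have half : 0 <= 2^-1 :> R by lra.
have HL' : (H.*2.+1 ^ 2)%:R <= (Rs 6%N ^+ 2) ^+ 2.
  rewrite natrX lerXn2r ?nnegrE ?exprn_ge0 //; [lra|apply: le_trans scale_sqr].
  by rewrite natr_double_succ; have := HL; lra.
have sL : L `^ 2^-1 <= Rs 6%N.
  apply: (@le_trans _ _ ((Rs 6%N ^+ 2) `^ 2^-1)).
    by apply: ge0_ler_powR; rewrite ?nnegrE ?exprn_ge0 ?scale_sqr //; lra.
  by rewrite powR12_sqrt ?exprn_ge0 ?sqrtr_sqr ?ger0_norm //; lra.
have sl : Rs 6%N `^ 2^-1 <= 2 * l `^ (2 / 3).
  apply: (@le_trans _ _ (2 * l `^ 2^-1)); last first.
    by rewrite ler_wpM2l //; apply: ler_powR; lra.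
  apply: (@le_trans _ _ ((2 ^+ 2 * l) `^ 2^-1)).
    by apply: ge0_ler_powR; rewrite ?nnegrE //; lra.
  rewrite powRM ?exprn_ge0 //; last lra.
  by rewrite (powR12_sqrt (a := 2 ^+ 2)) ?exprn_ge0 // sqrtr_sqr ger0_norm.
have hE : expR (- (e * l `^ (2 / 3))) <= (4 * Rs 6%N ^+ 5)^-1.
  have p0 : 0 < 4 * Rs 6%N ^+ 5 by rewrite mulr_gt0 // exprn_gt0 //; lra.
  rewrite expRN lef_pV2 ?posrE ?expR_gt0 // -[leLHS]lnK ?posrE // ler_expR.
  rewrite lnM ?posrE ?exprn_gt0 //; try lra; rewrite lnXn; last lra.
  have [_ _ _ h _] := scale_large (leqnn 6).
  have := le_trans h sl.
  have -> : 2 / e * ln 4 + 2 / e * 5 * ln (Rs 6%N) = 2 * ((ln 4 + 5 * ln (Rs 6%N)) / e).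
    by field; rewrite gt_eqF.
  rewrite ler_pM2l // ler_pdivrMr // (mulrC _ e) => h'.
  by rewrite -[ln (Rs 6%N) *+ 5]mulr_natl.
have Lh0 : 0 < L `^ 2^-1 by apply: powR_gt0; lra.
rewrite powRN ler_pdivlMr //.
apply: (@le_trans _ _ ((Rs 6%N ^+ 2) ^+ 2 * (4 * Rs 6%N ^+ 5)^-1 * Rs 6%N)).
  by rewrite ler_pM ?mulr_ge0 ?expR_ge0 ?(ltW Lh0) // ler_pM ?expR_ge0.
have -> : (Rs 6%N ^+ 2) ^+ 2 * (4 * Rs 6%N ^+ 5)^-1 * Rs 6%N = 4^-1.
  by field; lra.
lra.
Qed.

(** With g of order R_6^2 / O and O at most of order (ln L)^2, the left side is
    at most L^(-1 + 8 eps) up to logarithms, and R_6 is at least L^(1 - 3 eps).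
    *)
Lemma resonance_failures :
  O%:R * ((2 * m.+1 * (2 * m).+1 * H.*2.+1)%:R / peak_number%:R) <= 2^-1 * L `^ (- 2^-1).
Proof.
have r6 := scale_ge1 (leqnn 6); have L1 := scale_ge1 (leq0n 6); have ed := conj d0 (conj de e100).
have O1 : 0 < O%:R :> R by rewrite ltr0n.
have p0 : 0 < peak_number%:R :> R by rewrite ltr0n peak_number_gt0.
have Ld : 1 <= L `^ delta by apply: powR_ge1; lra.
have mL' := mL; set D := L `^ delta in mL' Ld.
have hb : (2 * m.+1 * (2 * m).+1 * H.*2.+1)%:R <= 90 * (D * D) * L.
  rewrite !natrM ler_pM ?mulr_ge0 //; last first.
    by rewrite natr_double_succ; have := HL; lra.
  have -> : 90 * (D * D) = 2 * (5 * D) * (9 * D) by ring.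
  rewrite ler_pM ?mulr_ge0 //; first rewrite ler_wpM2l //.
    by rewrite -addn1 natrD; lra.
  by rewrite -addn1 natrD natrM; lra.
rewrite mulrA ler_pdivrMr //.
apply: (@le_trans _ _ (O%:R * (90 * (D * D) * L))); first by rewrite ler_pM2l.
have hO : 54 ^+ 2 * O%:R ^+ 2 <= kap * L `^ (4 / 10).
  have [l1 l2 _] := log_factor_ge.
  have h := log_factor_le (leq0n 6) (le_trans ler01 l1) (lexx _).
  have lnL : 0 <= ln L by apply: ln_ge0; lra.
  have c4 := exprn_gt0 4 c20.
  have h1 : 54 ^+ 2 / (kap * c2 ^+ 4) * ln L ^+ 4 <= L `^ (4 / 10).
    have -> : L `^ (4 / 10) = (L `^ (1 / 10)) ^+ 4.
      by rewrite -powR_mulrn ?powR_ge0 // -powRrM; congr (_ `^ _); lra.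
    apply: (@le_trans _ _ ((log_factor * ln L) ^+ 4)); last first.
      by rewrite lerXn2r // nnegrE ?mulr_ge0 ?powR_ge0 //; lra.
    rewrite exprMn ler_wpM2r ?exprn_ge0 //; apply: le_trans l2 _.
    by rewrite exprS ler_peMr ?exprn_ege1 //; lra.
  have h2 : c2 ^+ 4 * O%:R ^+ 2 <= ln L ^+ 4.
    rewrite (_ : c2 ^+ 4 * _ = (c2 ^+ 2 * O%:R) ^+ 2); last by ring.
    rewrite (_ : ln L ^+ 4 = (ln L ^+ 2) ^+ 2); last by ring.
    rewrite lerXn2r // ?nnegrE ?mulr_ge0 ?exprn_ge0 ?(ltW c20) //.
    apply: le_trans offsets_log _; rewrite lerXn2r // ?nnegrE //.
      by apply: ln_ge0; lra.
    by rewrite ler_ln ?posrE ?(scale_ge (leq0n 6)) //; lra.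
  have -> : 54 ^+ 2 * O%:R ^+ 2 = kap * (54 ^+ 2 / (kap * c2 ^+ 4) * (c2 ^+ 4 * O%:R ^+ 2)).
    by field; rewrite !gt_eqF.
  rewrite ler_wpM2l ?(ltW kap0) //; apply: le_trans h1.
  by rewrite ler_wpM2l // divr_ge0 ?exprn_ge0 // mulr_ge0 ?(ltW kap0) ?(ltW c4).
have hP : L `^ (4 / 10) * (D * D) * L <= L `^ (- 2^-1) * Rs 6%N ^+ 2.
  apply: (@le_trans _ _ (L `^ (- 2^-1) * (L `^ (1 - 3 * eps)) ^+ 2)); last first.
    rewrite ler_wpM2l ?powR_ge0 // lerXn2r ?nnegrE ?powR_ge0 ?scale_lower //; lra.
  rewrite -[X in _ * X <= _]powRr1; last lra.
  have Lm x y : L `^ x * L `^ y = L `^ (x + y).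
    by rewrite powRD //; apply/implyP => _; lra.
  by rewrite expr2 /D !Lm; apply: ler_powR; lra.
have hg := peak_number_ge.
have W0 : 0 < L `^ (- 2^-1) by apply: powR_gt0; lra.
set W := L `^ (- 2^-1) in hP W0 *; set P := peak_number%:R in hg p0 *.
set Z := L `^ (4 / 10) in hO hP.
have D0 : 0 <= D * D * L by rewrite !mulr_ge0 //; lra.
have hA : 54 ^+ 2 * O%:R ^+ 2 * (D * D * L) <= W * (P * (16 * O%:R)).
  apply: (@le_trans _ _ (kap * Z * (D * D * L))); first by rewrite ler_wpM2r.
  apply: (@le_trans _ _ (W * (kap * Rs 6%N ^+ 2))); last by rewrite ler_wpM2l // ltW.
  have -> : kap * Z * (D * D * L) = kap * (Z * (D * D) * L) by ring.
  by rewrite [leRHS]mulrCA ler_wpM2l ?(ltW kap0).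
rewrite -(ler_pM2r (_ : 0 < 32 * O%:R)); last lra.
move: hA (mulr_ge0 (exprn_ge0 2 (ltW O1)) D0).
by set DL := D * D * L; rewrite (_ : 90 * (D * D) * L = 90 * DL) /DL; [lra|ring].
Qed.

Lemma failure_bound :
  (H.*2.+1 ^ 2)%:R * expR (- (e * l `^ (2 / 3))) +
  O%:R * ((2 * m.+1 * (2 * m).+1 * H.*2.+1)%:R / peak_number%:R) <= L `^ (10 * eps - 1 / 2).
Proof.
have L1 := scale_ge1 (leq0n 6); have ed := conj d0 (conj de e100).
apply: (@le_trans _ _ (L `^ (- 2^-1))); last by apply: ler_powR; lra.
have := continuation_failures; have := resonance_failures; lra.
Qed.

End Failure.
End Scales.

Local Open Scope classical_set_scope.
Local Open Scope ring_scope.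

(** * The resolvent bound *)

Lemma cutH_sym (R : realType) (eps0 : R) r Q V Rb t :
  (cutH eps0 r Q V Rb t)^T = cutH eps0 r Q V Rb t.
Proof.
apply/matrixP => i j; rewrite !mxE /cut_kernel setUC; case: ifP => // _.
by rewrite /kernelH eq_sym adj_sym; case: eqP => // ->.
Qed.

Lemma admissible_ext (R : realType) (eps0 : R) r V1 V2 a :
  (forall x, frame eps0 r a x -> V1 x = V2 x) ->
  admissible eps0 r V1 a -> admissible eps0 r V2 a.
Proof.
move=> V12; suff -> : admissible eps0 r V1 a = admissible eps0 r V2 a by [].
rewrite /admissible; have -> // : frame eps0 r a `&` zeros V1 = frame eps0 r a `&` zeros V2.
by apply/seteqP; split=> x [fx]; rewrite /zeros /= (V12 _ fx, =^~ V12 _ fx) => Vx; split.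
Qed.

Lemma half_floor (R : realType) (l : R) : 1 <= l -> exists h : nat,
  [/\ Num.floor ((l - 1) / 2) = h%:Z, 2 * h%:R <= l - 1 & l - 1 < 2 * h%:R + 2].
Proof.
move=> l1; have f0 : 0 <= Num.floor ((l - 1) / 2) by rewrite floor_ge_int mulr0z; lra.
have [h hE] : exists h : nat, Num.floor ((l - 1) / 2) = h%:Z.
  by exists `|Num.floor ((l - 1) / 2)|%N; rewrite gez0_abs.
exists h; have := floor_itv ((l - 1) / 2); rewrite hE intrD mulr1z => /andP[h1 h2].
by rewrite -[h%:~R]/(h%:R) in h1 h2; split=> //; lra.
Qed.

Lemma dyadic_half (R : realType) (eps0 : R) r (L : R) a (hr : int) (h : nat) :
  hr = Num.floor ((r%:R - 1 : R) / 2) -> dyadic_box eps0 r L a ->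
  Num.floor ((L - 1) / 2) = h%:Z ->
  exists N, lattice (N * rdot eps0 r) a /\ h%:Z = N * rdot eps0 r + hr.
Proof.
move=> hrE [k [_ lat LE]] <-; exists (2 ^+ k); split=> //.
by rewrite LE -(dyadic_floor _ _ hrE) exprS.
Qed.

Lemma localized (R : realType) S (E G : set site) (u : 'rV[R]_(num_sites S)) (y b : R) :
  0 < y -> 0 <= b <= 1 -> y * l2norm_on E u^T <= l2norm u^T ->
  l2norm u^T <= (1 + b) * l2norm_on G u^T ->
  norm2_on E u <= (y^-1) ^+ 2 * dotr u u /\ dotr u u <= 4 * norm2_on G u.
Proof.
move=> y0 /andP[b0 b1]; rewrite !l2norm_on_trmx l2norm_trmx => hE hG.
have n0 F : 0 <= norm2_on F u by apply: sumr_ge0 => i _; exact: sqr_ge0.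
have s4 : 2 = Num.sqrt 4 :> R by rewrite (_ : 4 = 2 ^+ 2) ?sqrtr_sqr ?ger0_norm //; ring.
split.
  have h : Num.sqrt (norm2_on E u) <= Num.sqrt ((y^-1) ^+ 2 * dotr u u).
    rewrite sqrtrM ?exprn_ge0 ?invr_ge0 ?(ltW y0) // sqrtr_sqr ger0_norm ?invr_ge0 ?(ltW y0) //.
    by rewrite ler_pdivlMl.
  by rewrite ler_sqrt // in h; rewrite mulr_ge0 ?dotr_ge0 // exprn_ge0 // invr_ge0 ltW.
have h : Num.sqrt (dotr u u) <= Num.sqrt (4 * norm2_on G u).
  rewrite sqrtrM // -s4; apply: le_trans hG _; rewrite ler_wpM2r ?sqrtr_ge0 //; lra.
by rewrite ler_sqrt // in h; rewrite mulr_ge0.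
Qed.

Lemma offsets_bound (R : realType) (eps0 : R) r : 0 < eps0 -> eps0 < 1 / 100 -> 16 <= eps0 * r%:R ->
  let O := num_sites (ibox (Num.floor (((1 - 2 * eps0) * r%:R - 1) / 2)) (0, 0)) in
  (0 < O)%N /\ O%:R <= r%:R ^+ 2 :> R.
Proof.
move=> e0 e1 er.
have l1 : 1 <= (1 - 2 * eps0) * r%:R.
  have r0 : 0 <= r%:R :> R by [].
  have : eps0 * r%:R <= 1 / 100 * r%:R by rewrite ler_wpM2r // ltW.
  lra.
have [h [-> h1 _]] := half_floor l1.
rewrite /= num_sites_ibox expn_gt0; split=> //.
have le_r : (h.*2.+1)%:R <= r%:R :> R.
  have : 0 <= eps0 * r%:R by lra.
  by rewrite natr_double_succ; lra.
by rewrite natrX lerXn2r // nnegrE.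
Qed.

Theorem proposition3p18 (R : realType) (eps1 eps0 c2 : R)
  (heps1 : 0 < eps1 < 1 / 100) (huc : unique_continuation eps1)
  (heps0 : 0 < eps0 < eps1 ^+ 10) (hc2 : 0 < c2) :
  exists2 eps_star : R, 0 < eps_star &
  forall eps delta : R, 0 < delta -> delta < eps -> eps < eps_star ->
  forall K : nat, (1 <= K)%N ->
  exists C : R,
  forall (r : nat) (Vbar lambda0 : R) (Rs : nat -> R) (a0 : site)
    (q : 'I_K -> site) (G Theta D : set site) (V' : site -> R),
  let Q := box (Rs 0%N) a0 in
  let Qs := \bigcup_(k in [set: 'I_K]) box (Rs 3%N) (q k) in
  (* (2) *)
  odd r -> C < r%:R -> expR (r%:R ^+ 2) < Vbar ->
  (* (3) *)
  0 <= lambda0 <= 8 -> ~ Jset r Vbar lambda0 ->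
  (* (4) *)
  (forall k : nat, (k <= 5)%N -> Rs k.+1 <= Rs k) -> expR (c2 * r%:R) <= Rs 6%N ->
  (forall k : nat, (k <= 5)%N ->
     Rs k `^ (1 - 2^-1 * eps) <= Rs k.+1 <= Rs k `^ (1 - 2 * delta)) ->
  dyadic_scale eps0 r (Rs 0%N) -> dyadic_scale eps0 r (Rs 3%N) ->
  (* (5) *)
  dyadic_box eps0 r (Rs 0%N) a0 ->
  (* (6) *)
  (forall k, dyadic_box eps0 r (Rs 3%N) (q k) /\ box (Rs 3%N) (q k) `<=` Q) ->
  (* (7) *)
  G `<=` Qs -> (0 < num_sites G)%N -> (num_sites G)%:R <= Rs 0%N `^ delta ->
  (* (8) *)
  Theta `<=` Q -> D `<=` lattice (rdot eps0 r) `&` Q ->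
  Q `\` Theta = \bigcup_(b in D) Omega eps0 r b ->
  (* (9) *)
  (forall a : site, box (Rs 6%N) a `<=` Q `\` Qs ->
     regular (eps0 `^ (1 / 5)) Theta (box (Rs 6%N) a)) ->
  (* (10) *)
  two_valued Vbar Theta V' ->
  (forall (V : site -> R) (lambda t : R) (Rb : set site),
     two_valued Vbar Q V -> (forall x, Theta x -> V x = V' x) ->
     lambda0 - Vbar `^ (- Rs 5%N) <= lambda <= lambda0 + Vbar `^ (- Rs 5%N) ->
     0 <= t <= 1 ->
     (forall b, Rb b -> [/\ lattice (rdot eps0 r) b, box (r%:R : R) b `<=` Q
                          & Omega eps0 r b `&` (Theta `|` Qs) = set0]) ->
     (forall b, Rb b -> admissible eps0 r V b) /\
     (forall u : 'cV[R]_(num_sites Q),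
        cutH eps0 r Q V Rb t *m u = lambda *: u ->
        Vbar `^ (Rs 4%N) * l2norm_on (Q `\` Qs) u <= l2norm u /\
        l2norm u <= (1 + Rs 0%N `^ (- delta)) * l2norm_on G u)) ->
  (* conclusion *)
  forall (d : measure_display) (T : measurableType d) (P : probability T R)
    (V : site -> {RV P >-> R}),
  iid_potential Vbar V ->
  1 - Rs 0%N `^ (10 * eps - 1 / 2) <=
  cond_prob P
    [set w | resolvent_le (dirichletH Q (fun x => V x w)) lambda0 (Vbar `^ (Rs 1%N))]
    [set w | forall x, Theta x -> V x w = V' x].

Proof.
have [p0 _] := andP heps0; have [eps_lt e0 e_le e1] := fifth_root heps1 heps0.
set e := eps0 `^ (1 / 5) in e0 e_le e1 *.
(* The continuation property is used at the regularity constant of Theta. *)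
have [alpha a1 uc] := huc e e0 e_le.
pose kap := e ^+ 3 * (1 - e).
have kap0 : 0 < kap by rewrite mulr_gt0 ?exprn_gt0 // subr_gt0.
(* The exponents in the final estimate leave room as long as 8 eps <= 1/10. *)
exists (1 / 100) => [|eps delta d0 de e100 K K1]; first lra.
have [M M1 big] := large_eventually e c2 kap K d0 a1.
(* The three terms make R_6 large, leave room for rounding the radii of a bit, and
   give Vbar > exp 25. *)
exists (M / c2 + 16 / eps0 + 5) => r Vbar lambda0 Rs a0 q G Theta D V' Q Qs.
move=> _ rC rV l08 _ mono R6c step _ _ dyQ dyq GQs G0 GL ThetaQ DQ QTheta reg V'2 loc.
move=> d T P V iidV.
have [re rM U26 lnU rc] := threshold hc2 p0 M1 rC rV R6c.
have {}big x : Rs 6%N <= x -> large delta alpha e c2 kap K x.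
  by move=> h; apply: big; apply: le_trans h.
have U0 : 0 < Vbar := lt_le_trans (ltr0n _ 26) U26.
have Vn0 : Vbar != 0 := lt0r_neq0 U0.
have [hO0 hOT hTr hTrd] := radii_facts p0 eps_lt re erefl erefl erefl.
have [off0 Or] := offsets_bound p0 eps_lt re.
set hO := Num.floor (((1 - 2 * eps0) * r%:R - 1) / 2) in hO0 hOT off0 Or.
set hT := Num.floor (((1 - 3 / 2 * eps0) * r%:R - 1) / 2) in hOT hTr hTrd.
set hr := Num.floor ((r%:R - 1 : R) / 2) in hTr hTrd.
have sc1 k : (k <= 6)%N -> 1 <= Rs k.
  by move=> k6; apply: le_trans (scale_ge1 a1 mono big k6); rewrite ler1n.
have [H [HE H1 H2]] := half_floor (sc1 0%N isT).
have [h3 [h3E h31 _]] := half_floor (sc1 3%N isT).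
have [rho [rhoE rho1 rho2]] := half_floor (sc1 6%N isT).
have OE a : Omega eps0 r a = ibox hO a by exact: boxE.
have TE a : tOmega eps0 r a = ibox hT a by exact: boxE.
have rE a : box (r%:R : R) a = ibox hr a by exact: boxE.
have QE : box (Rs 0%N) = ibox H%:Z by apply/funext => a; rewrite boxE HE.
have QsE : box (Rs 3%N) = ibox h3%:Z by apply/funext => a; rewrite boxE h3E.
have boxR6 a : box (Rs 6%N) a = ibox rho%:Z a by rewrite boxE rhoE.
have latQ := dyadic_half (erefl hr) dyQ HE.
have latq k := dyadic_half (erefl hr) (dyq k).1 h3E.
have GQ : G `<=` Q by move=> x /GQs[k _ kx]; exact: (dyq k).2.
rewrite /Q /Qs QE QsE in ThetaQ DQ QTheta reg loc GQ *.
clear dyq dyQ GQs Q Qs.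
set Rb := free_bits eps0 r h3 q D.
have ok b : Rb b -> _ := @free_bit_ok _ _ _ _ _ _ _ h3 K a0 q _ _ rE hO0 hOT hTr hTrd latQ DQ QTheta b.
have two X : two_valued Vbar (ibox H%:Z a0) (@pot _ (ibox H%:Z a0) Vbar X).
  exact: pot_two_valued.
have Rw := powR_ge0 Vbar (- Rs 5%N).
have adm b : Rb b -> admissible eps0 r V' b.
  move=> fb; have [X cX] := compat_exists (finite_ibox H%:Z a0) ThetaQ Vn0 V'2.
  have [] := loc (pot Vbar X) lambda0 0 Rb (two X) cX _ _ ok.
  - by rewrite lerBlDr lerDl Rw.
  - by rewrite lexx ler01.
  move=> /(_ b fb) + _; apply: admissible_ext => x fx.
  by apply: cX; apply: (frame_Theta OE rE hO0 hOT hTr hTrd latQ DQ QTheta) fx; case: fb.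
have locb (X : {set 'I_(num_sites (ibox H%:Z a0))}) t l (u : 'rV[R]_(num_sites (ibox H%:Z a0))) :
    compat Theta V' (pot Vbar X) -> 0 <= t <= 1 -> `|l - lambda0| <= Vbar `^ (- Rs 5%N) ->
    u *m cutH eps0 r (ibox H%:Z a0) (pot Vbar X) Rb t = l *: u ->
    norm2_on (ibox H%:Z a0 `\` \bigcup_(k in [set: 'I_K]) ibox h3%:Z (q k)) u <=
      ((Vbar `^ Rs 4%N)^-1) ^+ 2 * dotr u u /\ dotr u u <= 4 * norm2_on G u.
  move=> cX t01; rewrite ler_distl => ll uA.
  have [_] := loc (pot Vbar X) l t Rb (two X) cX ll t01 ok.
  move=> /(_ u^T); rewrite -{1}cutH_sym -trmx_mul uA linearZ /= => /(_ erefl)[hE hG].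
  apply: localized hE hG; first exact: powR_gt0.
  by rewrite powR_ge0 powRN invf_le1 ?powR_gt0 ?powR_ge1 ?sc1 ?(ltW d0) // (lt_le_trans ltr01) ?sc1.
have mL : (4 * num_sites G)%:R <= 4 * Rs 0%N `^ delta by rewrite natrM ler_wpM2l.
pose s := rung Rs Vbar; pose g := peak_number kap rho (num_sites (ibox hO (0%R, 0%R))).
have [l1 l6 lge lal] := ell_bounds a1 mono big rho1 rho2.
have ellE : ell (Rs 6%N) = 2 * rho%:R by rewrite /ell rhoE.
rewrite -ellE in l1 l6 lge lal.
have w0 : 0 < Vbar `^ (- Rs 5%N) := powU_gt0 U26 _.
have w1 : Vbar `^ (- Rs 5%N) <= 1 := powU_le1 a1 mono big U26 (isT : 5 <= 6)%N.
rewrite -(rung0 Rs Vbar).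
have tau0 : 0 <= ((Vbar `^ Rs 4%N)^-1) ^+ 2 by rewrite exprn_ge0 // invr_ge0 powR_ge0.
have b01 : 0 < Vbar `^ (- Rs 5%N) / 8 <= 1.
  by rewrite divr_gt0 //= ler_pdivrMr // mul1r (le_trans w1) // ler1n.
have bw : 8 * (Vbar `^ (- Rs 5%N) / 8) <= Vbar `^ (- Rs 5%N) by rewrite mulrC divfK.
have small := continuation_small d0 de e100 a1 mono step big U26 lnU rho1 h31 H1 l1 l6.
have s_uc : s 0%N <= (ell (Rs 6%N) * Vbar) `^ (- (alpha * ell (Rs 6%N))).
  by rewrite /s /rung mul0r addr0; exact: (continuation_window d0 de e100 a1 mono step big U26 lnU l1 l6).
have R6_100 : 100 <= Rs 6%N.
  by apply: le_trans (scale_ge1 a1 mono big (leqnn 6)); rewrite ler_nat.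
have many := peak_number_le kap0 rho off0.
rewrite /kap -mulrA in many.
have uc6 a : clear_center H h3 rho a0 q a -> 1 - expR (- (e * ell (Rs 6%N) `^ (2 / 3))) <= cond_prob P
    [set w | continuation_event e alpha (Rs 6%N) a (Theta `&` box (Rs 6%N) a) Vbar lambda0 (fun x => V x w)]
    [set w | forall x, (Theta `&` box (Rs 6%N) a) x -> V x w = V' x].
  move=> ca; have ba := clear_center_box boxR6 ca.
  apply: (uc a (Rs 6%N) (Theta `&` box (Rs 6%N) a)) => //; first exact: sc1.
  - exact/regular_capr/reg.
  - by apply: le_trans U26; rewrite ler_nat.
  - by move=> x [Tx _]; exact: V'2.
have core := (wegner_core OE TE rE hO0 hOT hTr hTrd latQ latq ThetaQ DQ QTheta adm GQ
  U0 w0 w1 tau0 b01 bw (powU_gt0 U26 _) (window_margin d0 de e100 a1 mono step big U26 lnU mL)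
  locb (rung_gt0 Rs U26) (fun k _ => rung_step a1 mono big U26 k)
  (rung_barrier d0 de e100 a1 mono step big U26 mL) (rung_top d0 de e100 a1 mono step big U26 mL)
  (peak_number_gt0 a1 hc2 kap0 mono big rho2 off0 Or (ler0n _ _) rc) V'2
  (box_margin d0 a1 mono step big rho1 h31 H2) boxR6 R6_100 l08 (lexx _) s_uc small e0 e1 reg many
  (expR_ge0 _) iidV uc6).
apply: le_trans core.
by rewrite lerD2l lerN2; exact: (failure_bound d0 de e100 a1 e0 hc2 kap0 mono step big rho2 H1 off0 Or (ler0n _ _) rc mL lge).
Qed.
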